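(* Let $k$ be a commutative ring and $G$ a group. Let $\mathbf a'\subset\mathbf a$ and $\mathbf b'\subset\mathbf b$ be functorial ideals of $k[F]$ (over $\mathrm{Pres}(G)$) such that $\mathbf a$ and $\mathbf b$ are flat as $k[F]$-modules. (1) If $\lim^1\mathbf a'\mathbf b=\lim^1\mathbf a\mathbf b'=\lim\mathbf a\mathbf b=0$, then $$\textstyle\lim^1\,\mathbf a'\mathbf b'\cong\lim\,\mathrm{Tor}^{k[F]}_1(\mathbf a/\mathbf a',\mathbf b/\mathbf b').$$ (2) If $n\ge1$ is such that $\lim^i\mathbf a'\mathbf b=\lim^i\mathbf a\mathbf b'=\lim^{i-1}\mathbf a\mathbf b=0$ for all $i\le n+1$, then there is an exact sequence $$\begin{aligned}0&\to\textstyle\lim^1\mathrm{Tor}^{k[F]}_1(\mathbf a/\mathbf a',\mathbf b/\mathbf b')\to\lim^2\mathbf a'\mathbf b'\to\lim^1(\mathbf a'\mathbf b+\mathbf a\mathbf b')\\&\to\textstyle\lim^2\mathrm{Tor}^{k[F]}_1(\mathbf a/\mathbf a',\mathbf b/\mathbf b')\to\lim^3\mathbf a'\mathbf b'\to\lim^2(\mathbf a'\mathbf b+\mathbf a\mathbf b')\to\cdots\\&\to\textstyle\lim^n\mathrm{Tor}^{k[F]}_1(\mathbf a/\mathbf a',\mathbf b/\mathbf b')\to\lim^{n+1}\mathbf a'\mathbf b'.\end{aligned}$$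
   Context: $\mathrm{Pres}(G)$ is the category of free extensions of $G$: objects are short exact sequences of groups $R\hookrightarrow F\twoheadrightarrow G$ with $F$ free; morphisms are commutative diagrams of such sequences that are the identity on $G$. A functorial ideal of $k[F]$ is an assignment to each object $R\hookrightarrow F\twoheadrightarrow G$ of a two-sided ideal of the group algebra $k[F]$, such that the maps $k[F_1]\to k[F_2]$ induced by morphisms of $\mathrm{Pres}(G)$ carry the ideal for the source into the ideal for the target; it is thus a functor from $\mathrm{Pres}(G)$ to $k$-modules. Products, sums, quotients and $\mathrm{Tor}$ groups (with $\mathbf a/\mathbf a'$ as a right and $\mathbf b/\mathbf b'$ as a left $k[F]$-module) are formed objectwise. $\lim^i$ is the $i$-th right derived functor of $\lim:\mathrm{Fun}(\mathrm{Pres}(G),\mathrm{Mod}(k))\to\mathrm{Mod}(k)$, with $\lim^i=0$ for $i<0$; since $\mathrm{Pres}(G)$ has binary coproducts and a morphism between any two objects, $\lim^i\mathcal F$ is the $i$-th cohomotopy group of the cosimplicial module $[m]\mapsto \mathcal F(c^{\sqcup (m+1)})$ for any object $c$. *)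

(* Defs.v *)
From HB Require Import structures.
From mathcomp Require Import all_boot all_algebra.
From mathcomp Require Import boolp classical_sets functions cardinality fsbigop.

Set Implicit Arguments.
Unset Strict Implicit.
Unset Printing Implicit Defensive.

Import GRing.Theory.
Local Open Scope ring_scope.
Local Open Scope quotient_scope.

Section Submodules.
Variables (R : pzRingType) (V : lmodType R).

Record submod := Submod {
  in_submod :> V -> Prop;
  submod0 : in_submod 0;
  submodD : forall x y, in_submod x -> in_submod y -> in_submod (x + y);
  submodZ : forall a x, in_submod x -> in_submod (a *: x) }.

Lemma submodN (S : submod) x : S x -> S (- x).
Proof. by rewrite -scaleN1r; apply: submodZ. Qed.

Lemma submodB (S : submod) x y : S x -> S y -> S (x - y).
Proof. by move=> Sx Sy; apply/submodD/submodN. Qed.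

Definition submod_pred (S : submod) : {pred V} := fun x => `[< S x >].

Record submod_type (S : submod) :=
  SubmodElt { submod_val : V; _ : submod_pred S submod_val }.

Fact submod_closed_pred (S : submod) : subsemimod_closed (submod_pred S).
Proof.
split=> [|a x]; last by move=> /asboolP Sx; apply/asboolP/submodZ.
split; first exact/asboolP/submod0.
by move=> x y /asboolP Sx /asboolP Sy; apply/asboolP/submodD.
Qed.

HB.instance Definition _ (S : submod) := [isSub for @submod_val S].
HB.instance Definition _ (S : submod) := [Choice of submod_type S by <:].
HB.instance Definition _ (S : submod) :=
  GRing.SubChoice_isSubLmodule.Build R V (submod_pred S) (submod_type S)
    (submod_closed_pred S).

Lemma submod_valP (S : submod) (x : submod_type S) : S (val x).
Proof. exact/asboolP/(valP x). Qed.

Definition insubmod (S : submod) x (Sx : S x) : submod_type S :=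
  SubmodElt (introT (asboolP _) Sx).

(* The submodule generated by P. *)
Definition span (P : V -> Prop) : submod.
Proof.
exists (fun x => forall S : submod, (forall y, P y -> S y) -> S x).
- by move=> S _; apply: submod0.
- by move=> x y Hx Hy S PS; apply: submodD; [apply: Hx | apply: Hy].
- by move=> a x Hx S PS; apply/submodZ/Hx.
Defined.

Definition quot_rel (S : submod) (x y : V) := `[< S (x - y) >].

Fact quot_rel_equiv (S : submod) : equiv_class_of (quot_rel S).
Proof.
split=> [x|x y|y x z].
- by apply/asboolP; rewrite subrr; apply: submod0.
- by apply/asboolP/asboolP => /submodN; rewrite opprB.
- move=> /asboolP Sxy /asboolP Syz; apply/asboolP.
  by rewrite -(subrKA y); apply: submodD.
Qed.

Canonical quot_rel_canonical (S : submod) :=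
  EquivRelPack (quot_rel_equiv S).

Definition quot (S : submod) : Type := {eq_quot quot_rel S}.
HB.instance Definition _ (S : submod) := Choice.on (quot S).
HB.instance Definition _ (S : submod) := EqQuotient.on (quot S).

Section QuotientModule.
Variable S : submod.

Definition qpi (x : V) : quot S := \pi_(quot S) x.

Lemma qpi_eq x y : (qpi x = qpi y) <-> S (x - y).
Proof.
by split=> [/eqP|Sxy]; [rewrite eqmodE => /asboolP|apply/eqP; rewrite eqmodE; apply/asboolP].
Qed.

Lemma qpi_repr (u : quot S) : qpi (repr u) = u.
Proof. exact: reprK. Qed.

Lemma repr_qpi x : S (repr (qpi x) - x).
Proof. by apply/qpi_eq; rewrite qpi_repr. Qed.

Definition quot_add (u v : quot S) := qpi (repr u + repr v).
Definition quot_opp (u : quot S) := qpi (- repr u).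
Definition quot_scale (a : R) (u : quot S) := qpi (a *: repr u).

Fact qpiD x y : quot_add (qpi x) (qpi y) = qpi (x + y).
Proof.
by apply/qpi_eq; rewrite opprD addrACA; apply: submodD; apply: repr_qpi.
Qed.

Fact qpiN x : quot_opp (qpi x) = qpi (- x).
Proof. by apply/qpi_eq; rewrite -opprD; apply/submodN/repr_qpi. Qed.

Fact qpiZ a x : quot_scale a (qpi x) = qpi (a *: x).
Proof. by apply/qpi_eq; rewrite -scalerBr; apply/submodZ/repr_qpi. Qed.

Fact quot_addA : associative quot_add.
Proof.
move=> u v w; rewrite -[u]qpi_repr -[v]qpi_repr -[w]qpi_repr.
by rewrite !qpiD addrA.
Qed.

Fact quot_addC : commutative quot_add.
Proof. by move=> u v; rewrite -[u]qpi_repr -[v]qpi_repr !qpiD addrC. Qed.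

Fact quot_add0 : left_id (qpi 0) quot_add.
Proof. by move=> u; rewrite -[u]qpi_repr !qpiD add0r. Qed.

Fact quot_addN : left_inverse (qpi 0) quot_opp quot_add.
Proof. by move=> u; rewrite -[u]qpi_repr qpiN qpiD addNr. Qed.

HB.instance Definition _ :=
  GRing.isZmodule.Build (quot S) quot_addA quot_addC quot_add0 quot_addN.

Fact quot_scaleA a b u : quot_scale a (quot_scale b u) = quot_scale (a * b) u.
Proof. by rewrite -[u]qpi_repr !qpiZ scalerA. Qed.

Fact quot_scale1 : left_id 1 quot_scale.
Proof. by move=> u; rewrite -[u]qpi_repr qpiZ scale1r. Qed.

Fact quot_scaleDr : right_distributive quot_scale +%R.
Proof.
move=> a u v; rewrite -[u]qpi_repr -[v]qpi_repr.
by rewrite [_ + _]qpiD !qpiZ [RHS]qpiD scalerDr.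
Qed.

Fact quot_scaleDl u : {morph quot_scale^~ u : a b / a + b}.
Proof.
by move=> a b; rewrite /= -[u]qpi_repr !qpiZ [RHS]qpiD scalerDl.
Qed.

HB.instance Definition _ := GRing.Zmodule_isLmodule.Build R (quot S)
  quot_scaleA quot_scale1 quot_scaleDr quot_scaleDl.

Fact qpi_linear : linear qpi.
Proof. by move=> a x y; rewrite -qpiD -qpiZ. Qed.

HB.instance Definition _ := GRing.isLinear.Build R V (quot S) *:%R qpi qpi_linear.

End QuotientModule.

End Submodules.

Arguments submod {R} V.
Arguments insubmod {R V} S {x} Sx.
Arguments qpi {R V} S x.

Section SemilinearMaps.
Variables (R S : pzRingType) (phi : R -> S) (U : lmodType R) (V : lmodType S).

Fact addmorph_nmod (f : U -> V) :
  {morph f : x y / x + y} -> GRing.nmod_morphism f.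
Proof. by move=> fD; split=> //; apply: (addIr (f 0)); rewrite -fD !add0r. Qed.

Definition mk_semilinear (f : U -> V) (fD : {morph f : x y / x + y})
    (fZ : forall a x, f (a *: x) = phi a *: f x) :
  {linear U -> V | phi \; *:%R} :=
  HB.pack f (GRing.isNmodMorphism.Build U V f (addmorph_nmod fD))
    (GRing.isScalable.Build R U V (phi \; *:%R) f fZ).

End SemilinearMaps.

Arguments mk_semilinear : simpl never.

Section LinearMaps.
Variables (R : pzRingType) (U V W : lmodType R).

Definition mk_linear (f : U -> V) (fD : {morph f : x y / x + y})
    (fZ : forall a x, f (a *: x) = a *: f x) : {linear U -> V} :=
  mk_semilinear (phi := idfun) fD fZ.

Definition ker (f : {linear U -> V}) : submod U.
Proof.
exists (fun x => f x = 0); first exact: linear0.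
- by move=> x y fx fy; rewrite linearD fx fy addr0.
- by move=> a x fx; rewrite linearZ_LR fx scaler0.
Defined.

Definition im (f : {linear U -> V}) : submod V.
Proof.
exists (fun y => exists x, f x = y); first by exists 0; rewrite linear0.
- by move=> _ _ [x <-] [y <-]; exists (x + y); rewrite linearD.
- by move=> a _ [x <-]; exists (a *: x); rewrite linearZ_LR.
Defined.

End LinearMaps.

Section Modules.
Variables (R : pzRingType) (V : lmodType R).

Definition submodule (Z : submod V) : lmodType R :=
  GRing.Lmodule.clone R (submod_type Z) _.

Definition quotient (B : submod V) : lmodType R :=
  GRing.Lmodule.clone R (quot B) _.

End Modules.

Section Subquotients.
Variables (R : pzRingType) (V : lmodType R).

Definition comap (Z B : submod V) : submod (submodule Z).
Proof.
exists (fun x : submod_type Z => B (val x)).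
- exact: (submod0 B).
- by move=> x y; apply: (@submodD _ _ B).
- by move=> a x; apply: (@submodZ _ _ B).
Defined.

(* The quotient Z / (Z :&: B), which is Z / B when B is contained in Z. *)
Definition subquot (Z B : submod V) : lmodType R := quotient (comap Z B).

End Subquotients.

Definition homology (R : pzRingType) (U V W : lmodType R)
  (f : {linear U -> V}) (g : {linear V -> W}) : lmodType R :=
  subquot (ker g) (im f).

Section InducedMaps.
Variables (R S : pzRingType) (phi : R -> S) (U : lmodType R) (V : lmodType S).
Variable f : {linear U -> V | phi \; *:%R}.

Section Submod.
Variables (Z : submod U) (Z' : submod V) (fZ : forall x, Z x -> Z' (f x)).

Definition submod_map_fun (x : submod_type Z) : submod_type Z' :=
  insubmod Z' (fZ (submod_valP x)).

Fact submod_map_D : {morph submod_map_fun : x y / x + y}.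
Proof. by move=> x y; apply: val_inj; rewrite /= linearD. Qed.

Fact submod_map_Z a x : submod_map_fun (a *: x) = phi a *: submod_map_fun x.
Proof. by apply: val_inj; rewrite /= linearZ_LR. Qed.

Definition submod_map : {linear submodule Z -> submodule Z' | phi \; *:%R} :=
  mk_semilinear submod_map_D submod_map_Z.
End Submod.

Section Quot.
Variables (B : submod U) (B' : submod V) (fB : forall x, B x -> B' (f x)).

Definition quot_map_fun (u : quot B) : quot B' := qpi B' (f (repr u)).

Fact quot_map_qpi x : quot_map_fun (qpi B x) = qpi B' (f x).
Proof. by apply/qpi_eq; rewrite -linearB; apply/fB/repr_qpi. Qed.

Fact quot_map_D : {morph quot_map_fun : x y / x + y}.
Proof.
move=> u v; rewrite -[u]qpi_repr -[v]qpi_repr -linearD !quot_map_qpi.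
by rewrite !linearD.
Qed.

Fact quot_map_Z a u : quot_map_fun (a *: u) = phi a *: quot_map_fun u.
Proof.
rewrite -[u]qpi_repr -[a *: _]linearZ_LR !quot_map_qpi.
by rewrite -[RHS]linearZ_LR (linearZ_LR f).
Qed.

Definition quot_map : {linear quotient B -> quotient B' | phi \; *:%R} :=
  mk_semilinear quot_map_D quot_map_Z.
End Quot.
End InducedMaps.

Section SubquotMap.
Variables (R S : pzRingType) (phi : R -> S) (U : lmodType R) (V : lmodType S).
Variable f : {linear U -> V | phi \; *:%R}.
Variables (Z B : submod U) (Z' B' : submod V).
Hypothesis fZ : forall x, Z x -> Z' (f x).
Hypothesis fB : forall x, B x -> B' (f x).

Definition subquot_map : {linear subquot Z B -> subquot Z' B' | phi \; *:%R} :=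
  @quot_map _ _ phi _ _ (submod_map fZ) (comap Z B) (comap Z' B')
    (fun x => fB (x := val x)).

End SubquotMap.

Lemma quot_map_id (R : pzRingType) (phi : R -> R) (U : lmodType R)
    (f : {linear U -> U | phi \; *:%R}) (B : submod U)
    (fB : forall x, B x -> B (f x)) : f =1 id -> quot_map fB =1 id.
Proof. by move=> f_id u; rewrite -[u]qpi_repr [LHS](quot_map_qpi fB) f_id. Qed.

Lemma quot_map_comp (R S T : pzRingType) (phi : R -> S) (psi : S -> T)
    (chi : R -> T) (U : lmodType R) (V : lmodType S) (W : lmodType T)
    (f : {linear U -> V | phi \; *:%R}) (g : {linear V -> W | psi \; *:%R})
    (gf : {linear U -> W | chi \; *:%R}) (A : submod U) (B : submod V)
    (C : submod W) (fA : forall x, A x -> B (f x))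
    (gB : forall x, B x -> C (g x)) (gfA : forall x, A x -> C (gf x)) :
  (forall x, gf x = g (f x)) ->
  forall u, quot_map gfA u = quot_map gB (quot_map fA u).
Proof.
move=> gfE u; rewrite -[u]qpi_repr [LHS](quot_map_qpi gfA) gfE.
by rewrite [quot_map fA _](quot_map_qpi fA) [RHS](quot_map_qpi gB).
Qed.

Lemma subquot_map_id (R : pzRingType) (phi : R -> R) (U : lmodType R)
    (f : {linear U -> U | phi \; *:%R}) (Z B : submod U)
    (fZ : forall x, Z x -> Z (f x)) (fB : forall x, B x -> B (f x)) :
  f =1 id -> subquot_map fZ fB =1 id.
Proof. by move=> f_id; apply: quot_map_id => x; apply: val_inj; apply: f_id. Qed.

Lemma subquot_map_comp (R S T : pzRingType) (phi : R -> S) (psi : S -> T)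
    (chi : R -> T) (U : lmodType R) (V : lmodType S) (W : lmodType T)
    (f : {linear U -> V | phi \; *:%R}) (g : {linear V -> W | psi \; *:%R})
    (gf : {linear U -> W | chi \; *:%R}) (Z B : submod U) (Z' B' : submod V)
    (Z'' B'' : submod W)
    (fZ : forall x, Z x -> Z' (f x)) (fB : forall x, B x -> B' (f x))
    (gZ : forall x, Z' x -> Z'' (g x)) (gB : forall x, B' x -> B'' (g x))
    (gfZ : forall x, Z x -> Z'' (gf x)) (gfB : forall x, B x -> B'' (gf x)) :
  (forall x, gf x = g (f x)) ->
  forall u, subquot_map gfZ gfB u = subquot_map gZ gB (subquot_map fZ fB u).
Proof. by move=> gfE; apply: quot_map_comp => x; apply: val_inj; apply: gfE. Qed.

Section FreeModule.
Variables (R : pzRingType) (X : choiceType).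

Definition finsupp : submod (GRing.Lmodule.clone R (X -> R^o) _).
Proof.
exists (fun u => finite_set [set x | u x != 0]%classic).
- by rewrite (_ : [set _ | _]%classic = set0) // -subset0 => x /=; rewrite eqxx.
- move=> u v fu fv; apply: (@sub_finite_set _ _ _ _ (_ : finite_set (_ `|` _)%classic)).
    2: by rewrite finite_setU; split; [exact: fu | exact: fv].
  move=> x /= uvx; apply/orP; rewrite -negb_and; apply: contra uvx.
  by move=> /andP[/eqP ux /eqP vx]; apply/eqP; rewrite [LHS](_ : _ = u x + v x) // ux vx addr0.
- move=> a u; apply: sub_finite_set => x /=; apply: contra => /eqP ux.
  by apply/eqP; rewrite [LHS](_ : _ = a *: u x) // ux scaler0.
Defined.

Definition freemod : lmodType R := submodule finsupp.

Definition coef (u : freemod) (x : X) : R := submod_val u x.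

Fact delta_finsupp (x : X) : finsupp (fun y => (y == x)%:R).
Proof.
apply: (@sub_finite_set _ _ [set x]%classic) => // y /=.
by case: (y =P x) => // _; rewrite eqxx.
Qed.

Definition delta (x : X) : freemod := insubmod finsupp (delta_finsupp x).

Lemma deltaE x y : coef (delta x) y = (y == x)%:R.
Proof. by []. Qed.

Lemma coef_inj (u v : freemod) : coef u =1 coef v -> u = v.
Proof. by move=> uv; apply: val_inj; apply: funext. Qed.

Lemma coefD (u v : freemod) x : coef (u + v) x = coef u x + coef v x.
Proof. by []. Qed.

Lemma coefZ a (u : freemod) x : coef (a *: u) x = a * coef u x.
Proof. by []. Qed.

Lemma coef_sum (I : Type) (r : seq I) (F : I -> freemod) x :
  coef (\sum_(i <- r) F i) x = \sum_(i <- r) coef (F i) x.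
Proof. by elim/big_rec2: _ => // i y u _ <-; rewrite coefD. Qed.

Lemma freemod_seq (u : freemod) :
  exists2 r : seq X, uniq r & forall x, coef u x != 0 -> x \in r.
Proof.
have /finite_seqP[r ur] := submod_valP u.
exists (undup r); first exact: undup_uniq.
by move=> x ux; rewrite mem_undup; have : [set` r]%classic x by rewrite -ur.
Qed.

End FreeModule.

Arguments coef {R X} : simpl never.
Arguments delta R {X} : simpl never.

Section FreeExtension.
Variables (R S : pzRingType) (phi : {rmorphism R -> S}) (X : choiceType).
Variables (V : lmodType S) (h : X -> V).

Definition free_ext_fun (u : freemod R X) : V :=
  \sum_(x \in [set: X]) phi (coef u x) *: h x.

Lemma free_ext_seq (r : seq X) (u : freemod R X) : uniq r ->
    (forall x, coef u x != 0 -> x \in r) ->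
  free_ext_fun u = \sum_(x <- r) phi (coef u x) *: h x.
Proof.
move=> r_uniq ru; rewrite /free_ext_fun (fsbigE r) //.
  by apply: eq_bigl => x; rewrite in_setT.
move=> x _ xr; have [->|/ru] := eqVneq (coef u x) 0; last by rewrite (negPf xr).
by rewrite rmorph0 scale0r.
Qed.

Fact free_ext_D : {morph free_ext_fun : u v / u + v}.
Proof.
move=> u v; have [[r _ ru] [s _ sv]] := (freemod_seq u, freemod_seq v).
have t_uniq := undup_uniq (r ++ s).
have tu x : coef u x != 0 -> x \in undup (r ++ s).
  by rewrite mem_undup mem_cat => /ru ->.
have tv x : coef v x != 0 -> x \in undup (r ++ s).
  by rewrite mem_undup mem_cat => /sv ->; rewrite orbT.
rewrite (free_ext_seq t_uniq tu) (free_ext_seq t_uniq tv) (free_ext_seq t_uniq).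
  rewrite -big_split; apply: eq_bigr => x _ /=.
  by rewrite -scalerDl -rmorphD.
move=> x; have [ux0|/tu //] := eqVneq (coef u x) 0.
have [vx0|/tv //] := eqVneq (coef v x) 0.
by rewrite coefD ux0 vx0 addr0 eqxx.
Qed.

Fact free_ext_Z a u : free_ext_fun (a *: u) = phi a *: free_ext_fun u.
Proof.
have [r r_uniq ru] := freemod_seq u.
rewrite !(free_ext_seq r_uniq) // => [|x].
  by rewrite scaler_sumr; apply: eq_bigr => x _; rewrite scalerA -rmorphM.
have [ux0|/ru //] := eqVneq (coef u x) 0.
by rewrite coefZ ux0 mulr0 eqxx.
Qed.

Definition free_ext : {linear freemod R X -> V | phi \; *:%R} :=
  mk_semilinear free_ext_D free_ext_Z.

Lemma free_ext_delta x : free_ext (delta R x) = h x.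
Proof.
rewrite [LHS](@free_ext_seq [:: x]) // => [|y].
  by rewrite big_seq1 deltaE eqxx rmorph1 scale1r.
by rewrite deltaE inE; case: (y == x); rewrite // eqxx.
Qed.

End FreeExtension.

Lemma freemod_sum (R : pzRingType) (X : choiceType) (r : seq X)
    (u : freemod R X) : uniq r -> (forall x, coef u x != 0 -> x \in r) ->
  u = \sum_(x <- r) coef u x *: delta R x.
Proof.
move=> r_uniq ru; apply: coef_inj => y; rewrite coef_sum.
have [yr|yr] := boolP (y \in r).
  rewrite (bigD1_seq y) //= big1 ?addr0 => [|x /negPf xy].
    by rewrite coefZ deltaE eqxx mulr1.
  by rewrite coefZ deltaE eq_sym xy mulr0.
rewrite big1_seq => [|x /= xr].
  by apply/eqP; apply: contraNT yr; apply: ru.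
rewrite coefZ deltaE; case: eqP => [yx|]; last by rewrite mulr0.
by rewrite yx xr in yr.
Qed.

Lemma free_ext_unique (R S : pzRingType) (phi : R -> S) (X : choiceType)
    (V : lmodType S) (f g : {linear freemod R X -> V | phi \; *:%R}) :
  (forall x, f (delta R x) = g (delta R x)) -> f =1 g.
Proof.
move=> fg u; have [r r_uniq ru] := freemod_seq u.
rewrite (freemod_sum r_uniq ru) !linear_sum; apply: eq_bigr => x _.
by rewrite !linearZ_LR /= fg.
Qed.

Lemma freemod_ind (R : pzRingType) (X : choiceType) (P : freemod R X -> Prop) :
  P 0 -> (forall u v, P u -> P v -> P (u + v)) ->
  (forall a u, P u -> P (a *: u)) -> (forall x, P (delta R x)) ->
  forall u, P u.
Proof.
move=> P0 PD PZ Pdelta u; have [r r_uniq ru] := freemod_seq u.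
rewrite (freemod_sum r_uniq ru); elim/big_ind: _ => // x _.
exact: PZ.
Qed.

Definition lin_ext (R : pzRingType) (X : choiceType) (V : lmodType R)
  (h : X -> V) : {linear freemod R X -> V} := free_ext idfun h.

Lemma lin_ext_delta (R : pzRingType) (X : choiceType) (V : lmodType R)
  (h : X -> V) x : lin_ext h (delta R x) = h x.
Proof. exact: free_ext_delta. Qed.

Arguments free_ext : simpl never.
Arguments lin_ext : simpl never.

Section FreeMap.
Variables (R S : pzRingType) (phi : {rmorphism R -> S}) (X Y : choiceType).

Definition free_map (h : X -> Y) : {linear freemod R X -> freemod S Y | phi \; *:%R} :=
  free_ext phi (fun x => delta S (h x)).

Lemma free_map_delta h x : free_map h (delta R x) = delta S (h x).
Proof. exact: free_ext_delta. Qed.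

End FreeMap.

Arguments free_map : simpl never.

Lemma free_map_id (R : pzRingType) (phi : {rmorphism R -> R}) (X : choiceType)
  (h : X -> X) : phi =1 id -> h =1 id -> free_map phi h =1 id.
Proof.
move=> phi_id h_id; elim/freemod_ind => [|u v IHu IHv|a u IH|x].
- exact: linear0.
- by rewrite linearD IHu IHv.
- by rewrite linearZ_LR IH /= phi_id.
- by rewrite free_map_delta h_id.
Qed.

Lemma free_map_comp (R S T : pzRingType) (phi : {rmorphism R -> S})
  (psi : {rmorphism S -> T}) (chi : {rmorphism R -> T}) (X Y Z : choiceType)
  (h : X -> Y) (g : Y -> Z) (gh : X -> Z) :
  chi =1 psi \o phi -> gh =1 g \o h ->
  forall u, free_map chi gh u = free_map psi g (free_map phi h u).
Proof.
move=> chiE ghE; elim/freemod_ind => [|u v IHu IHv|a u IH|x].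
- by rewrite !linear0.
- by rewrite !linearD IHu IHv.
- by rewrite linearZ_LR IH [in RHS]linearZ_LR [RHS]linearZ_LR /= chiE.
- by rewrite !free_map_delta ghE.
Qed.

Section Tensor.
Variables (k : comPzRingType) (R : pzRingType) (iota : k -> R).
Variables (M : lmodType R^c) (N : lmodType R).

(* M (x)_R N, generated over k: here iota is the structure map of the k-algebra
   R, so its image is central. *)
Inductive tens_rel : freemod k (M * N)%type -> Prop :=
| tens_rel_addl m m' n :
    tens_rel (delta k (m + m', n) - (delta k (m, n) + delta k (m', n)))
| tens_rel_addr m n n' :
    tens_rel (delta k (m, n + n') - (delta k (m, n) + delta k (m, n')))
| tens_rel_mid m (r : R) n :
    tens_rel (delta k ((r : R^c) *: m, n) - delta k (m, r *: n))
| tens_rel_scal (a : k) m n :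
    tens_rel (delta k (m, iota a *: n) - a *: delta k (m, n)).

Definition tens : lmodType k := quotient (span tens_rel).

Definition ptens (m : M) (n : N) : tens := qpi (span tens_rel) (delta k (m, n)).

End Tensor.

Section TensorMap.
Variables (k : comPzRingType) (R S : pzRingType).
Variables (iota : k -> R) (iota' : k -> S) (phi : R -> S).
Hypothesis phi_iota : forall a, phi (iota a) = iota' a.
Variables (M : lmodType R^c) (N : lmodType R).
Variables (M' : lmodType S^c) (N' : lmodType S).
Variable f : {linear M -> M' | (phi : R^c -> S^c) \; *:%R}.
Variable g : {linear N -> N' | phi \; *:%R}.

Definition tens_pair : {linear freemod k (M * N)%type -> freemod k (M' * N')%type} :=
  free_map idfun (fun p => (f p.1, g p.2)).

Fact tens_pair_span u :
  span (tens_rel iota (M := M) (N := N)) u ->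
  span (tens_rel iota' (M := M') (N := N')) (tens_pair u).
Proof.
pose T := span (tens_rel iota' (M := M') (N := N')).
have T0 : T (tens_pair 0) by rewrite linear0; apply: submod0.
have TD v w : T (tens_pair v) -> T (tens_pair w) -> T (tens_pair (v + w)).
  by rewrite linearD; apply: submodD.
have TZ a v : T (tens_pair v) -> T (tens_pair (a *: v)).
  by rewrite linearZ_LR; apply: submodZ.
have pairE m n : tens_pair (delta k (m, n)) = delta k (f m, g n).
  exact: free_map_delta.
suff relT v : tens_rel iota v -> T (tens_pair v).
  by move=> /(_ (Submod T0 TD TZ)); apply.
case=> [m m' n|m n n'|m r n|a m n] W; apply.
- rewrite linearB linearD !pairE linearD; exact: tens_rel_addl.
- rewrite linearB linearD !pairE linearD; exact: tens_rel_addr.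
- rewrite linearB !pairE !linearZ_LR; exact: tens_rel_mid.
- rewrite linearB [tens_pair (_ *: _)]linearZ_LR !pairE linearZ_LR /= phi_iota.
  exact: tens_rel_scal.
Qed.

Definition tens_map : {linear tens iota M N -> tens iota' M' N'} :=
  quot_map tens_pair_span.

Lemma tens_map_ptens m n :
  tens_map (ptens iota m n) = ptens iota' (f m) (g n).
Proof. by rewrite [LHS](quot_map_qpi tens_pair_span); congr qpi; exact: free_map_delta. Qed.

End TensorMap.

Lemma tens_ind (k : comPzRingType) (R : pzRingType) (iota : k -> R)
    (M : lmodType R^c) (N : lmodType R) (P : tens iota M N -> Prop) :
  P 0 -> (forall t u, P t -> P u -> P (t + u)) ->
  (forall a t, P t -> P (a *: t)) -> (forall m n, P (ptens iota m n)) ->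
  forall t, P t.
Proof.
move=> P0 PD PZ Pp t; rewrite -[t]qpi_repr.
elim/freemod_ind: (repr t) => [|u v IHu IHv|a u IH|[m n]]; last exact: Pp.
- by rewrite linear0.
- by rewrite linearD; apply: PD.
- by rewrite linearZ_LR; apply: PZ.
Qed.

Section Flatness.
Variables (k : comPzRingType) (R : pzRingType) (iota : k -> R).

Definition tens_mapr (M : lmodType R^c) (N N' : lmodType R)
  (g : {linear N -> N'}) : {linear tens iota M N -> tens iota M N'} :=
  @tens_map k R R iota iota idfun (fun=> erefl) M N M N' idfun g.

Definition tens_mapl (M M' : lmodType R^c) (N : lmodType R)
  (f : {linear M -> M'}) : {linear tens iota M N -> tens iota M' N} :=
  @tens_map k R R iota iota idfun (fun=> erefl) M N M' N f idfun.

(* A right R-module is an lmodType over the converse ring R^c. *)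
Definition right_flat (M : lmodType R^c) : Prop :=
  forall (N N' : lmodType R) (g : {linear N -> N'}),
    injective g -> injective (tens_mapr M g).

Definition left_flat (N : lmodType R) : Prop :=
  forall (M M' : lmodType R^c) (f : {linear M -> M'}),
    injective f -> injective (tens_mapl N f).

End Flatness.

(* The converse of a ring morphism, for right modules. *)
Definition conv_morph (R S : pzRingType) (phi : R -> S) : R^c -> S^c := phi.

Section ConverseMorphism.
Variables (R S : pzRingType) (phi : {rmorphism R -> S}).

Fact conv_morph_nmod : nmod_morphism (conv_morph phi).
Proof. by split; [exact: (rmorph0 phi) | exact: (rmorphD phi)]. Qed.

Fact conv_morph_monoid : monoid_morphism (conv_morph phi).
Proof. by split=> [|x y]; [exact: (rmorph1 phi) | exact: (rmorphM phi y x)]. Qed.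

HB.instance Definition _ :=
  GRing.isNmodMorphism.Build R^c S^c (conv_morph phi) conv_morph_nmod.
HB.instance Definition _ :=
  GRing.isMonoidMorphism.Build R^c S^c (conv_morph phi) conv_morph_monoid.
End ConverseMorphism.

Section Cover.
Variables (R : pzRingType) (P Q : lmodType R) (d : {linear P -> Q}).

(* One step of the functorial free resolution: the free module on the
   underlying set of ker d, with its evaluation map to P. *)
Definition cover : lmodType R := freemod R (submodule (ker d)).

Definition cover_map : {linear cover -> P} :=
  lin_ext (fun x : submodule (ker d) => submod_val x).

Lemma cover_map_delta x : cover_map (delta R x) = submod_val x.
Proof. exact: lin_ext_delta. Qed.

End Cover.

Section CoverFunctor.
Variables (R S : pzRingType) (phi : {rmorphism R -> S}).
Variables (P Q : lmodType R) (d : {linear P -> Q}).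
Variables (P' Q' : lmodType S) (d' : {linear P' -> Q'}).
Variables (p : {linear P -> P' | phi \; *:%R}) (q : {linear Q -> Q' | phi \; *:%R}).
Hypothesis pq : forall x, d' (p x) = q (d x).

Fact cover_ker x : ker d x -> ker d' (p x).
Proof. by move=> dx; rewrite /= pq dx linear0. Qed.

Definition cover_lift : {linear cover d -> cover d' | phi \; *:%R} :=
  free_map phi (submod_map cover_ker).

Lemma cover_liftP u : cover_map d' (cover_lift u) = p (cover_map d u).
Proof.
elim/freemod_ind: u => [|u v IHu IHv|a u IH|x].
- by rewrite !linear0.
- by rewrite !linearD IHu IHv.
- by rewrite [in LHS]linearZ_LR [LHS]linearZ_LR IH [in RHS]linearZ_LR [RHS]linearZ_LR.
- by rewrite [cover_lift _]free_map_delta !cover_map_delta.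
Qed.

End CoverFunctor.

(* Tor_1 as a functor of the ring and of the two modules: the homology in
   degree 1 of F2 (x) N -> F1 (x) N -> F0 (x) N, for the functorial free
   resolution F of the right module M. *)
Section Tor.
Variables (k : comPzRingType) (R : pzRingType) (iota : k -> R).

Section FreeResolution.
Variable M : lmodType R^c.

Definition tor_aug : {linear freemod R^c M -> M} := lin_ext (fun x : M => x).
Definition tor_d1 : {linear cover tor_aug -> freemod R^c M} := cover_map tor_aug.
Definition tor_d2 : {linear cover tor_d1 -> cover tor_aug} := cover_map tor_d1.

End FreeResolution.

Definition Tor1 (M : lmodType R^c) (N : lmodType R) : lmodType k :=
  homology (tens_mapl iota N (tor_d2 M)) (tens_mapl iota N (tor_d1 M)).

End Tor.

Section TorMap.
Variables (k : comPzRingType) (R S : pzRingType).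
Variables (iota : k -> R) (iota' : k -> S) (phi : {rmorphism R -> S}).
Hypothesis phi_iota : forall a, phi (iota a) = iota' a.
Variables (M : lmodType R^c) (N : lmodType R).
Variables (M' : lmodType S^c) (N' : lmodType S).
Variable f : {linear M -> M' | conv_morph phi \; *:%R}.
Variable g : {linear N -> N' | phi \; *:%R}.

Definition tor_lift0 : {linear freemod R^c M -> freemod S^c M' | conv_morph phi \; *:%R} :=
  @free_map R^c S^c (conv_morph phi) M M' f.

Fact tor_lift0P u : tor_aug M' (tor_lift0 u) = f (tor_aug M u).
Proof.
elim/freemod_ind: u => [|u v IHu IHv|a u IH|x].
- by rewrite !linear0.
- by rewrite !linearD IHu IHv.
- by rewrite [in LHS]linearZ_LR [LHS]linearZ_LR IH [in RHS]linearZ_LR [RHS]linearZ_LR.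
- by rewrite [tor_lift0 _]free_map_delta [LHS]lin_ext_delta [tor_aug M _]lin_ext_delta.
Qed.

Definition tor_lift1 := cover_lift tor_lift0P.
Definition tor_lift2 := cover_lift (cover_liftP tor_lift0P).

Definition tor_tens1 := tens_map phi_iota tor_lift1 g.

Fact tor_tens1_d1 t : tens_mapl iota' N' (tor_d1 M') (tor_tens1 t) =
  tens_map phi_iota tor_lift0 g (tens_mapl iota N (tor_d1 M) t).
Proof.
elim/tens_ind: t => [|t u IHt IHu|a t IH|m n].
- by rewrite !linear0.
- by rewrite !linearD IHt IHu.
- by rewrite [in LHS]linearZ_LR [LHS]linearZ_LR IH [in RHS]linearZ_LR [RHS]linearZ_LR.
rewrite [tor_tens1 _]tens_map_ptens [LHS]tens_map_ptens.
rewrite [tens_mapl _ _ _ _]tens_map_ptens [RHS]tens_map_ptens.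
by rewrite [tor_d1 _ _](cover_liftP tor_lift0P).
Qed.

Fact tor_tens1_d2 t : tor_tens1 (tens_mapl iota N (tor_d2 M) t) =
  tens_mapl iota' N' (tor_d2 M') (tens_map phi_iota tor_lift2 g t).
Proof.
elim/tens_ind: t => [|t u IHt IHu|a t IH|m n].
- by rewrite !linear0.
- by rewrite !linearD IHt IHu.
- by rewrite [in LHS]linearZ_LR [LHS]linearZ_LR IH [in RHS]linearZ_LR [RHS]linearZ_LR.
rewrite [tens_map _ _ _ _]tens_map_ptens [RHS]tens_map_ptens.
rewrite [tens_mapl _ _ _ _]tens_map_ptens [LHS]tens_map_ptens.
by rewrite [tor_d2 M' _](cover_liftP (cover_liftP tor_lift0P)).
Qed.

Fact tor_map_ker t : ker (tens_mapl iota N (tor_d1 M)) t ->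
  ker (tens_mapl iota' N' (tor_d1 M')) (tor_tens1 t).
Proof. by move=> dt; apply: (etrans (tor_tens1_d1 t)); rewrite [tens_mapl _ _ _ _]dt linear0. Qed.

Fact tor_map_im t : im (tens_mapl iota N (tor_d2 M)) t ->
  im (tens_mapl iota' N' (tor_d2 M')) (tor_tens1 t).
Proof. by move=> [u <-]; eexists; apply/esym/tor_tens1_d2. Qed.

Definition Tor1_map : {linear Tor1 iota M N -> Tor1 iota' M' N'} :=
  subquot_map tor_map_ker tor_map_im.

End TorMap.

Lemma tens_map_id (k : comPzRingType) (R : pzRingType) (iota : k -> R)
    (phi : R -> R) (phi_iota : forall a, phi (iota a) = iota a)
    (M : lmodType R^c) (N : lmodType R)
    (f : {linear M -> M | (phi : R^c -> R^c) \; *:%R})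
    (g : {linear N -> N | phi \; *:%R}) :
  f =1 id -> g =1 id -> tens_map phi_iota f g =1 id.
Proof.
move=> f_id g_id; elim/tens_ind => [|t u IHt IHu|a t IH|m n].
- exact: linear0.
- by rewrite linearD IHt IHu.
- by rewrite linearZ_LR IH.
- by rewrite [LHS]tens_map_ptens f_id g_id.
Qed.

Section TensorComp.
Variables (k : comPzRingType) (R S T : pzRingType).
Variables (iR : k -> R) (iS : k -> S) (iT : k -> T).
Variables (phi : R -> S) (psi : S -> T) (chi : R -> T).
Hypothesis phi_iota : forall a, phi (iR a) = iS a.
Hypothesis psi_iota : forall a, psi (iS a) = iT a.
Hypothesis chi_iota : forall a, chi (iR a) = iT a.
Variables (M : lmodType R^c) (M' : lmodType S^c) (M'' : lmodType T^c).
Variables (N : lmodType R) (N' : lmodType S) (N'' : lmodType T).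
Variables (f : {linear M -> M' | (phi : R^c -> S^c) \; *:%R}).
Variables (f' : {linear M' -> M'' | (psi : S^c -> T^c) \; *:%R}).
Variables (f'' : {linear M -> M'' | (chi : R^c -> T^c) \; *:%R}).
Variables (g : {linear N -> N' | phi \; *:%R}).
Variables (g' : {linear N' -> N'' | psi \; *:%R}).
Variables (g'' : {linear N -> N'' | chi \; *:%R}).

Lemma tens_map_comp :
  (forall x, f'' x = f' (f x)) -> (forall x, g'' x = g' (g x)) ->
  forall t, tens_map chi_iota f'' g'' t =
            tens_map psi_iota f' g' (tens_map phi_iota f g t).
Proof.
move=> fE gE; elim/tens_ind => [|t u IHt IHu|a t IH|m n].
- by rewrite !linear0.
- by rewrite !linearD IHt IHu.
- by rewrite linearZ_LR IH [in RHS]linearZ_LR [RHS]linearZ_LR.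
rewrite [LHS]tens_map_ptens fE gE.
by rewrite [tens_map phi_iota _ _ _]tens_map_ptens [RHS]tens_map_ptens.
Qed.

End TensorComp.

Lemma Tor1_map_id (k : comPzRingType) (R : pzRingType) (iota : k -> R)
    (phi : {rmorphism R -> R}) (phi_iota : forall a, phi (iota a) = iota a)
    (M : lmodType R^c) (N : lmodType R)
    (f : {linear M -> M | conv_morph phi \; *:%R})
    (g : {linear N -> N | phi \; *:%R}) :
  phi =1 id -> f =1 id -> g =1 id -> Tor1_map phi_iota f g =1 id.
Proof.
move=> phi_id f_id g_id; apply/subquot_map_id/tens_map_id => //.
apply: free_map_id => // x; apply: val_inj; apply: free_map_id => //.
Qed.

Section TorComp.
Variables (k : comPzRingType) (R S T : pzRingType).
Variables (iR : k -> R) (iS : k -> S) (iT : k -> T).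
Variables (phi : {rmorphism R -> S}) (psi : {rmorphism S -> T}).
Variables (chi : {rmorphism R -> T}).
Hypothesis phi_iota : forall a, phi (iR a) = iS a.
Hypothesis psi_iota : forall a, psi (iS a) = iT a.
Hypothesis chi_iota : forall a, chi (iR a) = iT a.
Variables (M : lmodType R^c) (M' : lmodType S^c) (M'' : lmodType T^c).
Variables (N : lmodType R) (N' : lmodType S) (N'' : lmodType T).
Variables (f : {linear M -> M' | conv_morph phi \; *:%R}).
Variables (f' : {linear M' -> M'' | conv_morph psi \; *:%R}).
Variables (f'' : {linear M -> M'' | conv_morph chi \; *:%R}).
Variables (g : {linear N -> N' | phi \; *:%R}).
Variables (g' : {linear N' -> N'' | psi \; *:%R}).
Variables (g'' : {linear N -> N'' | chi \; *:%R}).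

Lemma Tor1_map_comp : (forall a, chi a = psi (phi a)) ->
  (forall x, f'' x = f' (f x)) -> (forall x, g'' x = g' (g x)) ->
  forall t, Tor1_map chi_iota f'' g'' t =
            Tor1_map psi_iota f' g' (Tor1_map phi_iota f g t).
Proof.
move=> chiE fE gE; apply/subquot_map_comp/tens_map_comp => //.
apply: free_map_comp => // x; apply: val_inj.
by apply: free_map_comp.
Qed.

End TorComp.

(* A copy of groupType whose carriers live in their own universe: the carrier
   of lim is a set of families indexed by all the free extensions of G, so
   groups must be strictly smaller than modules, whereas the library requires
   every module to be no larger than the carriers of groupType (through
   to_multiplicative). The library structure is then inherited. *)
Record grp := Grp {
  gcar :> Type;
  gmul : gcar -> gcar -> gcar;
  gone : gcar;
  ginv : gcar -> gcar;
  gmulA : associative gmul;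
  gmul1 : left_id gone gmul;
  gmulV : left_inverse gone ginv gmul }.

Section GroupStructure.
Variable F : grp.

HB.instance Definition _ := gen_eqMixin (gcar F).
HB.instance Definition _ := gen_choiceMixin (gcar F).

Fact gmulxV : right_inverse (gone F) (@ginv F) (@gmul F).
Proof.
move=> x; set y := ginv x; rewrite -[gmul x y]gmul1.
by rewrite -{1}(gmulV y) -gmulA [gmul y (gmul _ _)]gmulA gmulV gmul1 gmulV.
Qed.

Fact gmulx1 : right_id (gone F) (@gmul F).
Proof. by move=> x; rewrite -(gmulV x) gmulA gmulxV gmul1. Qed.

HB.instance Definition _ := isMonoid.Build (gcar F) (@gmulA F) (@gmul1 F) gmulx1.
HB.instance Definition _ := hasInv.Build (gcar F) (@ginv F).
HB.instance Definition _ := Monoid_isGroup.Build (gcar F) (@gmulV F) gmulxV.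

End GroupStructure.

Record ghom (F H : grp) := GHom {
  ghom_fun :> F -> H;
  ghomM : {morph ghom_fun : x y / (x * y)%g} }.

Section GroupAlgebra.
Variable k : comPzRingType.

Definition galg (F : grp) : Type := freemod k F.

Section Ring.
Variable F : grp.
HB.instance Definition _ := GRing.Lmodule.on (galg F).
Implicit Types u v w : galg F.

Definition gelt (x : F) : galg F := delta k x.

Definition galg_mul u v : galg F :=
  lin_ext (fun x : F => lin_ext (fun y : F => gelt (x * y)%g) v) u.

Fact galg_mulDl : left_distributive galg_mul +%R.
Proof. by move=> u v w; apply: linearD. Qed.

Fact galg_mulZl a u v : galg_mul (a *: u) v = a *: galg_mul u v.
Proof. exact: linearZ_LR. Qed.

Fact galg_mul0l v : galg_mul 0 v = 0.
Proof. exact: linear0. Qed.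

Fact galg_mulDr : right_distributive galg_mul +%R.
Proof.
move=> u v w; elim/freemod_ind: u => [|u1 u2 IH1 IH2|a u IH|x].
- by rewrite !galg_mul0l addr0.
- by rewrite !galg_mulDl IH1 IH2 addrACA.
- by rewrite !galg_mulZl IH scalerDr.
- by rewrite /galg_mul !lin_ext_delta linearD.
Qed.

Fact galg_mulZr a u v : galg_mul u (a *: v) = a *: galg_mul u v.
Proof.
elim/freemod_ind: u => [|u1 u2 IH1 IH2|b u IH|x].
- by rewrite !galg_mul0l scaler0.
- by rewrite !galg_mulDl IH1 IH2 scalerDr.
- by rewrite !galg_mulZl IH !scalerA mulrC.
- by rewrite /galg_mul !lin_ext_delta linearZ_LR.
Qed.

Fact galg_mul0r u : galg_mul u 0 = 0.
Proof. by rewrite -(scale0r 0) galg_mulZr !scale0r. Qed.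

Lemma galg_mul_gelt x y : galg_mul (gelt x) (gelt y) = gelt (x * y)%g.
Proof. by rewrite /galg_mul !lin_ext_delta. Qed.

Fact galg_mulA : associative galg_mul.
Proof.
move=> u v w; elim/freemod_ind: u => [|u1 u2 IH1 IH2|a u IH|x].
- by rewrite !galg_mul0l.
- by rewrite !galg_mulDl IH1 IH2.
- by rewrite !galg_mulZl IH.
elim/freemod_ind: v => [|v1 v2 IH1 IH2|a v IH|y].
- by rewrite galg_mul0l galg_mul0r galg_mul0l.
- by rewrite galg_mulDl !galg_mulDr galg_mulDl IH1 IH2.
- by rewrite galg_mulZl !galg_mulZr galg_mulZl IH.
elim/freemod_ind: w => [|w1 w2 IH1 IH2|a w IH|z].
- by rewrite !galg_mul0r.
- by rewrite !galg_mulDr IH1 IH2.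
- by rewrite !galg_mulZr IH.
by rewrite !galg_mul_gelt mulgA.
Qed.

Fact galg_mul1 : left_id (gelt 1%g) galg_mul.
Proof.
elim/freemod_ind => [|u v IHu IHv|a u IH|x].
- by rewrite galg_mul0r.
- by rewrite galg_mulDr IHu IHv.
- by rewrite galg_mulZr IH.
- by rewrite galg_mul_gelt mul1g.
Qed.

Fact galg_mulx1 : right_id (gelt 1%g) galg_mul.
Proof.
elim/freemod_ind => [|u v IHu IHv|a u IH|x].
- by rewrite galg_mul0l.
- by rewrite galg_mulDl IHu IHv.
- by rewrite galg_mulZl IH.
- by rewrite galg_mul_gelt mulg1.
Qed.

HB.instance Definition _ := GRing.Zmodule_isPzRing.Build (galg F)
  galg_mulA galg_mul1 galg_mulx1 galg_mulDl galg_mulDr.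

(* galg F is not declared as an algType only because the library requires
   algebras, hence k, to be nonzero. *)
Definition galg_scalar (a : k) : galg F := a *: (1 : galg F).

Fact galg_scalar_nmod : nmod_morphism galg_scalar.
Proof. by split=> [|a b]; rewrite /galg_scalar ?scale0r ?scalerDl. Qed.

Fact galg_scalar_monoid : monoid_morphism galg_scalar.
Proof.
split=> [|a b]; first exact: scale1r.
by rewrite /galg_scalar -scalerA [RHS]galg_mulZl; congr (_ *: _); exact/esym/mul1r.
Qed.

HB.instance Definition _ :=
  GRing.isNmodMorphism.Build k (galg F) galg_scalar galg_scalar_nmod.
HB.instance Definition _ :=
  GRing.isMonoidMorphism.Build k (galg F) galg_scalar galg_scalar_monoid.

Lemma galg_scalarE a u : galg_scalar a * u = a *: u.
Proof. by rewrite /galg_scalar [LHS]galg_mulZl; congr (_ *: _); exact: mul1r. Qed.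

Lemma galg_scalarC a u : galg_scalar a * u = u * galg_scalar a.
Proof. by rewrite galg_scalarE /galg_scalar [RHS]galg_mulZr; congr (_ *: _); exact/esym/mulr1. Qed.

End Ring.

Lemma galg_ind (F : grp) (P : galg F -> Prop) :
  P 0 -> (forall u v, P u -> P v -> P (u + v)) ->
  (forall a u, P u -> P (a *: u)) -> (forall x, P (gelt x)) -> forall u, P u.
Proof. exact: freemod_ind. Qed.

Section Functoriality.
Variables (F H : grp) (f : ghom F H).

Definition galg_map : galg F -> galg H := lin_ext (fun x : F => gelt (f x)).

Lemma galg_map_gelt x : galg_map (gelt x) = gelt (f x).
Proof. exact: lin_ext_delta. Qed.

Fact galg_mapZ a u : galg_map (a *: u) = a *: galg_map u.
Proof. exact: linearZ_LR. Qed.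

Fact galg_map0 : galg_map 0 = 0. Proof. exact: linear0. Qed.

Fact galg_mapD : {morph galg_map : u v / u + v}. Proof. exact: linearD. Qed.

HB.instance Definition _ :=
  GRing.isNmodMorphism.Build (galg F) (galg H) galg_map (galg_map0, galg_mapD).

Fact galg_map_monoid : monoid_morphism galg_map.
Proof.
split=> [|u v].
  rewrite [LHS]galg_map_gelt; congr gelt.
  by apply: (mulgI (f 1%g)); rewrite -ghomM !mulg1.
elim/galg_ind: u => [|u1 u2 IH1 IH2|a u IH|x].
- by rewrite mul0r ?galg_map0 mul0r.
- by rewrite mulrDl !galg_mapD IH1 IH2 mulrDl.
- by rewrite [_ * _]galg_mulZl !galg_mapZ IH [RHS]galg_mulZl.
elim/galg_ind: v => [|v1 v2 IH1 IH2|a v IH|y].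
- by rewrite mulr0 ?galg_map0 mulr0.
- by rewrite mulrDr !galg_mapD IH1 IH2 mulrDr.
- by rewrite [_ * _]galg_mulZr !galg_mapZ IH [RHS]galg_mulZr.
by rewrite [_ * _]galg_mul_gelt !galg_map_gelt [RHS]galg_mul_gelt ghomM.
Qed.

HB.instance Definition _ :=
  GRing.isMonoidMorphism.Build (galg F) (galg H) galg_map galg_map_monoid.

Lemma galg_map_scalar a : galg_map (galg_scalar F a) = galg_scalar H a.
Proof. by rewrite /galg_scalar galg_mapZ rmorph1. Qed.

End Functoriality.

Lemma galg_map_id (F : grp) (f : ghom F F) : f =1 id -> galg_map f =1 id.
Proof.
move=> f_id; elim/galg_ind => [|u v IHu IHv|a u IH|x].
- exact: galg_map0.
- by rewrite galg_mapD IHu IHv.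
- by rewrite galg_mapZ IH.
- by rewrite [LHS]galg_map_gelt f_id.
Qed.

Lemma galg_map_comp (F H K : grp) (f : ghom F H) (g : ghom H K)
  (gf : ghom F K) : gf =1 g \o f -> galg_map gf =1 galg_map g \o galg_map f.
Proof.
move=> gfE; elim/galg_ind => [|u v IHu IHv|a u IH|x] /=.
- by rewrite ?galg_map0.
- by rewrite !galg_mapD IHu IHv.
- by rewrite !galg_mapZ IH.
- by rewrite ![in LHS]galg_map_gelt [galg_map f _]galg_map_gelt galg_map_gelt gfE.
Qed.

End GroupAlgebra.

Arguments galg_map k {F H} f.

Section Ideals.
Variable A : pzRingType.

(* Two-sided ideals. *)
Record ideal := Ideal {
  in_ideal :> A -> Prop;
  ideal0 : in_ideal 0;
  idealD : forall x y, in_ideal x -> in_ideal y -> in_ideal (x + y);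
  idealMl : forall r x, in_ideal x -> in_ideal (r * x);
  idealMr : forall r x, in_ideal x -> in_ideal (x * r) }.

Definition left_submod (I : ideal) : submod (GRing.Lmodule.clone A A^o _) :=
  @Submod A (GRing.Lmodule.clone A A^o _) I (ideal0 I) (@idealD I) (@idealMl I).

Definition right_submod (I : ideal) :
    submod (GRing.Lmodule.clone A^c (A^c)^o _) :=
  @Submod A^c (GRing.Lmodule.clone A^c (A^c)^o _) I
    (ideal0 I) (@idealD I) (@idealMr I).

Definition left_quotient (I J : ideal) : lmodType A :=
  subquot (left_submod I) (left_submod J).

Definition right_quotient (I J : ideal) : lmodType A^c :=
  subquot (right_submod I) (right_submod J).

Definition ideal_add (I J : ideal) : ideal.
Proof.
exists (fun z => exists x y, [/\ I x, J y & z = x + y]).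
- by exists 0, 0; split; [exact: ideal0 | exact: ideal0 | rewrite addr0].
- move=> _ _ [x [y [Ix Jy ->]]] [x' [y' [Ix' Jy' ->]]].
  exists (x + x'), (y + y'); split; [exact: idealD | exact: idealD |].
  by rewrite addrACA.
- move=> r _ [x [y [Ix Jy ->]]]; exists (r * x), (r * y).
  by split; [exact: idealMl | exact: idealMl | rewrite mulrDr].
- move=> r _ [x [y [Ix Jy ->]]]; exists (x * r), (y * r).
  by split; [exact: idealMr | exact: idealMr | rewrite mulrDl].
Defined.

(* The finite sums of products of an element of I by an element of J. *)
Definition ideal_mul (I J : ideal) : ideal.
Proof.
exists (fun z => exists2 s : seq (A * A),
  (forall p, p \in s -> I p.1 /\ J p.2) & z = \sum_(p <- s) p.1 * p.2).
- by exists [::]; rewrite ?big_nil.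
- move=> _ _ [s sIJ ->] [t tIJ ->]; exists (s ++ t); last by rewrite big_cat.
  by move=> p; rewrite mem_cat => /orP[/sIJ|/tIJ].
- move=> r _ [s sIJ ->]; exists [seq (r * p.1, p.2) | p <- s].
    by move=> _ /mapP[p /sIJ[Ip Jp] ->]; split=> //; apply: idealMl.
  by rewrite big_map mulr_sumr; apply: eq_bigr => p _; rewrite mulrA.
- move=> r _ [s sIJ ->]; exists [seq (p.1, p.2 * r) | p <- s].
    by move=> _ /mapP[p /sIJ[Ip Jp] ->]; split=> //; apply: idealMr.
  by rewrite big_map mulr_suml; apply: eq_bigr => p _; rewrite mulrA.
Defined.

End Ideals.

Section QuotientMaps.
Variables (A B : pzRingType) (phi : {rmorphism A -> B}).
Variables (I J : ideal A) (I' J' : ideal B).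
Hypothesis phiI : forall x, I x -> I' (phi x).
Hypothesis phiJ : forall x, J x -> J' (phi x).

Definition left_quotient_map :
    {linear left_quotient I J -> left_quotient I' J' | phi \; *:%R} :=
  @subquot_map A B phi _ _
    (@mk_semilinear A B phi A^o B^o phi (rmorphD phi) (rmorphM phi))
    (left_submod I) (left_submod J) (left_submod I') (left_submod J') phiI phiJ.

Definition right_quotient_map :
    {linear right_quotient I J -> right_quotient I' J' | conv_morph phi \; *:%R} :=
  @subquot_map A^c B^c (conv_morph phi) _ _
    (@mk_semilinear A^c B^c (conv_morph phi) (A^c)^o (B^c)^o (conv_morph phi)
       (rmorphD (conv_morph phi)) (rmorphM (conv_morph phi)))
    (right_submod I) (right_submod J) (right_submod I') (right_submod J')
    phiI phiJ.

End QuotientMaps.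

Section GroupAlgebraIdeal.
Variables (k : comPzRingType) (F : grp).

Fact galg_idealZ (I : ideal (galg k F)) (a : k) (x : galg k F) :
  I x -> I (a *: x).
Proof. by rewrite -galg_scalarE; apply: idealMl. Qed.

Definition galg_submod (I : ideal (galg k F)) :
    submod (GRing.Lmodule.clone k (galg k F) _) :=
  @Submod k (GRing.Lmodule.clone k (galg k F) _) I
    (ideal0 I) (@idealD _ I) (@galg_idealZ I).

End GroupAlgebraIdeal.

Record category := Category {
  obj :> Type;
  mor : obj -> obj -> Type;
  idc : forall c, mor c c;
  compc : forall c d e, mor d e -> mor c d -> mor c e;
  compc1 : forall c d (f : mor c d), compc f (idc c) = f;
  comp1c : forall c d (f : mor c d), compc (idc d) f = f;
  compcA : forall b c d e (h : mor d e) (g : mor c d) (f : mor b c),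
    compc h (compc g f) = compc (compc h g) f }.

Section FunctorCategory.
Variables (k : comPzRingType) (C : category).

Record functor := Functor {
  fobj :> C -> lmodType k;
  fmap : forall c d, mor c d -> {linear fobj c -> fobj d};
  fmap_id : forall c x, fmap (idc c) x = x;
  fmap_comp : forall c d e (g : mor d e) (f : mor c d) x,
    fmap (compc g f) x = fmap g (fmap f x) }.

Record nattrans (F H : functor) := NatTrans {
  nt :> forall c, {linear F c -> H c};
  nt_natural : forall c d (f : mor c d) x, nt d (fmap F f x) = fmap H f (nt c x) }.

(* Monomorphisms and exactness in the functor category are objectwise. *)
Definition mono (F H : functor) (u : nattrans F H) : Prop :=
  forall c, injective (u c).

Definition injective_functor (J : functor) : Prop :=
  forall (F H : functor) (u : nattrans F H) (v : nattrans F J), mono u ->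
  exists w : nattrans H J, forall c x, w c (u c x) = v c x.

Record injective_resolution (F : functor) := InjRes {
  ir :> nat -> functor;
  ir_aug : nattrans F (ir 0);
  ir_d : forall n, nattrans (ir n) (ir n.+1);
  ir_injective : forall n, injective_functor (ir n);
  ir_aug_mono : mono ir_aug;
  ir_exact0 : forall c x, ir_d 0 c x = 0 <-> exists y, ir_aug c y = x;
  ir_exact : forall n c x, ir_d n.+1 c x = 0 <-> exists y, ir_d n c y = x }.

(* lim F, as the module of compatible families. *)
Definition family (F : functor) : Type := forall c : C, F c.

Section Family.
Variable F : functor.
Implicit Types u v w : family F.

HB.instance Definition _ := gen_eqMixin (family F).
HB.instance Definition _ := gen_choiceMixin (family F).

Definition family_add u v : family F := fun c => u c + v c.
Definition family_zero : family F := fun=> 0.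
Definition family_opp u : family F := fun c => - u c.
Definition family_scale (a : k) u : family F := fun c => a *: u c.

Fact family_addA : associative family_add.
Proof. by move=> u v w; apply: functional_extensionality_dep => c; apply: addrA. Qed.
Fact family_addC : commutative family_add.
Proof. by move=> u v; apply: functional_extensionality_dep => c; apply: addrC. Qed.
Fact family_add0 : left_id family_zero family_add.
Proof. by move=> u; apply: functional_extensionality_dep => c; apply: add0r. Qed.
Fact family_addN : left_inverse family_zero family_opp family_add.
Proof. by move=> u; apply: functional_extensionality_dep => c; apply: addNr. Qed.

HB.instance Definition _ := GRing.isZmodule.Build (family F)
  family_addA family_addC family_add0 family_addN.

Fact family_scaleA a b u : family_scale a (family_scale b u) = family_scale (a * b) u.
Proof. by apply: functional_extensionality_dep => c; apply: scalerA. Qed.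
Fact family_scale1 : left_id 1 family_scale.
Proof. by move=> u; apply: functional_extensionality_dep => c; apply: scale1r. Qed.
Fact family_scaleDr : right_distributive family_scale +%R.
Proof. by move=> a u v; apply: functional_extensionality_dep => c; apply: scalerDr. Qed.
Fact family_scaleDl u : {morph family_scale^~ u : a b / a + b}.
Proof. by move=> a b; apply: functional_extensionality_dep => c; apply: scalerDl. Qed.

HB.instance Definition _ := GRing.Zmodule_isLmodule.Build k (family F)
  family_scaleA family_scale1 family_scaleDr family_scaleDl.

Definition compatible : submod (GRing.Lmodule.clone k (family F) _).
Proof.
exists (fun u : family F => forall c d (f : mor c d), fmap F f (u c) = u d).
- by move=> c d f; exact: linear0.
- by move=> u v cu cv c d f; rewrite [LHS]linearD cu cv.
- by move=> a u cu c d f; rewrite [LHS]linearZ_LR cu.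
Defined.

Definition lim : lmodType k := submodule compatible.

End Family.

Section LimMap.
Variables (F H : functor) (t : nattrans F H).

Definition family_map (u : family F) : family H := fun c => t c (u c).

Fact family_map_D : {morph family_map : u v / u + v}.
Proof. by move=> u v; apply: functional_extensionality_dep => c; apply: linearD. Qed.

Fact family_map_Z a u : family_map (a *: u) = a *: family_map u.
Proof. by apply: functional_extensionality_dep => c; apply: linearZ_LR. Qed.

Fact family_map_compatible u : compatible F u -> compatible H (family_map u).
Proof. by move=> cu c d f; rewrite [RHS]/(t d (u d)) -(cu c d f); apply/esym/nt_natural. Qed.

Definition lim_map : {linear lim F -> lim H} :=
  @submod_map k k idfun (GRing.Lmodule.clone k (family F) _)
    (GRing.Lmodule.clone k (family H) _)
    (mk_linear family_map_D family_map_Z)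
    _ _ family_map_compatible.

End LimMap.

End FunctorCategory.

(* The functor category has enough injectives; this occupies the text down to
   cofree_resolution. First, homomorphisms to a divisible abelian group extend
   from subgroups, by Zorn's lemma on their graphs. *)
Section DivisibleExtension.
Local Open Scope classical_set_scope.
Variables (M D : zmodType).
Hypothesis divD : forall n : nat, (0 < n)%N -> forall d : D, exists e, e *+ n = d.

Record graph (X : set (M * D)) : Prop := Graph {
  graph0 : X (0, 0);
  graphB : forall p q, X p -> X q -> X (p.1 - q.1, p.2 - q.2);
  graph_fun : forall d, X (0, d) -> d = 0 }.

Lemma graphMz X p n : graph X -> X p -> X (p.1 *~ n, p.2 *~ n).
Proof.
move=> gX Xp; have pos m : X (p.1 *+ m, p.2 *+ m).
  elim: m => [|m IH]; first exact: (graph0 gX).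
  rewrite !mulrS; have := graphB gX Xp (graphB gX (graph0 gX) IH).
  by rewrite /= !sub0r !opprK.
case: n => m; first exact: pos.
by have := graphB gX (graph0 gX) (pos m.+1); rewrite /= !sub0r.
Qed.

Lemma graphD X p q : graph X -> X p -> X q -> X (p.1 + q.1, p.2 + q.2).
Proof.
move=> gX Xp /(graphMz (-1) gX) Xq; have := graphB gX Xp Xq.
by rewrite /= !mulrN1z !opprK.
Qed.

Definition graph_add (X : set (M * D)) x e : set (M * D) :=
  fun p => exists n q, X q /\ p = (q.1 + x *~ n, q.2 + e *~ n).

Lemma graph_add_graph X x e : graph X ->
  (forall n d, X (x *~ n, d) -> d = e *~ n) -> graph (graph_add X x e).
Proof.
move=> gX xe; split.
- by exists 0, (0, 0); split; [exact: (graph0 gX) | rewrite !mulr0z !addr0].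
- move=> _ _ [m [p [Xp ->]]] [n [q [Xq ->]]].
  exists (m - n), (p.1 - q.1, p.2 - q.2); split; first exact: (graphB gX).
  by rewrite /= !mulrzBr !opprD !(addrACA _ _ (- _)).
- move=> d [n [q [Xq [q1 ->]]]].
  have /eqP := esym q1; rewrite addr_eq0 -mulrNz => /eqP q1E.
  have /xe -> : X (x *~ - n, q.2) by rewrite -q1E -surjective_pairing.
  by rewrite mulrNz addNr.
Qed.

Lemma graph_value X x : graph X ->
  exists e, forall n d, X (x *~ n, d) -> d = e *~ n.
Proof.
move=> gX; pose P n := `[< (0 < n)%N /\ exists d, X (x *+ n, d) >].
have [exP|noP] := pselect (exists n, P n); last first.
  exists 0 => n d Xn; rewrite mul0rz; move: Xn; case: n => [[|n]|n].
  - by rewrite mulr0z; apply: (graph_fun gX).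
  - by move=> Xn; case: noP; exists n.+1; apply/asboolP; split=> //; exists d.
  - move=> Xn; case: noP; exists n.+1; apply/asboolP; split=> //; exists (- d).
    by have := graphMz (-1) gX Xn; rewrite /= !mulrN1z NegzE mulrNz opprK.
case: (ex_minnP exP) => n0 /asboolP[n0_gt0 [d0 Xd0]] n0_min.
have [e de] := divD n0_gt0 d0; exists e => n d Xn.
have [q [r [nE r_lt]]] : exists (q : int) (r : nat), n = q * n0%:Z + r%:Z /\ (r < n0)%N.
  exists (divz n n0), `|modz n n0|%N.
  have r_ge0 : 0 <= (n %% n0%:Z)%Z by rewrite modz_ge0 // -lt0n.
  by rewrite gez0_abs // -divz_eq -ltz_nat gez0_abs // ltz_mod // -lt0n.
have Xr : X (x *+ r, d - d0 *~ q).
  have := graphB gX Xn (graphMz q gX Xd0).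
  rewrite /= (_ : x *~ n - _ = x *+ r) //.
  by rewrite nE mulrzDr [q * _]mulrC mulrzA -!pmulrn addrAC subrr add0r.
have r0 : r = 0%N.
  apply/eqP; rewrite eqn0Ngt; apply/negP => r_gt0.
  suff /n0_min : P r by rewrite leqNgt r_lt.
  by apply/asboolP; split=> //; exists (d - d0 *~ q).
move: Xr; rewrite r0 mulr0n => /(graph_fun gX) /eqP.
rewrite subr_eq0 => /eqP ->.
by rewrite nE r0 addr0 [q * _]mulrC mulrzA -pmulrn de.
Qed.

Lemma graph_extend X : graph X ->
  exists g : M -> D, {morph g : x y / x + y} /\ forall p, X p -> g p.1 = p.2.
Proof.
move=> gX; pose P Y := Y = set0 \/ (graph Y /\ X `<=` Y).
have [Y [[Y0|[gY XY]] Ymax]] : exists A, P A /\ forall B, A `<` B -> ~ P B.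
- apply: Zorn_bigcup => F FP Ftot.
  have [[Y [FY Yn0]]|allY0] := pselect (exists Y, F Y /\ Y <> set0); last first.
    left; rewrite -subset0 => p [Y FY Yp]; apply: allY0; exists Y; split=> //.
    by move=> Y0; rewrite Y0 in Yp.
  have FgX Z : F Z -> forall p, Z p -> graph Z /\ X `<=` Z.
    by move=> /FP[->|].
  have [gY XY] : graph Y /\ X `<=` Y by case: (FP Y FY).
  right; split; last by move=> p /XY Yp; exists Y.
  split; first by exists Y => //; exact: (graph0 gY).
  - move=> p q [Z FZ Zp] [Z' FZ' Zq].
    have [gZ _] := FgX _ FZ _ Zp; have [gZ' _] := FgX _ FZ' _ Zq.
    case: (Ftot Z Z' FZ FZ') => sub.
      by exists Z' => //; apply: (graphB gZ') => //; apply: sub.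
    by exists Z => //; apply: (graphB gZ) => //; apply: sub.
  - by move=> d [Z FZ Zd]; have [gZ _] := FgX _ FZ _ Zd; apply: (graph_fun gZ).
- exfalso; apply: (Ymax X); last by right; split.
  rewrite Y0; split; first exact: sub0set.
  by move=> /(_ _ (graph0 gX)).
have tot x : exists d, Y (x, d).
  have [e eP] := graph_value x gY; apply: contrapT => nYx.
  have gYx := graph_add_graph gY eP.
  have YYx : Y `<=` graph_add Y x e.
    by move=> p Yp; exists 0, p; rewrite !mulr0z !addr0 -surjective_pairing.
  apply: (Ymax (graph_add Y x e)); last first.
    by right; split=> // p /XY /YYx.
  split=> // sub; apply: nYx; exists e; apply: sub.
  by exists 1, (0, 0); rewrite /= !add0r !mulr1z; split=> //; exact: (graph0 gY).
have [g gP] := choice tot.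
have gE p : Y p -> g p.1 = p.2.
  move=> Yp; apply/eqP; rewrite -subr_eq0; apply/eqP/(graph_fun gY).
  by have := graphB gY (gP p.1) Yp; rewrite /= subrr.
exists g; split=> [x y|p /XY]; last exact: gE.
exact: (gE (x + y, g x + g y) (graphD gY (gP x) (gP y))).
Qed.

Lemma divisible_extend (A : zmodType) (u : {additive A -> M}) (f : {additive A -> D}) :
  injective u ->
  exists g : M -> D, {morph g : x y / x + y} /\ forall a, g (u a) = f a.
Proof.
move=> u_inj; pose X : set (M * D) := fun p => exists a, p = (u a, f a).
have gX : graph X.
  split; first by exists 0; rewrite !raddf0.
    by move=> _ _ [a ->] [b ->]; exists (a - b); rewrite !raddfB.
  by move=> d [a [ua ->]]; rewrite (u_inj a 0) ?raddf0.
have [g [gD gX']] := graph_extend gX.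
by exists g; split=> // a; apply: (gX' (u a, f a)); exists a.
Qed.

End DivisibleExtension.

(* Q / Z *)
Definition integers : submod (GRing.Lmodule.clone int (zmodule rat) _).
Proof.
exists (fun x : rat => exists n : int, x = n%:~R).
- by exists 0.
- by move=> _ _ [m ->] [n ->]; exists (m + n); rewrite intrD.
- by move=> a _ [n ->]; exists (n * a); rewrite intrM mulrzr.
Defined.

Definition QZ : zmodType := quotient integers.

Lemma QZ_divisible (n : nat) : (0 < n)%N -> forall d : QZ, exists e, e *+ n = d.
Proof.
move=> n_gt0 d; exists (qpi integers ((repr d : rat) / n%:R : rat)).
rewrite -raddfMn -[RHS]qpi_repr; congr qpi.
by rewrite [LHS](_ : _ = ((repr d : rat) / n%:R) *+ n) // -mulr_natr divfK // Num.Theory.pnatr_eq0 -lt0n.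
Qed.

Lemma QZ_inv_neq0 (n : nat) : (1 < n)%N -> qpi integers (n%:R^-1 : rat) <> 0.
Proof.
move=> n_gt1 /eqP; rewrite -(linear0 (qpi integers)) => /eqP /qpi_eq.
rewrite subr0 => -[m mE].
have n0 : n%:R != 0 :> rat by rewrite Num.Theory.pnatr_eq0 -lt0n ltnW.
have : m%:~R * n%:~R = 1 :> rat by rewrite -mE -pmulrn mulVf.
rewrite -intrM => /eqP; rewrite -[1]/(1%:~R) eqr_int => /eqP mn.
have : (n %| 1)%N by have /(congr1 absz) := mn; rewrite abszM /= => <-; apply: dvdn_mull.
by rewrite dvdn1 => /eqP n1; rewrite n1 in n_gt1.
Qed.

Lemma QZ_separates (M : zmodType) (x : M) : x <> 0 ->
  exists g : M -> QZ, {morph g : x y / x + y} /\ g x <> 0.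
Proof.
move=> x0; pose X : classical_sets.set (M * QZ) := fun p => p = (0, 0).
have gX : graph X.
  split=> //; last by move=> d [].
  by move=> p q -> ->; rewrite /X /= !subrr.
suff [e [e0 eP]] : exists e : QZ, e <> 0 /\ forall n d, X (x *~ n, d) -> d = e *~ n.
  have [g [gD gP]] := graph_extend QZ_divisible (graph_add_graph gX eP).
  exists g; split=> //; rewrite (gP (x, e)) //.
  by exists 1, (0, 0); rewrite /= !add0r !mulr1z.
pose P n := `[< (0 < n)%N /\ x *+ n = 0 >].
have [exP|noP] := pselect (exists n, P n); last first.
  exists (qpi integers (2%:R^-1 : rat)); split; first exact: QZ_inv_neq0.
  move=> n d [xn ->]; suff -> : n = 0 by rewrite mulr0z.
  case: n xn => [[|n]|n] // xn; case: noP; exists n.+1; apply/asboolP; split=> //.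
  by apply/eqP; rewrite -oppr_eq0 pmulrn -mulrNz -NegzE xn.
case: (ex_minnP exP) => n0 /asboolP[n0_gt0 xn0] n0_min.
have n0_gt1 : (1 < n0)%N by case: n0 n0_gt0 xn0 {n0_min} => [|[|]].
exists (qpi integers (n0%:R^-1 : rat)); split; first exact: QZ_inv_neq0.
move=> n d [xn ->].
have r_ge0 : 0 <= modz n n0 by rewrite modz_ge0 // -lt0n.
have r_lt : (`|modz n n0| < n0)%N by rewrite -ltz_nat gez0_abs // ltz_mod // -lt0n.
have nE : n = n0%:Z * divz n n0 + `|modz n n0|%N%:Z.
  by rewrite gez0_abs // mulrC -divz_eq.
have r0 : `|modz n n0|%N = 0%N.
  apply/eqP; rewrite eqn0Ngt; apply/negP => r_gt0.
  suff /n0_min : P `|modz n n0|%N by rewrite leqNgt r_lt.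
  apply/asboolP; split=> //; move: xn.
  by rewrite {1}nE mulrzDr mulrzA -!pmulrn xn0 mul0rz add0r.
rewrite nE r0 addr0 mulrzA -pmulrn.
have -> : qpi integers (n0%:R^-1 : rat) *+ n0 = qpi integers (1%:~R : rat).
  have n0V : (n0%:R^-1 : rat) *+ n0 = 1.
    by rewrite -[LHS]mulr_natr mulVf // Num.Theory.pnatr_eq0 -lt0n.
  by rewrite -raddfMn; congr qpi; exact: n0V.
rewrite (_ : qpi integers (1%:~R : rat) = 0) ?mul0rz //.
by rewrite -(linear0 (qpi integers)); apply/qpi_eq; exists 1; rewrite subr0.
Qed.

(* The k-module Hom(k, Q / Z). *)
Section Character.
Variable k : comPzRingType.

Definition char_pred : {pred k -> QZ} :=
  fun e => `[< forall x y, e (x + y) = e x + e y >].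

Record kchar := KChar { kchar_fun :> k -> QZ; _ : char_pred kchar_fun }.

HB.instance Definition _ := [isSub for kchar_fun].
HB.instance Definition _ := [Choice of kchar by <:].

Fact kchar_closed : zmod_closed char_pred.
Proof.
split; first by apply/asboolP => x y; rewrite [RHS]addr0.
move=> e f /asboolP eD /asboolP fD; apply/asboolP => x y.
by rewrite [LHS](_ : _ = e (x + y) - f (x + y)) // eD fD opprD addrACA.
Qed.

HB.instance Definition _ :=
  GRing.SubChoice_isSubZmodule.Build (k -> QZ) char_pred kchar kchar_closed.

Lemma kcharD (e : kchar) x y : e (x + y) = e x + e y.
Proof. by have /asboolP := valP e; apply. Qed.

Fact kchar_scale_char a (e : kchar) : char_pred (fun x => e (x * a)).
Proof. by apply/asboolP => x y; rewrite mulrDl kcharD. Qed.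

Definition kchar_scale a (e : kchar) : kchar := KChar (kchar_scale_char a e).

Lemma kchar_eq (e f : kchar) : e =1 f -> e = f.
Proof. by move=> ef; apply: val_inj; apply: funext. Qed.

Fact kchar_scaleA a b e : kchar_scale a (kchar_scale b e) = kchar_scale (a * b) e.
Proof. by apply: kchar_eq => x; rewrite /= mulrA. Qed.
Fact kchar_scale1 : left_id 1 kchar_scale.
Proof. by move=> e; apply: kchar_eq => x; rewrite /= mulr1. Qed.
Fact kchar_scaleDr : right_distributive kchar_scale +%R.
Proof. by move=> a e f; apply: kchar_eq. Qed.
Fact kchar_scaleDl e : {morph kchar_scale^~ e : a b / a + b}.
Proof. by move=> a b; apply: kchar_eq => x; rewrite /= mulrDr kcharD. Qed.

HB.instance Definition _ := GRing.Zmodule_isLmodule.Build k kchar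
  kchar_scaleA kchar_scale1 kchar_scaleDr kchar_scaleDl.

End Character.

(* F embeds in the injective functor
   c |-> prod_{d, phi : F d -> Q / Z, h : mor c d} Hom(k, Q / Z). *)
Section CofreeFunctor.
Variables (k : comPzRingType) (C : category) (F : functor k C).

Record cofree_index (c : C) := CofreeIndex {
  ci_obj : C;
  ci_char : F ci_obj -> QZ;
  ci_charD : {morph ci_char : x y / x + y};
  ci_hom : mor c ci_obj }.

Definition cofree_obj (c : C) : lmodType k :=
  GRing.Lmodule.clone k (cofree_index c -> kchar k) _.

Definition cofree_reindex (c c' : C) (f : mor c c') (i : cofree_index c') :
  cofree_index c := CofreeIndex (@ci_charD _ i) (compc (ci_hom i) f).

Definition cofree_fmap_fun (c c' : C) (f : mor c c') (j : cofree_obj c) :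
  cofree_obj c' := fun i => j (cofree_reindex f i).

Definition cofree_fmap (c c' : C) (f : mor c c') :
    {linear cofree_obj c -> cofree_obj c'} :=
  mk_linear (f := cofree_fmap_fun f) (fun _ _ => erefl) (fun _ _ => erefl).

Fact cofree_fmap_id c x : cofree_fmap (idc c) x = x.
Proof.
by apply: funext => -[d phi phiD h]; congr x; rewrite /cofree_reindex /= compc1.
Qed.

Fact cofree_fmap_comp c d e (g : mor d e) (f : mor c d) x :
  cofree_fmap (compc g f) x = cofree_fmap g (cofree_fmap f x).
Proof.
by apply: funext => -[d' phi phiD h]; congr x; rewrite /cofree_reindex /= compcA.
Qed.

Definition cofree : functor k C := Functor cofree_fmap_id cofree_fmap_comp.

Lemma cofree_injective : injective_functor cofree.
Proof.
move=> A B u v u_mono.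
have ext (d : C) (phi : F d -> QZ) (phiD : {morph phi : x y / x + y}) :
    exists psi : B d -> QZ, {morph psi : x y / x + y} /\
      forall x, psi (u d x) = v d x (CofreeIndex phiD (idc d)) 1.
  pose f (x : A d) : QZ := v d x (CofreeIndex phiD (idc d)) 1.
  have fD : {morph f : x y / x + y} by move=> x y; rewrite /f linearD.
  pose f' : {additive A d -> QZ} :=
    HB.pack f (GRing.isNmodMorphism.Build _ _ f (addmorph_nmod fD)).
  exact: (@divisible_extend _ _ QZ_divisible _ (u d) f' (u_mono d)).
pose psi d phi phiD := sval (cid (@ext d phi phiD)).
have psiD d phi phiD : {morph @psi d phi phiD : x y / x + y}.
  by rewrite /psi; case: (cid _) => ? [].
have psiE d phi phiD x : @psi d phi phiD (u d x) = v d x (CofreeIndex phiD (idc d)) 1.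
  by rewrite /psi; case: (cid _) => ? [].
pose w0 c (y : B c) (i : cofree_index c) (a : k) : QZ :=
  psi _ _ (@ci_charD _ i) (a *: fmap B (ci_hom i) y).
have w0P c y i : char_pred (@w0 c y i).
  by apply/asboolP => a b; rewrite /w0 scalerDl psiD.
pose w1 c (y : B c) : cofree c := fun i => KChar (w0P c y i).
have w1D c : {morph @w1 c : x y / x + y}.
  move=> x y; apply: funext => i; apply: kchar_eq => a.
  by rewrite /= /w0 linearD scalerDr psiD.
have w1Z c a x : @w1 c (a *: x) = a *: w1 c x.
  apply: funext => i; apply: kchar_eq => b.
  by rewrite /= /w0 linearZ_LR scalerA.
pose w c : {linear B c -> cofree c} := mk_linear (@w1D c) (@w1Z c).
have wN c d (f : mor c d) x : w d (fmap B f x) = fmap cofree f (w c x).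
  apply: funext => i; apply: kchar_eq => a.
  by rewrite /= /w0 -fmap_comp.
exists (NatTrans wN) => c x; apply: funext => -[d phi phiD h]; apply: kchar_eq => a.
rewrite /= /w0 /= -nt_natural -linearZ_LR psiE linearZ_LR nt_natural /=.
rewrite [LHS]/(v c x (cofree_reindex h (CofreeIndex phiD (idc d))) (1 * a)).
by rewrite mul1r /cofree_reindex /= comp1c.
Qed.

Definition cofree_unit_char c (x : F c) (i : cofree_index c) (a : k) : QZ :=
  ci_char (a *: fmap F (ci_hom i) x).

Fact cofree_unit_charP c x i : char_pred (@cofree_unit_char c x i).
Proof.
by apply/asboolP => a b; rewrite /cofree_unit_char scalerDl ci_charD.
Qed.

Definition cofree_unit_fun c (x : F c) : cofree c :=
  fun i => KChar (cofree_unit_charP x i).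

Fact cofree_unit_D c : {morph @cofree_unit_fun c : x y / x + y}.
Proof.
move=> x y; apply: funext => i; apply: kchar_eq => a.
by rewrite /= /cofree_unit_char linearD scalerDr ci_charD.
Qed.

Fact cofree_unit_Z c a x : @cofree_unit_fun c (a *: x) = a *: cofree_unit_fun x.
Proof.
apply: funext => i; apply: kchar_eq => b.
by rewrite /= /cofree_unit_char linearZ_LR scalerA.
Qed.

Definition cofree_unit_at c : {linear F c -> cofree c} :=
  mk_linear (@cofree_unit_D c) (@cofree_unit_Z c).

Fact cofree_unit_natural c d (f : mor c d) x :
  cofree_unit_at d (fmap F f x) = fmap cofree f (cofree_unit_at c x).
Proof.
apply: funext => i; apply: kchar_eq => a.
by rewrite /= /cofree_unit_char -fmap_comp.
Qed.

Definition cofree_unit : nattrans F cofree := NatTrans cofree_unit_natural.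

Lemma cofree_unit_mono : mono cofree_unit.
Proof.
move=> c x y xy; apply/eqP; rewrite -subr_eq0; apply/negPn/negP => /eqP xy0.
have [phi [phiD]] := QZ_separates xy0; apply.
have := congr1 (fun j : cofree c => j (CofreeIndex phiD (idc c)) 1) xy.
rewrite /= /cofree_unit_char /= !scale1r !fmap_id => phixy.
by apply: (addIr (phi y)); rewrite -phiD subrK add0r.
Qed.

End CofreeFunctor.

Section Cokernel.
Variables (k : comPzRingType) (C : category) (F H : functor k C).
Variable u : nattrans F H.

Definition coker_obj (c : C) : lmodType k := quotient (im (u c)).

Fact coker_im c d (f : mor c d) x : im (u c) x -> im (u d) (fmap H f x).
Proof. by move=> [y <-]; exists (fmap F f y); rewrite nt_natural. Qed.

Definition coker_fmap c d (f : mor c d) : {linear coker_obj c -> coker_obj d} :=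
  @quot_map k k idfun _ _ (fmap H f) _ _ (@coker_im c d f).

Fact coker_fmap_id c x : coker_fmap (idc c) x = x.
Proof. by apply: quot_map_id => y; apply: fmap_id. Qed.

Fact coker_fmap_comp c d e (g : mor d e) (f : mor c d) x :
  coker_fmap (compc g f) x = coker_fmap g (coker_fmap f x).
Proof. by apply: quot_map_comp => y; apply: fmap_comp. Qed.

Definition coker : functor k C := Functor coker_fmap_id coker_fmap_comp.

Definition coker_pi_at c : {linear H c -> coker c} := qpi (im (u c)).

Fact coker_pi_natural c d (f : mor c d) x :
  coker_pi_at d (fmap H f x) = fmap coker f (coker_pi_at c x).
Proof. by rewrite [RHS](quot_map_qpi (@coker_im c d f)). Qed.

Definition coker_pi : nattrans H coker := NatTrans coker_pi_natural.

Lemma coker_pi_eq0 c x : coker_pi c x = 0 <-> exists y, u c y = x.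
Proof. by rewrite -(linear0 (coker_pi c)); split=> [/qpi_eq|?]; [|apply/qpi_eq]; rewrite subr0. Qed.

Lemma coker_pi_surj c (y : coker c) : exists x, coker_pi c x = y.
Proof. by exists (repr y); apply: qpi_repr. Qed.

End Cokernel.

Section InjectiveResolution.
Variables (k : comPzRingType) (C : category).

Definition nat_comp (F H K : functor k C) (v : nattrans H K) (u : nattrans F H) :
  nattrans F K :=
  @NatTrans k C F K (fun c => v c \o u c)
    (fun c d f x => etrans (congr1 (v d) (nt_natural u f x)) (nt_natural v f (u c x))).

Variable F : functor k C.

Fixpoint cosyzygy (n : nat) : functor k C :=
  if n is m.+1 then coker (cofree_unit (cosyzygy m)) else F.

Definition cofree_d n : nattrans (cofree (cosyzygy n)) (cofree (cosyzygy n.+1)) :=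
  nat_comp (cofree_unit (cosyzygy n.+1)) (coker_pi (cofree_unit (cosyzygy n))).

Fact cofree_d_eq0 n c x :
  cofree_d n c x = 0 <-> exists y, cofree_unit (cosyzygy n) c y = x.
Proof.
rewrite -coker_pi_eq0; split=> [dx|px].
  by apply: (@cofree_unit_mono _ _ (cosyzygy n.+1) c); rewrite linear0.
exact: etrans (congr1 (cofree_unit (cosyzygy n.+1) c) px) (linear0 _).
Qed.

Fact cofree_exact n c x : cofree_d n.+1 c x = 0 <-> exists y, cofree_d n c y = x.
Proof.
rewrite cofree_d_eq0; split=> [] [y <-]; last by exists (coker_pi (cofree_unit (cosyzygy n)) c y).
by have [z <-] := coker_pi_surj y; exists z.
Qed.

Definition cofree_resolution : injective_resolution F :=
  @InjRes k C F (fun n => cofree (cosyzygy n)) (cofree_unit F) cofree_d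
    (fun n => @cofree_injective k C (cosyzygy n)) (@cofree_unit_mono k C F)
    (@cofree_d_eq0 0) cofree_exact.

End InjectiveResolution.

Section DerivedLimits.
Variables (k : comPzRingType) (C : category).

(* The i-th cohomology of lim I^0 -> lim I^1 -> ..., for an injective
   resolution I of F. *)
Definition derlim_of (F : functor k C) (I : injective_resolution F) (i : nat) :
    lmodType k :=
  match i with
  | 0 => homology (\0 : {linear lim (I 0) -> lim (I 0)}) (lim_map (ir_d I 0))
  | n.+1 => homology (lim_map (ir_d I n)) (lim_map (ir_d I n.+1))
  end.

Definition derlim (i : nat) (F : functor k C) : lmodType k :=
  derlim_of (cofree_resolution F) i.

End DerivedLimits.

Definition free_group (F : grp) : Prop :=
  exists (X : Type) (i : X -> F), forall (H : grp) (h : X -> H),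
    (exists f : ghom F H, forall x, f (i x) = h x) /\
    (forall f f' : ghom F H, (forall x, f (i x) = f' (i x)) -> f =1 f').

Lemma ghom_eq (F H : grp) (f g : ghom F H) : f =1 g -> f = g.
Proof.
case: f g => [f fM] [g gM] /= /funext fg; case: _ / fg gM => gM.
by rewrite (Prop_irrelevance fM gM).
Qed.

Definition ghom_id (F : grp) : ghom F F :=
  @GHom F F (fun x => x) (fun _ _ => erefl).

Definition ghom_comp (F H K : grp) (g : ghom H K) (f : ghom F H) : ghom F K :=
  @GHom F K (fun x => g (f x))
    (fun x y => etrans (congr1 g (ghomM f x y)) (ghomM g (f x) (f y))).

Section Presentations.
Variable G : grp.

(* The free extensions R >-> F ->> G. *)
Record pres := MkPres {
  prR : grp;
  prF : grp;
  pr_inc : ghom prR prF;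
  pr_proj : ghom prF G;
  pr_inc_inj : injective pr_inc;
  pr_exact : forall x, pr_proj x = 1%g <-> exists r, pr_inc r = x;
  pr_surj : forall g, exists x, pr_proj x = g;
  pr_free : free_group prF }.

Record pres_hom (c d : pres) := PresHom {
  phR : ghom (prR c) (prR d);
  phF : ghom (prF c) (prF d);
  ph_inc : forall r, phF (pr_inc c r) = pr_inc d (phR r);
  ph_proj : forall x, pr_proj d (phF x) = pr_proj c x }.

Lemma pres_hom_eq (c d : pres) (f g : pres_hom c d) :
  phR f =1 phR g -> phF f =1 phF g -> f = g.
Proof.
case: f g => [fR fF f1 f2] [gR gF g1 g2] /= /ghom_eq fgR /ghom_eq fgF.
by subst; rewrite (Prop_irrelevance f1 g1) (Prop_irrelevance f2 g2).
Qed.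

Definition pres_id (c : pres) : pres_hom c c :=
  @PresHom c c (ghom_id _) (ghom_id _) (fun=> erefl) (fun=> erefl).

Definition pres_comp (c d e : pres) (g : pres_hom d e) (f : pres_hom c d) :
  pres_hom c e :=
  @PresHom c e (ghom_comp (phR g) (phR f)) (ghom_comp (phF g) (phF f))
    (fun r => etrans (congr1 (phF g) (ph_inc f r)) (ph_inc g (phR f r)))
    (fun x => etrans (ph_proj g (phF f x)) (ph_proj f x)).

Definition Pres : category :=
  @Category pres pres_hom pres_id pres_comp
    (fun c d f => @pres_hom_eq c d (pres_comp f (pres_id c)) f (frefl _) (frefl _))
    (fun c d f => @pres_hom_eq c d (pres_comp (pres_id d) f) f (frefl _) (frefl _))
    (fun b c d e h g f => @pres_hom_eq b e (pres_comp h (pres_comp g f))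
       (pres_comp (pres_comp h g) f) (frefl _) (frefl _)).

End Presentations.

Section FunctorialIdeals.
Variables (k : comPzRingType) (G : grp).

Definition pr_alg (c : Pres G) : pzRingType := galg k (prF c).

Definition pr_map (c d : Pres G) (f : mor c d) : {rmorphism pr_alg c -> pr_alg d} :=
  galg_map k (phF f).

Record fideal := FIdeal {
  fi :> forall c : Pres G, ideal (pr_alg c);
  fi_map : forall (c d : Pres G) (f : mor c d) x, fi c x -> fi d (pr_map f x) }.

Definition fideal_sub (a b : fideal) : Prop := forall c x, a c x -> b c x.

Definition fideal_add (a b : fideal) : fideal.
Proof.
exists (fun c => ideal_add (a c) (b c)) => c d f _ [x [y [ax by_ ->]]].
exists (pr_map f x), (pr_map f y).
by split; [exact: fi_map | exact: fi_map | rewrite rmorphD].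
Defined.

Definition fideal_mul (a b : fideal) : fideal.
Proof.
exists (fun c => ideal_mul (a c) (b c)) => c d f _ [s sab ->].
exists [seq (pr_map f p.1, pr_map f p.2) | p <- s].
  by move=> _ /mapP[p /sab[ap bp] ->]; split; apply: fi_map.
by rewrite big_map rmorph_sum; apply: eq_bigr => p _; rewrite rmorphM.
Defined.

Section IdealFunctor.
Variable a : fideal.

Definition fideal_obj (c : Pres G) : lmodType k := submodule (galg_submod (a c)).

Definition fideal_fmap (c d : Pres G) (f : mor c d) :
    {linear fideal_obj c -> fideal_obj d} :=
  @submod_map k k idfun _ _
    (mk_linear (galg_mapD (phF f)) (galg_mapZ (phF f)))
    (galg_submod (a c)) (galg_submod (a d)) (fun x => fi_map (x := x) f).

Fact fideal_fmap_id c x : fideal_fmap (idc c) x = x.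
Proof. by apply: val_inj; apply: galg_map_id. Qed.

Fact fideal_fmap_comp c d e (g : mor d e) (f : mor c d) x :
  fideal_fmap (compc g f) x = fideal_fmap g (fideal_fmap f x).
Proof. by apply: val_inj; apply: galg_map_comp. Qed.

Definition fideal_functor : functor k (Pres G) :=
  Functor fideal_fmap_id fideal_fmap_comp.

End IdealFunctor.

Section TorFunctor.
Variables a a' b b' : fideal.

Definition ftor_left (c : Pres G) : lmodType (pr_alg c)^c :=
  right_quotient (a c) (a' c).
Definition ftor_right (c : Pres G) : lmodType (pr_alg c) :=
  left_quotient (b c) (b' c).

Definition ftor_obj (c : Pres G) : lmodType k :=
  Tor1 (galg_scalar (prF c)) (ftor_left c) (ftor_right c).

Definition ftor_fmap (c d : Pres G) (f : mor c d) :
    {linear ftor_obj c -> ftor_obj d} :=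
  Tor1_map (galg_map_scalar (phF f))
    (right_quotient_map (phi := pr_map f) (fun x => fi_map (x := x) f)
       (fun x => fi_map (x := x) f))
    (left_quotient_map (phi := pr_map f) (fun x => fi_map (x := x) f)
       (fun x => fi_map (x := x) f)).

Fact ftor_fmap_id c x : ftor_fmap (idc c) x = x.
Proof.
have pr_map_id : pr_map (idc c) =1 id by apply: galg_map_id.
apply: Tor1_map_id => //; exact: subquot_map_id.
Qed.

Fact ftor_fmap_comp c d e (g : mor d e) (f : mor c d) x :
  ftor_fmap (compc g f) x = ftor_fmap g (ftor_fmap f x).
Proof.
have pr_map_comp u : pr_map (compc g f) u = pr_map g (pr_map f u).
  exact: galg_map_comp.
apply: Tor1_map_comp => //; exact: subquot_map_comp.
Qed.

Definition ftor : functor k (Pres G) := Functor ftor_fmap_id ftor_fmap_comp.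

End TorFunctor.
End FunctorialIdeals.

Section ExactSequences.
Variable k : comPzRingType.

Definition zero_module (V : lmodType k) : Prop := forall x : V, x = 0.

Definition isomorphic (U V : lmodType k) : Prop :=
  exists f : {linear U -> V}, bijective f.

Definition exact_at (U V W : lmodType k) (f : {linear U -> V})
  (g : {linear V -> W}) : Prop := forall y, g y = 0 <-> exists x, f x = y.

End ExactSequences.

(* Main.v *)
Require Import Defs.
From HB Require Import structures.
From mathcomp Require Import all_boot all_algebra.
From mathcomp Require Import boolp functions.

(* Flatness of a and b makes the multiplication maps of a (x) b, a' (x) b and
   a (x) b' injective, whence a natural isomorphism
   Tor_1(a/a', b/b') = (a'b :&: ab') / a'b'.  The two short exact sequences
     0 -> a'b' -> a'b :&: ab' -> Tor_1 -> 0,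
     0 -> a'b :&: ab' -> a'b (+) ab' -> a'b + ab' -> 0
   of functors then give the result: lim^i of the middle term of the second
   vanishes, so lim^i (a'b + ab') = lim^(i+1) (a'b :&: ab'), and the long exact
   sequence of the first is the required one; in degree 0, the limits of
   a'b + ab' and a'b :&: ab' vanish because both are contained in ab.
   The long exact sequence of the derived limits is obtained from injective
   resolutions I, J, K of 0 -> A -> B -> D -> 0, from lifts I -> J -> K and from
   a homotopy of their composite to 0: the total complex of I -> J -> K is an
   exact complex of injectives bounded below, so lim keeps it exact. *)

Set Implicit Arguments.
Unset Strict Implicit.
Unset Printing Implicit Defensive.

Import GRing.Theory.
Local Open Scope ring_scope.

(** * Homology of complexes of modules *)

(** The resolutions behind [derlim] are fixed for each functor separately, so those of a short exact
    sequence need not form a short exact sequence themselves, and the two lifted chain maps need not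
    compose to zero. This is why the homotopy enters the differential of the total complex. For Tor,
    let P be free over I/I' with kernel K. Dimension shifting makes Tor_1(I/I', J/J') the kernel of
    K (x) J/J' -> P (x) J/J'. A lift P -> I of the covering restricts to K -> I', and multiplying by
    J/J' lands in A/I'J'. An element of that kernel has two descriptions, one over I' and J, one
    over I and J'; this puts its product in both I'J and IJ'. The lift P -> I depends on chosen
    representatives and is not natural. The discrepancy between two lifts takes values in the
    smaller ideal and is seen only through the differential to P (x) J/J', so it disappears on
    cycles. *)

Lemma dependent_sequence (T : nat -> Type) (P : forall n, T n -> Prop)
    (R : forall n, T n -> T n.+1 -> Prop) (x0 : T 0) :
    P 0 x0 -> (forall n x, P n x -> exists y, P n.+1 y /\ R n x y) ->
  exists s : forall n, T n, s 0 = x0 /\ forall n, R n (s n) (s n.+1).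
Proof.
move=> Px0 step.
pose next n (x : {x | P n x}) := cid (step n _ (svalP x)).
pose s := fix s n : {x | P n x} := match n with
  | 0 => exist _ x0 Px0
  | m.+1 => exist _ (sval (next m (s m))) (svalP (next m (s m))).1
  end.
exists (fun n => sval (s n)); split=> // n.
exact: (svalP (next n (s n))).2.
Qed.

Lemma dfun_choice (T : Type) (Y : T -> Type) (P : forall x, Y x -> Prop) :
  (forall x, exists y, P x y) -> exists f : forall x, Y x, forall x, P x (f x).
Proof. by move=> PY; exists (fun x => sval (cid (PY x))) => x; case: cid. Qed.

(** Homology maps and the map to Tor are given on representatives only. Written as additive
    relations, their well-definedness reduces to a condition at 0, and the resulting equivalence
    lets later arguments pick any convenient representative. *)
Lemma linear_of_relation (R : pzRingType) (U V : lmodType R)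
    (E : U -> V -> Prop) :
    (forall u u' v v', E u v -> E u' v' -> E (u + u') (v + v')) ->
    (forall a u v, E u v -> E (a *: u) (a *: v)) ->
    (forall u, exists v, E u v) -> (forall v, E 0 v -> v = 0) ->
  exists f : {linear U -> V}, forall u v, E u v <-> f u = v.
Proof.
move=> ED EZ tot E0.
have fct u v v' : E u v -> E u v' -> v = v'.
  move=> Ev Ev'; apply/eqP; rewrite -subr_eq0 -scaleN1r; apply/eqP/E0.
  by rewrite -(subrr u) -scaleN1r; apply/ED/EZ.
pose f u := sval (cid (tot u)).
have fE u : E u (f u) by rewrite /f; case: cid.
have fD : {morph f : u v / u + v}.
  by move=> u v; apply: fct (fE _) _; apply: ED.
have fZ a u : f (a *: u) = a *: f u by apply: fct (fE _) _; apply: EZ.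
exists (mk_linear fD fZ) => u v; split=> [Euv | <-]; last exact: fE.
exact: fct (fE _) Euv.
Qed.

Section HomologyClass.
Variables (R : pzRingType) (U V W : lmodType R).
Variables (f : {linear U -> V}) (g : {linear V -> W}).

(** A relation rather than a function on [ker g], so that cycles stay plain elements of [V]. *)
Definition hclass (x : V) (u : homology f g) : Prop :=
  exists gx : ker g x, u = qpi (comap (ker g) (im f)) (insubmod (ker g) gx).

Lemma hclass_ker x u : hclass x u -> g x = 0.
Proof. by case. Qed.

Lemma hclass_ex x : g x = 0 -> exists u, hclass x u.
Proof. by move=> gx; eexists; exists gx. Qed.

Lemma hclass_rep u : exists x, hclass x u.
Proof.
exists (val (repr u)), (submod_valP (repr u)).
by rewrite -[LHS]qpi_repr; congr qpi; apply: val_inj.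
Qed.

Lemma hclassD x y u v : hclass x u -> hclass y v -> hclass (x + y) (u + v).
Proof.
move=> [gx ->] [gy ->]; exists (submodD gx gy); rewrite -[LHS]linearD.
by congr qpi; apply: val_inj.
Qed.

Lemma hclassZ a x u : hclass x u -> hclass (a *: x) (a *: u).
Proof.
move=> [gx ->]; exists (submodZ a gx); rewrite -[LHS]linearZ_LR.
by congr qpi; apply: val_inj.
Qed.

Lemma hclass_eq0 x u : hclass x u -> u = 0 <-> exists y, f y = x.
Proof.
move=> [gx ->]; rewrite -(linear0 (qpi (comap (ker g) (im f)))).
by split=> [/qpi_eq|?]; [|apply/qpi_eq]; rewrite subr0.
Qed.

End HomologyClass.

Section Cohomology.
Variables (k : comPzRingType) (X : nat -> lmodType k).
Variable d : forall n, {linear X n -> X n.+1}.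

(** Has the shape of [derlim_of], including the zero endomorphism entering degree 0: for
    [d n := lim_map (ir_d I n)] the two are convertible. *)
Definition cohomology n : lmodType k :=
  match n with
  | 0 => homology (\0 : {linear X 0 -> X 0}) (d 0)
  | m.+1 => homology (d m) (d m.+1)
  end.

Definition cobound n : X n -> Prop :=
  match n with
  | 0 => fun x => x = 0
  | m.+1 => fun x => exists w, d m w = x
  end.

Definition coclass n : X n -> cohomology n -> Prop :=
  match n with
  | 0 => @hclass _ _ _ _ _ _
  | m.+1 => @hclass _ _ _ _ _ _
  end.

Lemma coclass_ker n x u : @coclass n x u -> d n x = 0.
Proof. by case: n x u => [|n] x u; apply: hclass_ker. Qed.

Lemma coclass_ex n x : d n x = 0 -> exists u, @coclass n x u.
Proof. by case: n x => [|n] x; apply: hclass_ex. Qed.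

Lemma coclass_rep n u : exists x, @coclass n x u.
Proof. by case: n u => [|n] u; apply: hclass_rep. Qed.

Lemma coclassD n x y u v :
  @coclass n x u -> @coclass n y v -> @coclass n (x + y) (u + v).
Proof. by case: n x y u v => [|n] x y u v; apply: hclassD. Qed.

Lemma coclassZ n a x u : @coclass n x u -> @coclass n (a *: x) (a *: u).
Proof. by case: n x u => [|n] x u; apply: hclassZ. Qed.

Lemma coclass_eq0 n x u : @coclass n x u -> u = 0 <-> cobound x.
Proof.
case: n x u => [|n] x u xu; rewrite (hclass_eq0 xu) //=.
by split=> [[y <-] | ->]; last exists 0.
Qed.

Lemma coclassB n x y u v :
  @coclass n x u -> @coclass n y v -> @coclass n (x - y) (u - v).
Proof. by move=> xu yv; rewrite -!scaleN1r; apply/coclassD/coclassZ. Qed.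

Lemma coclass_eq n x y u v : @coclass n x u -> @coclass n y v ->
  u = v <-> cobound (x - y).
Proof.
move=> xu yv; rewrite -(coclass_eq0 (coclassB xu yv)).
by split=> [-> | /eqP]; [rewrite subrr | rewrite subr_eq0 => /eqP].
Qed.

Lemma coclass_fun n x y u : @coclass n x u -> d n y = 0 -> cobound (x - y) ->
  @coclass n y u.
Proof.
move=> xu /coclass_ex[v yv] xy.
by rewrite ((coclass_eq xu yv).2 xy).
Qed.

Lemma cobound0 n : @cobound n 0.
Proof. by case: n => [//|n]; exists 0; rewrite linear0. Qed.

Lemma coboundD n x y : @cobound n x -> cobound y -> cobound (x + y).
Proof.
case: n x y => [|n] x y /=; first by move=> -> ->; rewrite addr0.
by move=> [v <-] [w <-]; exists (v + w); rewrite linearD.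
Qed.

Lemma coboundZ n a x : @cobound n x -> cobound (a *: x).
Proof.
case: n x => [|n] x /=; first by move=> ->; rewrite scaler0.
by move=> [v <-]; exists (a *: v); rewrite linearZ_LR.
Qed.

Lemma coboundN n x : @cobound n x -> cobound (- x).
Proof. by rewrite -scaleN1r; apply: coboundZ. Qed.

Lemma coboundB n x y : @cobound n x -> cobound y -> cobound (x - y).
Proof. by move=> cx /coboundN; apply: coboundD. Qed.

End Cohomology.

(** * Long exact sequence from a comparison with a mapping cone *)

Section LongExactSequence.
Variables (k : comPzRingType) (X Y Z : nat -> lmodType k).
Variable dX : forall n, {linear X n -> X n.+1}.
Variable dY : forall n, {linear Y n -> Y n.+1}.
Variable dZ : forall n, {linear Z n -> Z n.+1}.
Variables (f : forall n, {linear X n -> Y n}) (g : forall n, {linear Y n -> Z n}).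
Variable h : forall n, {linear X n.+1 -> Z n}.
Hypothesis fd : forall n x, f n.+1 (dX n x) = dY n (f n x).
Hypothesis gd : forall n y, g n.+1 (dY n y) = dZ n (g n y).
(* h is a homotopy from 0 to g f. *)
Hypothesis hd0 : forall x, h 0 (dX 0 x) = g 0 (f 0 x).
Hypothesis hd : forall n x,
  h n.+1 (dX n.+1 x) + dZ n (h n x) = g n.+1 (f n.+1 x).
(** A pair [(x, y)] with [dX x = 0] and [f x = dY y] is a cycle of degree [n] in the mapping cone of
    [f]. The two hypotheses say that [(x, y) |-> g y - h x], from this cone to [Z], is injective
    ([exactXY]) and surjective ([exactZ]) on cohomology. *)
Hypothesis exactXY : forall n (x : X n.+1) (y : Y n),
  dX n.+1 x = 0 -> f n.+1 x = dY n y -> cobound dZ (g n y - h n x) ->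
  exists2 x', dX n x' = x & cobound dY (y - f n x').
Hypothesis exactZ : forall n (z : Z n), dZ n z = 0 ->
  exists (x : X n.+1) (y : Y n),
    [/\ dX n.+1 x = 0, f n.+1 x = dY n y & cobound dZ (z - g n y + h n x)].

Let cobound_f n x : cobound dX x -> cobound dY (f n x).
Proof.
case: n x => [|n] x /=; first by move=> ->; rewrite linear0.
by move=> [w <-]; exists (f n w); rewrite fd.
Qed.

Let cobound_g n y : cobound dY y -> cobound dZ (g n y).
Proof.
case: n y => [|n] y /=; first by move=> ->; rewrite linear0.
by move=> [w <-]; exists (g n w); rewrite gd.
Qed.

Let homotopic0 n x : cobound dZ (h n (dX n x) - g n (f n x)).
Proof.
case: n x => [|n] x /=; first by rewrite hd0 subrr.
by exists (- h n x); rewrite -hd opprD addNKr linearN.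
Qed.

Let rel_f n (u : cohomology dX n) (v : cohomology dY n) : Prop :=
  exists2 x, coclass x u & coclass (f n x) v.

Let rel_g n (u : cohomology dY n) (v : cohomology dZ n) : Prop :=
  exists2 x, coclass x u & coclass (g n x) v.

(** The connecting map of the cone: a class of [Z] is represented by a cone cycle [(x, y)], which is
    projected to [x]. *)
Let rel_delta n (w : cohomology dZ n) (u : cohomology dX n.+1) : Prop :=
  exists z x y, [/\ coclass z w, @coclass _ _ dX n.+1 x u,
    f n.+1 x = dY n y & cobound dZ (z - g n y + h n x)].

Lemma long_exact_sequence : exists
    (fs : forall n, {linear cohomology dX n -> cohomology dY n})
    (gs : forall n, {linear cohomology dY n -> cohomology dZ n})
    (delta : forall n, {linear cohomology dZ n -> cohomology dX n.+1}),
  forall n, [/\ exact_at (fs n) (gs n), exact_at (gs n) (delta n)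
              & exact_at (delta n) (fs n.+1)].
Proof.
have ex_f n : exists F : {linear cohomology dX n -> cohomology dY n},
    forall u v, rel_f u v <-> F u = v.
  apply: linear_of_relation.
  - move=> u u' v v' [x xu fx] [x' xu' fx']; exists (x + x').
      exact: coclassD.
    by rewrite linearD; apply: coclassD.
  - move=> a u v [x xu fx]; exists (a *: x); first exact: coclassZ.
    by rewrite linearZ_LR; apply: coclassZ.
  - move=> u; have [x xu] := coclass_rep u.
    have [|v fxv] := @coclass_ex _ _ dY n (f n x); last by exists v, x.
    by rewrite -fd (coclass_ker xu) linear0.
  - move=> v [x /coclass_eq0[/(_ erefl) cx _] fx].
    exact/(coclass_eq0 fx)/cobound_f.
have ex_g n : exists F : {linear cohomology dY n -> cohomology dZ n},
    forall u v, rel_g u v <-> F u = v.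
  apply: linear_of_relation.
  - move=> u u' v v' [x xu fx] [x' xu' fx']; exists (x + x').
      exact: coclassD.
    by rewrite linearD; apply: coclassD.
  - move=> a u v [x xu fx]; exists (a *: x); first exact: coclassZ.
    by rewrite linearZ_LR; apply: coclassZ.
  - move=> u; have [x xu] := coclass_rep u.
    have [|v fxv] := @coclass_ex _ _ dZ n (g n x); last by exists v, x.
    by rewrite -gd (coclass_ker xu) linear0.
  - move=> v [x /coclass_eq0[/(_ erefl) cx _] fx].
    exact/(coclass_eq0 fx)/cobound_g.
have ex_delta n : exists F : {linear cohomology dZ n -> cohomology dX n.+1},
    forall u v, rel_delta u v <-> F u = v.
  apply: linear_of_relation.
  - move=> u u' v v' [z [x [y [zu xv fx c]]]] [z' [x' [y' [zu' xv' fx' c']]]].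
    exists (z + z'), (x + x'), (y + y'); split.
    + exact: coclassD.
    + exact: (@coclassD _ _ dX n.+1).
    + by rewrite !linearD fx fx'.
    + rewrite (linearD (g n)) (linearD (h n)) opprD (addrACA z) (addrACA (z - _)).
      exact: coboundD.
  - move=> a u v [z [x [y [zu xv fx c]]]].
    exists (a *: z), (a *: x), (a *: y); split.
    + exact: coclassZ.
    + exact: (@coclassZ _ _ dX n.+1).
    + by rewrite !linearZ_LR fx.
    + by rewrite (linearZ_LR (g n)) (linearZ_LR (h n)) -scalerBr -scalerDr; apply: coboundZ.
  - move=> w; have [z zw] := coclass_rep w.
    have [x [y [dx fx c]]] := exactZ (coclass_ker zw).
    by have [u xu] := @coclass_ex _ _ dX n.+1 x dx; exists u, z, x, y.
  - move=> u [z [x [y [/coclass_eq0[/(_ erefl) cz _] xu fx c]]]].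
    apply/(@coclass_eq0 _ _ dX n.+1 x u xu).
    have [||x' <-] := @exactXY n x y _ fx; last by exists x'.
      exact: (@coclass_ker _ _ dX n.+1 x u).
    by have := coboundB cz c; rewrite opprD opprB addrA (addrC z) subrK.
have [fs fsE] := dfun_choice ex_f; have [gs gsE] := dfun_choice ex_g.
have [delta deltaE] := dfun_choice ex_delta.
exists fs, gs, delta => n; split.
- move=> v; split=> [|[u <-]].
    move=> /gsE[y yv /coclass_eq0[/(_ erefl) cgy _]].
    (* A cycle [y] of [Y] is the cone cycle [(0, y)], to which [exactXY] applies. *)
    have f0 : f n.+1 0 = dY n y by rewrite linear0 (coclass_ker yv).
    have [|x dx c] := exactXY (linear0 _) f0; first by rewrite linear0 subr0.
    have [u xu] := coclass_ex dx; exists u; apply/fsE; exists x => //.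
    by apply: coclass_fun yv _ c; rewrite -fd dx linear0.
  have /fsE[x xu fxv] : fs n u = fs n u by [].
  apply/gsE; exists (f n x) => //.
  have [|w fxw] := @coclass_ex _ _ dZ n (g n (f n x)).
    by rewrite -gd -fd (coclass_ker xu) !linear0.
  suff <- : w = 0 by [].
  apply/(coclass_eq0 fxw); have := coboundN (homotopic0 x).
  by rewrite (coclass_ker xu) linear0 sub0r opprK.
- move=> w; split=> [|[v <-]].
    move=> /deltaE[z [x [y [zw x0 fx c]]]].
    have [x' dx] : cobound dX x by apply/(coclass_eq0 x0).
    (* Subtracting [f x'] turns [y] into a cycle. The class of its image is still that of [z],
       because [g (f x')] and [h (dX x')] differ by a coboundary. *)
    have dy' : dY n (y - f n x') = 0 by rewrite linearB -fd dx fx subrr.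
    have [v yv] := coclass_ex dy'; exists v; apply/gsE.
    exists (y - f n x') => //; apply: coclass_fun zw _ _.
      by rewrite -gd dy' linear0.
    suff -> : z - g n (y - f n x') = z - g n y + h n x -
        (h n (dX n x') - g n (f n x')) by apply/coboundB/homotopic0.
    rewrite dx (linearB (g n)) !opprB -[RHS]addrA (addrC (h n x)) subrK.
    by rewrite addrA addrAC.
  have /gsE[y yv gy] : gs n v = gs n v by [].
  apply/deltaE; exists (g n y), 0, y; split=> //.
  + have [u zu] := @coclass_ex _ _ dX n.+1 0 (linear0 _).
    suff <- : u = 0 by [].
    by apply/(@coclass_eq0 _ _ dX n.+1 _ _ zu)/cobound0.
  + by rewrite linear0 (coclass_ker yv).
  + by rewrite subrr linear0 addr0; apply: cobound0.
- move=> u; split=> [|[w <-]].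
    move=> /fsE[x xu fx0].
    have [y fx] : @cobound _ _ dY n.+1 (f n.+1 x) by apply/(coclass_eq0 fx0).
    (* The preimage of [u] is the image in [Z] of the cone cycle [(x, y)]; the homotopy identity
       [hd] shows that it is a cycle. *)
    have [|w zw] := @coclass_ex _ _ dZ n (g n y - h n x).
      rewrite linearB -gd fx.
      have := hd x; rewrite (@coclass_ker _ _ dX n.+1 x u xu) linear0 add0r.
      by move=> ->; rewrite subrr.
    exists w; apply/deltaE; exists (g n y - h n x), x, y; split=> //.
    by rewrite addrAC subrK subrr; apply: cobound0.
  have /deltaE[z [x [y [zw xu fx c]]]] : delta n w = delta n w by [].
  apply/fsE; exists x => //.
  have [|v fxv] := @coclass_ex _ _ dY n.+1 (f n.+1 x).
    by rewrite -fd (@coclass_ker _ _ dX n.+1 _ _ xu) linear0.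
  suff <- : v = 0 by [].
  by apply/(@coclass_eq0 _ _ dY n.+1 _ _ fxv); exists y.
Qed.

End LongExactSequence.

(** * Derived limits *)

Section FunctorConstructions.
Variables (k : comPzRingType) (C : category).
Implicit Types F H J : functor k C.

Definition mk_nattrans F H (t : forall c, F c -> H c)
    (tD : forall c, {morph t c : x y / x + y})
    (tZ : forall c a x, t c (a *: x) = a *: t c x)
    (tN : forall c d (m : mor c d) x, t d (fmap F m x) = fmap H m (t c x)) :
  nattrans F H :=
  @NatTrans k C F H (fun c => mk_linear (tD c) (tZ c)) tN.

Section Subfunctor.
Variables (F : functor k C) (S : forall c, submod (F c)).
Hypothesis fS : forall c d (m : mor c d) x, S c x -> S d (fmap F m x).

Definition subfunctor_fmap c d (m : mor c d) :
    {linear submodule (S c) -> submodule (S d)} :=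
  @submod_map k k idfun _ _ (fmap F m) _ _ (@fS c d m).

Fact subfunctor_fmap_id c x : subfunctor_fmap (idc c) x = x.
Proof. by apply: val_inj; apply: fmap_id. Qed.

Fact subfunctor_fmap_comp c d e (m' : mor d e) (m : mor c d) x :
  subfunctor_fmap (compc m' m) x = subfunctor_fmap m' (subfunctor_fmap m x).
Proof. by apply: val_inj; apply: fmap_comp. Qed.

Definition subfunctor : functor k C :=
  Functor subfunctor_fmap_id subfunctor_fmap_comp.

Definition subfunctor_incl : nattrans subfunctor F :=
  @mk_nattrans subfunctor F (fun c x => val x)
    (fun c x y => erefl) (fun c a x => erefl) (fun c d m x => erefl).

End Subfunctor.

(* Injectivity, applied to the inclusion of the image of d. *)
Lemma injective_factor F H J (d : nattrans F H) (v : nattrans F J) :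
    injective_functor J -> (forall c x, d c x = 0 -> v c x = 0) ->
  exists w : nattrans H J, forall c x, w c (d c x) = v c x.
Proof.
move=> injJ dv; pose I := subfunctor (coker_im (u := d)).
have ex_v' c : exists f : {linear I c -> J c}, forall y z,
    (exists2 x, d c x = val y & v c x = z) <-> f y = z.
  apply: linear_of_relation.
  - move=> y y' z z' [x dx <-] [x' dx' <-]; exists (x + x'); rewrite linearD //.
    by rewrite dx dx'.
  - move=> a y z [x dx <-]; exists (a *: x); rewrite linearZ_LR //.
    by rewrite dx.
  - by move=> y; have [x dx] := submod_valP y; exists (v c x), x.
  - by move=> z [x /dv dx <-].
have [v' v'E] := dfun_choice ex_v'.
have v'N c d' (m : mor c d') x : v' d' (fmap I m x) = fmap J m (v' c x).
  have /v'E[y dy <-] : v' c x = v' c x by [].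
  by apply/v'E; exists (fmap F m y); rewrite nt_natural // dy.
have [|w wE] := injJ _ _ (subfunctor_incl (coker_im (u := d))) (NatTrans v'N).
  by move=> c x y; apply: val_inj.
exists w => c x; have dx : im (d c) (d c x) by exists x.
rewrite [LHS](wE c (insubmod _ dx)).
by apply/v'E; exists x.
Qed.

Definition nat_id F : nattrans F F :=
  @mk_nattrans F F (fun c x => x) (fun c x y => erefl) (fun c a x => erefl)
    (fun c d m x => erefl).

Definition nat_zero F H : nattrans F H :=
  @mk_nattrans F H (fun c x => 0) (fun c x y => esym (addr0 0))
    (fun c a x => esym (scaler0 _ a))
    (fun c d m x => esym (linear0 (fmap H m))).

Fact nat_subD F H (t u : nattrans F H) c :
  {morph (fun x => t c x - u c x) : x y / x + y}.
Proof. by move=> x y; rewrite (linearD (t c)) (linearD (u c)) opprD addrACA. Qed.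

Fact nat_subZ F H (t u : nattrans F H) c a x :
  t c (a *: x) - u c (a *: x) = a *: (t c x - u c x).
Proof. by rewrite (linearZ_LR (t c)) (linearZ_LR (u c)) scalerBr. Qed.

Fact nat_subN F H (t u : nattrans F H) c d (m : mor c d) x :
  t d (fmap F m x) - u d (fmap F m x) = fmap H m (t c x - u c x).
Proof. by rewrite linearB !nt_natural. Qed.

Definition nat_sub F H (t u : nattrans F H) : nattrans F H :=
  mk_nattrans (nat_subD t u) (@nat_subZ F H t u) (@nat_subN F H t u).

Definition void_module : lmodType k := GRing.Lmodule.clone k (void -> k^o) _.

Definition zero_functor : functor k C :=
  @Functor k C (fun=> void_module) (fun _ _ _ => idfun) (fun _ _ => erefl)
    (fun _ _ _ _ _ _ => erefl).

Lemma zero_functorE c (x y : zero_functor c) : x = y.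
Proof. by apply: funext => -[]. Qed.

Lemma zero_functor_injective : injective_functor zero_functor.
Proof.
by move=> F H u v _; exists (nat_zero H zero_functor) => c x; apply: zero_functorE.
Qed.

Section Product.
Variables F H : functor k C.

Definition prod_obj c : lmodType k := GRing.Lmodule.clone k (F c * H c)%type _.

Definition prod_fmap c d (m : mor c d) : {linear prod_obj c -> prod_obj d}.
Proof.
apply: (@mk_linear k _ _ (fun p => (fmap F m p.1, fmap H m p.2))).
- by move=> p q; rewrite !linearD.
- by move=> a p; rewrite !linearZ_LR.
Defined.

Definition prod_functor : functor k C.
Proof.
apply: (@Functor k C prod_obj prod_fmap).
- by move=> c [x y]; congr pair; apply: fmap_id.
- by move=> c d e m' m [x y]; congr pair; apply: fmap_comp.
Defined.

Definition prod_fst : nattrans prod_functor F :=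
  @mk_nattrans prod_functor F (fun c p => p.1)
    (fun c x y => erefl) (fun c a x => erefl) (fun c d m x => erefl).

Definition prod_snd : nattrans prod_functor H :=
  @mk_nattrans prod_functor H (fun c p => p.2)
    (fun c x y => erefl) (fun c a x => erefl) (fun c d m x => erefl).

Definition nat_pair J (t : nattrans J F) (u : nattrans J H) :
  nattrans J prod_functor.
Proof.
apply: (@mk_nattrans J prod_functor (fun c x => (t c x, u c x))).
- by move=> c x y; rewrite !linearD.
- by move=> c a x; rewrite !linearZ_LR.
- by move=> c d m x; congr pair; apply: nt_natural.
Defined.

Lemma prod_functor_injective :
  injective_functor F -> injective_functor H -> injective_functor prod_functor.
Proof.
move=> injF injH A B u v u_mono.
have [w1 w1E] := injF A B u (nat_comp prod_fst v) u_mono.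
have [w2 w2E] := injH A B u (nat_comp prod_snd v) u_mono.
exists (nat_pair w1 w2) => c x.
by rewrite [RHS]surjective_pairing; congr pair; [apply: w1E | apply: w2E].
Qed.

End Product.

Lemma lim_eq F (u v : lim F) : (forall c, val u c = val v c) -> u = v.
Proof.
move=> uv; apply: val_inj; apply: functional_extensionality_dep => c.
exact: uv.
Qed.

Lemma lim_compat F (u : lim F) c d (m : mor c d) : fmap F m (val u c) = val u d.
Proof. exact: (submod_valP u). Qed.

Definition lim_pair F H (u : lim F) (v : lim H) : lim (prod_functor F H).
Proof.
apply: (@insubmod _ _ (compatible (prod_functor F H)) (fun c => (val u c, val v c))).
by move=> c d m; congr pair; apply: lim_compat.
Defined.

(** Such a complex splits naturally, by maps [s] with [D s D = D], and natural maps pass to limits.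
    In degree 0 [s] is a retraction of [D 0]. Given [s] in degree [n], the map [id - D s] kills the
    image of [D n], which is the kernel of [D n.+1], so by injectivity it factors as [t D]; then
    [D t D = D] because [D D = 0]. *)
Lemma lim_exact (T : nat -> functor k C) (D : forall n, nattrans (T n) (T n.+1)) :
    (forall n, injective_functor (T n)) -> mono (D 0) ->
    (forall n c x, D n.+1 c x = 0 <-> exists y, D n c y = x) ->
  forall n (u : lim (T n.+1)), lim_map (D n.+1) u = 0 ->
  exists w, lim_map (D n) w = u.
Proof.
move=> injT D0 D_exact.
have ex_s n : exists s : nattrans (T n.+1) (T n),
    forall c x, D n c (s c (D n c x)) = D n c x.
  elim: n => [|n [s sE]].
    have [|s sE] := @injective_factor _ _ _ (D 0) (nat_id (T 0)) (injT 0).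
      by move=> c x Dx; apply: (D0 c); rewrite linear0.
    by exists s => c x; rewrite sE.
  have [|t tE] := @injective_factor _ _ _ (D n.+1)
      (nat_sub (nat_id (T n.+1)) (nat_comp (D n) s)) (injT n.+1).
    move=> c x /D_exact[y <-].
    by rewrite [LHS](_ : _ = D n c y - D n c (s c (D n c y))) // sE subrr.
  exists t => c x; rewrite tE.
  rewrite [nat_sub _ _ c x](_ : _ = x - D n c (s c x)) // linearB.
  by rewrite [X in _ - X](_ : _ = 0) ?subr0 //; apply/D_exact; exists (s c x).
move=> n u Du; have [s sE] := ex_s n; exists (lim_map s u).
apply: lim_eq => c.
have /D_exact[y Dy] : D n.+1 c (val u c) = 0.
  exact: (congr1 (fun v : lim _ => val v c) Du).
by rewrite [LHS](_ : _ = D n c (s c (val u c))) // -Dy sE.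
Qed.

(** Shifting by padding with the zero functor keeps every degree in [nat], so no negative index
    occurs in the total complex. *)
Definition shift (I : nat -> functor k C) n : functor k C :=
  if n is m.+1 then I m else zero_functor.

Definition shift_d (I : nat -> functor k C)
    (d : forall n, nattrans (I n) (I n.+1)) n :
  nattrans (shift I n) (shift I n.+1) :=
  match n with 0 => nat_zero _ _ | m.+1 => d m end.

Definition shift_map (I J : nat -> functor k C)
    (t : forall n, nattrans (I n) (J n)) n : nattrans (shift I n) (shift J n) :=
  match n with 0 => nat_zero _ _ | m.+1 => t m end.

Lemma shift_injective I : (forall n, injective_functor (I n)) ->
  forall n, injective_functor (shift I n).
Proof. by move=> injI [|n]; [apply: zero_functor_injective | apply: injI]. Qed.

End FunctorConstructions.

(** * Lifts to injective resolutions and the total complex *)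

Section ShortExact.
Variables (k : comPzRingType) (C : category).

Definition short_exact (A B D : functor k C) (f : nattrans A B)
    (g : nattrans B D) : Prop :=
  [/\ mono f, forall c, exact_at (f c) (g c)
    & forall c z, exists y, g c y = z].

Lemma resolution_lift (A B : functor k C) (f : nattrans A B)
    (I : injective_resolution A) (J : injective_resolution B) :
  exists F : forall n, nattrans (ir I n) (ir J n),
    (forall c x, F 0 c (ir_aug I c x) = ir_aug J c (f c x)) /\
    (forall n c x, F n.+1 c (ir_d I n c x) = ir_d J n c (F n c x)).
Proof.
have [|F0 F0E] := @injective_factor _ _ _ _ _ (ir_aug I)
    (nat_comp (ir_aug J) f) (@ir_injective _ _ _ J 0).
  move=> c x xi0; suff -> : x = 0 by rewrite linear0.
  by apply: (@ir_aug_mono _ _ _ I c); rewrite linear0.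
(* The invariant, that [F] preserves cocycles, is what lets [ir_d J n] after [F] factor through
   [ir_d I n]. *)
pose P n (F : nattrans (ir I n) (ir J n)) :=
  forall c x, ir_d I n c x = 0 -> ir_d J n c (F c x) = 0.
have [||F [F0' F']] := @dependent_sequence _ P (fun n F F' => forall c x,
    F' c (ir_d I n c x) = ir_d J n c (F c x)) F0.
- move=> c x /ir_exact0[y <-]; rewrite F0E.
  by apply/ir_exact0; exists (f c y).
- move=> n F PF.
  have [F' F'E] := @injective_factor _ _ _ _ _ (ir_d I n)
    (nat_comp (ir_d J n) F) (@ir_injective _ _ _ J n.+1) PF.
  exists F'; split=> // c x /ir_exact[y <-]; rewrite F'E.
  by apply/ir_exact; exists (F c y).
by exists F; rewrite F0'.
Qed.

Section Resolutions.
Variables (A B D : functor k C) (f : nattrans A B) (g : nattrans B D).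
Variables (I : injective_resolution A) (J : injective_resolution B).
Variable K : injective_resolution D.
Hypothesis fg : short_exact f g.
Variable F : forall n, nattrans (ir I n) (ir J n).
Hypothesis F_aug : forall c x, F 0 c (ir_aug I c x) = ir_aug J c (f c x).
Hypothesis F_d : forall n c x, F n.+1 c (ir_d I n c x) = ir_d J n c (F n c x).
Variable H : forall n, nattrans (ir J n) (ir K n).
Hypothesis H_aug : forall c x, H 0 c (ir_aug J c x) = ir_aug K c (g c x).
Hypothesis H_d : forall n c x, H n.+1 c (ir_d J n c x) = ir_d K n c (H n c x).

Let sK := shift (ir K).
Let sdK := shift_d (ir_d K).

Lemma resolution_homotopy : exists h : forall n, nattrans (ir I n) (sK n),
  forall n c x, h n.+1 c (ir_d I n c x) + sdK n c (h n c x) =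
                H n c (F n c x).
Proof.
(* The part of the composite not yet accounted for by [h] must vanish on cocycles in order to factor
   through [ir_d I n]. The start is [h = 0], with values in the zero functor, and the invariant
   there reads [g f = 0]. *)
pose P n (h : nattrans (ir I n) (sK n)) :=
  forall c x, ir_d I n c x = 0 -> H n c (F n c x) - sdK n c (h c x) = 0.
have [||h [_ hE]] := @dependent_sequence _ P (fun n h h' => forall c x,
    h' c (ir_d I n c x) = H n c (F n c x) - sdK n c (h c x))
    (nat_zero (ir I 0) (sK 0)).
- move=> c x /ir_exact0[y <-]; rewrite F_aug H_aug subr0.
  have [_ fg_exact _] := fg.
  by rewrite (_ : g c (f c y) = 0) ?linear0 //; apply/fg_exact; exists y.
- move=> n h Ph.
  have [h' h'E] := @injective_factor _ _ _ _ _ (ir_d I n)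
    (nat_sub (nat_comp (H n) (F n)) (nat_comp (sdK n) h))
    (@ir_injective _ _ _ K n) Ph.
  exists h'; split=> // c x /ir_exact[y <-]; rewrite h'E.
  rewrite [X in _ - X](_ : _ = H n.+1 c (F n.+1 c (ir_d I n c y))) ?subrr //.
  rewrite F_d H_d; apply: etrans (linearB (ir_d K n c) _ _) _.
  rewrite [X in _ - X](_ : _ = 0) ?subr0 //.
  case: n h y {Ph h' h'E x} => [|n] h y /=; first by rewrite linear0.
  by apply/ir_exact; exists (h c y).
by exists h => n c x; rewrite hE subrK.
Qed.

Variable h : forall n, nattrans (ir I n) (sK n).
Hypothesis hE : forall n c x,
  h n.+1 c (ir_d I n c x) + sdK n c (h n c x) = H n c (F n c x).

(** [sK] is already shifted once, so the three summands are I^n, J^(n-1) and K^(n-2). *)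
Definition total n : functor k C :=
  prod_functor (ir I n) (prod_functor (shift (ir J) n) (shift sK n)).

(* total is the total complex of I -> J -> K, whose exactness encodes both the
   exactness of the columns and that of A -> B -> D. *)
Definition total_d n : nattrans (total n) (total n.+1) :=
  let x := prod_fst (ir I n) (prod_functor (shift (ir J) n) (shift sK n)) in
  let yz := prod_snd (ir I n) (prod_functor (shift (ir J) n) (shift sK n)) in
  let y := nat_comp (prod_fst (shift (ir J) n) (shift sK n)) yz in
  let z := nat_comp (prod_snd (shift (ir J) n) (shift sK n)) yz in
  nat_pair (nat_comp (ir_d I n) x)
    (@nat_pair _ _ (ir J n) (sK n) _
      (nat_sub (nat_comp (F n) x) (nat_comp (shift_d (ir_d J) n) y))
      (nat_sub (nat_comp (shift_map H n) y)
        (nat_sub (nat_comp (h n) x) (nat_comp (shift_d sdK n) z)))).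

Lemma total_dE n c (x : ir I n c) (y : shift (ir J) n c) (z : shift sK n c) :
  total_d n c (x, (y, z)) =
  (ir_d I n c x, (F n c x - shift_d (ir_d J) n c y,
     shift_map H n c y - (h n c x - shift_d sdK n c z))).
Proof. by []. Qed.

Lemma total_injective n : injective_functor (total n).
Proof.
have injK := shift_injective (fun n => @ir_injective _ _ _ K n).
apply: prod_functor_injective; first exact: ir_injective.
apply: prod_functor_injective; first exact: (shift_injective (@ir_injective _ _ _ J)).
exact: (shift_injective injK).
Qed.

(** Only I^0 survives in degree 0. An element killed by both [ir_d I 0] and [F 0] is the
    augmentation of some [a] with [f a = 0], hence zero since [f] is mono. *)
Lemma total_d0_mono : mono (total_d 0).
Proof.
have [f_mono fg_exact _] := fg.
suff ker0 c p : total_d 0 c p = 0 -> p = 0.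
  move=> c p q pq; apply/eqP; rewrite -subr_eq0; apply/eqP/(ker0 c).
  by rewrite linearB pq subrr.
case: p => x [y z]; rewrite total_dE => -[/ir_exact0[a <-] Fa _].
have Fa0 : ir_aug J c (f c a) = 0 by rewrite -F_aug -[LHS]subr0.
suff -> : a = 0.
  by rewrite linear0; congr pair; congr pair; apply: zero_functorE.
apply: (f_mono c); rewrite linear0; apply: (@ir_aug_mono _ _ _ J c).
by rewrite Fa0 linear0.
Qed.

(** Beyond exactness of the resolutions, cycles of degree 1 are filled by exactness at [B] and
    cycles of degree 2 by surjectivity of [g]; this accounts for the two case distinctions on
    [n]. *)
Lemma total_exact n c p :
  total_d n.+1 c p = 0 <-> exists q, total_d n c q = p.
Proof.
have [f_mono fg_exact g_surj] := fg.
split=> [|[[x [y z]] <-]]; last first.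
  have dd (L : functor k C) (M : injective_resolution L) m w :
    ir_d M m c (shift_d (ir_d M) m c w) = 0.
    by case: m w => [|m] w /=; [apply: linear0 | apply/ir_exact; exists w].
  have sdd : sdK n c (shift_d sdK n c z) = 0.
    by case: n z {p x y} => [|n] z; [apply: linear0 | apply: dd].
  have sHd : sdK n c (shift_map H n c y) = H n c (shift_d (ir_d J) n c y).
    case: n y {p x z sdd} => [|n] y; last exact/esym/H_d.
    by rewrite [LHS]linear0 [RHS]linear0.
  rewrite !total_dE; congr pair; first by apply/ir_exact; exists x.
  congr pair; rewrite /=.
    by rewrite F_d linearB dd subr0 subrr.
  rewrite (linearB (H n c)) (linearB (sdK n c)) (linearB (sdK n c)).
  rewrite sdd subr0 sHd -hE.
  set r := h n.+1 c _; set s := sdK n c _; set b := H n c _.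
  by rewrite (opprB r) -(addrA b) subrKA addrA addrK subrr.
case: p => x [y z]; rewrite total_dE => -[dx Fy Hz].
have {}Fy := subr0_eq Fy; have {}Hz := subr0_eq Hz.
case: n x y z dx Fy Hz => [|n] x y z /ir_exact[x' <-] Fy Hz.
  have dy : ir_d J 0 c (y - F 0 c x') = 0 by rewrite linearB -[X in _ - X]F_d Fy subrr.
  have [b bE] := (ir_exact0 _).1 dy.
  have Kgb : ir_aug K c (g c b) = 0.
    rewrite -H_aug bE linearB; apply/eqP; rewrite subr_eq0; apply/eqP.
    by rewrite [LHS]Hz -hE; congr (_ + _); exact: oppr0.
  have gb : g c b = 0 by apply: (@ir_aug_mono _ _ _ K c); rewrite linear0.
  have [a fa] := (fg_exact c b).1 gb.
  (* Adding the augmentation of [a] leaves the differential of [x'] unchanged and supplies the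
     missing [y - F x'], which is the augmentation of [b = f a]. *)
  exists (x' + ir_aug I c a, (0, 0)); rewrite total_dE; congr pair.
    rewrite linearD (_ : ir_d I 0 c (ir_aug I c a) = 0) ?addr0 //.
    by apply/ir_exact0; exists a.
  congr pair; last exact: zero_functorE.
  by apply: etrans (subr0 _) _; rewrite linearD F_aug fa bE addrC subrK.
have dy : ir_d J n.+1 c (y - F n.+1 c x') = 0.
  by rewrite linearB -[X in _ - X]F_d Fy subrr.
have [y1 y1E] := (ir_exact _).1 dy.
(* The pair [(x', - y1)] already produces the first two components; [w] is the error left in the
   third. It is a cocycle, and [total1] says that it may be absorbed by a cocycle [y2] together with
   some [z1]. *)
pose w : ir K n c := z + (H n c y1 + h n.+1 c x').
have dw : ir_d K n c w = 0.
  have dz : ir_d K n c z = h n.+2 c (ir_d I n.+1 c x') - H n.+1 c y.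
    by rewrite Hz opprB addrC subrK.
  have dh : ir_d K n c (h n.+1 c x') =
      H n.+1 c (F n.+1 c x') - h n.+2 c (ir_d I n.+1 c x').
    by rewrite -hE addrC addKr.
  rewrite linearD (linearD (ir_d K n c)) dz dh -H_d y1E (linearB (H n.+1 c)).
  by rewrite !subrKA subrr.
have total1 y2 z1 : ir_d J n c y2 = 0 ->
    H n c y2 + sdK n c z1 = w ->
    exists q, total_d n.+1 c q = (ir_d I n.+1 c x', (y, z)).
  move=> dy2 wE; exists (x', (y2 - y1, z1)); rewrite total_dE; congr pair.
  congr pair; first by rewrite linearB dy2 sub0r opprK y1E addrC subrK.
  rewrite [LHS](_ : _ = H n c (y2 - y1) - (h n.+1 c x' - sdK n c z1)) //.
  by rewrite linearB (opprB (h n.+1 c x')) addrACA wE /w -opprD addrK.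
clearbody w; clear Fy Hz dy y1E; case: n x x' y z y1 w dw total1
  => [|n] x x' y z y1 w dw total1.
  have [v vw] := (ir_exact0 _).1 dw; have [b gb] := g_surj c v.
  apply: (total1 (ir_aug J c b) 0); first by apply/ir_exact0; exists b.
  by rewrite linear0 addr0 H_aug gb.
have [z1 z1w] := (ir_exact _).1 dw.
by apply: (total1 0 z1); rewrite linear0 ?add0r.
Qed.

Lemma lim_total_exact n (x : lim (ir I n.+1)) (y : lim (ir J n))
    (z : lim (sK n)) :
    lim_map (ir_d I n.+1) x = 0 ->
    lim_map (F n.+1) x = lim_map (ir_d J n) y ->
    lim_map (H n) y + lim_map (sdK n) z = lim_map (h n.+1) x ->
  exists (x' : lim (ir I n)) (y' : lim (shift (ir J) n)) (z' : lim (shift sK n)),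
    [/\ lim_map (ir_d I n) x' = x,
        y = lim_map (F n) x' - lim_map (shift_d (ir_d J) n) y'
      & z = lim_map (shift_map H n) y' + lim_map (shift_d sdK n) z' -
            lim_map (h n) x'].
Proof.
move=> dx Fx Hy.
pose u : lim (total n.+1) := lim_pair x (lim_pair y z).
have [|w wu] := lim_exact total_injective total_d0_mono total_exact (u := u).
  apply: lim_eq => c; rewrite [LHS]total_dE; congr pair.
    exact: (congr1 (fun v : lim _ => val v c) dx).
  congr pair.
    have FxE : F n.+1 c (val x c) = ir_d J n c (val y c).
      exact: (congr1 (fun v : lim _ => val v c) Fx).
    by apply: etrans (subrr (ir_d J n c (val y c))); congr (_ - _).
  have HyE : H n c (val y c) + sdK n c (val z c) = h n.+1 c (val x c).
    exact: (congr1 (fun v : lim _ => val v c) Hy).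
  rewrite [LHS](_ : _ = H n c (val y c) - (h n.+1 c (val x c) - sdK n c (val z c))) //.
  by rewrite -HyE addrK subrr.
pose x' := lim_map (prod_fst _ _) w.
pose yz := lim_map (prod_snd _ _) w.
exists x', (lim_map (prod_fst _ _) yz), (lim_map (prod_snd _ _) yz).
have wuE c : total_d n c (val w c) = (val x c, (val y c, val z c)).
  exact: (congr1 (fun v : lim _ => val v c) wu).
split; apply: lim_eq => c.
- exact: (congr1 fst (wuE c)).
- exact/esym/(congr1 (fst \o snd) (wuE c)).
- apply/esym/(etrans _ (congr1 (snd \o snd) (wuE c))).
  by rewrite /= opprB addrA.
Qed.

End Resolutions.

Lemma derlim_of_long_exact (A B D : functor k C) (f : nattrans A B)
    (g : nattrans B D) (I : injective_resolution A)
    (J : injective_resolution B) (K : injective_resolution D) :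
  short_exact f g -> exists
    (fs : forall n, {linear derlim_of I n -> derlim_of J n})
    (gs : forall n, {linear derlim_of J n -> derlim_of K n})
    (delta : forall n, {linear derlim_of K n -> derlim_of I n.+1}),
  forall n, [/\ exact_at (fs n) (gs n), exact_at (gs n) (delta n)
              & exact_at (delta n) (fs n.+1)].
Proof.
move=> fg; have [F [F_aug F_d]] := resolution_lift f I J.
have [H [H_aug H_d]] := resolution_lift g J K.
have [h hE] := resolution_homotopy fg F_aug F_d H_aug H_d.
have lim_total := lim_total_exact fg F_aug F_d H_aug H_d hE.
have cobound_shift n (z : lim (shift (ir K) n)) :
    cobound (fun n => lim_map (ir_d K n)) (lim_map (shift_d (ir_d K) n) z).
  by case: n z => [|n] z; [apply: lim_eq | exists z].
have cobound_shiftJ n (z : lim (shift (ir J) n)) :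
    cobound (fun n => lim_map (ir_d J n)) (lim_map (shift_d (ir_d J) n) z).
  by case: n z => [|n] z; [apply: lim_eq | exists z].
have shift_cobound n (z : lim (ir K n)) :
    cobound (fun n => lim_map (ir_d K n)) z ->
    exists w : lim (shift (ir K) n), lim_map (shift_d (ir_d K) n) w = z.
  by case: n z => [|n] z //= ->; exists 0; apply: lim_eq.
apply: (@long_exact_sequence k _ _ _ (fun n => lim_map (ir_d I n))
  (fun n => lim_map (ir_d J n)) (fun n => lim_map (ir_d K n))
  (fun n => lim_map (F n)) (fun n => lim_map (H n))
  (fun n => lim_map (h n.+1))).
- by move=> n x; apply: lim_eq => c; apply: F_d.
- by move=> n x; apply: lim_eq => c; apply: H_d.
- by move=> x; apply: lim_eq => c; rewrite -[LHS]addr0; apply: hE.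
- by move=> n x; apply: lim_eq => c; apply: hE.
- move=> n x y dx Fx /shift_cobound[w wE].
  (* The sign of [w] makes [(x, y, - w)] a cycle of the total complex. *)
  have [|x' [y' [z' [<- -> _]]]] := lim_total n x y (- w) dx Fx.
    by rewrite linearN wE opprB addrC subrK.
  exists x' => //; rewrite addrAC subrr add0r -linearN; exact: cobound_shiftJ.
- move=> n z dz.
  (* A cocycle of [K] in degree [n] is a cycle of the total complex in degree [n + 2], concentrated
     in the last summand. *)
  have [||| x [y [w [dx Fy zE]]]] := lim_total n.+1 0 0 z.
  + exact: linear0.
  + by rewrite !linear0.
  + by rewrite !linear0 add0r.
  exists x, y; split=> //.
    by apply/eqP; rewrite -subr_eq0 -Fy.
  have {}zE : z = lim_map (H n) y + lim_map (shift_d (shift_d (ir_d K)) n.+1) w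
      - lim_map (h n.+1) x by [].
  rewrite zE addrAC subrK addrAC subrr add0r; exact: cobound_shift.
Qed.

Lemma derlim_long_exact (A B D : functor k C) (f : nattrans A B)
    (g : nattrans B D) :
  short_exact f g -> exists
    (fs : forall n, {linear derlim n A -> derlim n B})
    (gs : forall n, {linear derlim n B -> derlim n D})
    (delta : forall n, {linear derlim n D -> derlim n.+1 A}),
  forall n, [/\ exact_at (fs n) (gs n), exact_at (gs n) (delta n)
              & exact_at (delta n) (fs n.+1)].
Proof. exact: derlim_of_long_exact. Qed.

Lemma linear_bij (U V : lmodType k) (t : {linear U -> V}) :
  (forall x, t x = 0 -> x = 0) -> (forall y, exists x, t x = y) -> bijective t.
Proof.
move=> ker0 /choice[t' t'K]; exists t' => // x.
by apply/eqP; rewrite -subr_eq0; apply/eqP/ker0; rewrite linearB t'K subrr.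
Qed.

(** A compatible family of cocycles in degree 0 has objectwise preimages under the augmentation;
    these are again compatible because the augmentation is mono. *)
Lemma lim_derlim0 (A : functor k C) (I : injective_resolution A) :
  exists t : {linear lim A -> derlim_of I 0}, bijective t.
Proof.
have d_aug (u : lim A) : lim_map (ir_d I 0) (lim_map (ir_aug I) u) = 0.
  by apply: lim_eq => c; apply/ir_exact0; exists (val u c).
have [||||t tE] := @linear_of_relation k (lim A) (derlim_of I 0)
    (fun u v => hclass (lim_map (ir_aug I) u) v).
- by move=> u u' v v'; rewrite linearD; apply: hclassD.
- by move=> a u v; rewrite linearZ_LR; apply: hclassZ.
- by move=> u; apply/hclass_ex/d_aug.
- move=> v; rewrite linear0 => /hclass_eq0 /=[_]; apply.
  by exists 0.
exists t; apply: linear_bij => [u /tE /hclass_eq0[/(_ erefl)[? u0] _]|v].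
  apply: lim_eq => c; apply: (@ir_aug_mono _ _ _ I c); rewrite linear0.
  exact: (congr1 (fun w : lim _ => val w c) (esym u0)).
have [x xv] := hclass_rep v.
have /dfun_choice[y yE] : forall c, exists y, ir_aug I c y = val x c.
  move=> c; apply/ir_exact0.
  exact: (congr1 (fun w : lim _ => val w c) (hclass_ker xv)).
have cy : compatible A y.
  move=> c d m; apply: (@ir_aug_mono _ _ _ I d).
  by rewrite nt_natural !yE lim_compat.
exists (insubmod (compatible A) cy); apply/tE.
by rewrite (_ : lim_map _ _ = x) //; apply: lim_eq => c; apply: yE.
Qed.

End ShortExact.

(** * Tensor products *)

Section TensorTheory.
Variables (k : comPzRingType) (R : pzRingType) (iota : k -> R).

Section Relations.
Variables (M : lmodType R^c) (N : lmodType R).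

Let span_rel u v : tens_rel iota (u - v) ->
  qpi (Defs.span (tens_rel iota (M := M) (N := N))) u =
  qpi (Defs.span (tens_rel iota (M := M) (N := N))) v.
Proof. by move=> uv; apply/qpi_eq => W; apply. Qed.

Lemma ptensDl m m' (n : N) :
  ptens iota (m + m' : M) n = ptens iota m n + ptens iota m' n.
Proof. rewrite -linearD; apply: span_rel; exact: tens_rel_addl. Qed.

Lemma ptensDr (m : M) (n n' : N) :
  ptens iota m (n + n') = ptens iota m n + ptens iota m n'.
Proof. rewrite -linearD; apply: span_rel; exact: tens_rel_addr. Qed.

Lemma ptens_mid (m : M) (r : R) (n : N) :
  ptens iota ((r : R^c) *: m) n = ptens iota m (r *: n).
Proof. apply: span_rel; exact: tens_rel_mid. Qed.

Lemma ptens_scal (a : k) (m : M) (n : N) :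
  ptens iota m (iota a *: n) = a *: ptens iota m n.
Proof. rewrite -linearZ_LR; apply: span_rel; exact: tens_rel_scal. Qed.

Lemma ptensBl m m' (n : N) :
  ptens iota (m - m' : M) n = ptens iota m n - ptens iota m' n.
Proof. by apply/eqP; rewrite eq_sym subr_eq -ptensDl subrK. Qed.

Lemma ptensBr (m : M) (n n' : N) :
  ptens iota m (n - n') = ptens iota m n - ptens iota m n'.
Proof. by apply/eqP; rewrite eq_sym subr_eq -ptensDr subrK. Qed.

Lemma ptens0l (n : N) : ptens iota (0 : M) n = 0.
Proof. by have := ptensBl 0 0 n; rewrite !subrr. Qed.

Lemma ptens0r (m : M) : ptens iota m (0 : N) = 0.
Proof. by have := ptensBr m 0 0; rewrite !subrr. Qed.

Section Lift.
Variables (V : lmodType k) (b : M -> N -> V).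
Hypothesis bDl : forall m m' n, b (m + m') n = b m n + b m' n.
Hypothesis bDr : forall m n n', b m (n + n') = b m n + b m n'.
Hypothesis b_mid : forall m (r : R) n, b ((r : R^c) *: m) n = b m (r *: n).
Hypothesis b_scal : forall (a : k) m n, b m (iota a *: n) = a *: b m n.

Let pair_ext : {linear freemod k (M * N)%type -> V} :=
  lin_ext (fun p => b p.1 p.2).

Let pair_ext_delta m n : pair_ext (delta k (m, n)) = b m n.
Proof. exact: lin_ext_delta. Qed.

Let pair_ext_span u : Defs.span (tens_rel iota (M := M) (N := N)) u -> pair_ext u = 0.
Proof.
move=> /(_ (ker pair_ext)); apply=> v v_rel; change (pair_ext v = 0).
case: v_rel => [m m' n|m n n'|m r n|a m n].
- by rewrite linearB linearD !pair_ext_delta bDl subrr.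
- by rewrite linearB linearD !pair_ext_delta bDr subrr.
- by rewrite linearB !pair_ext_delta b_mid subrr.
- by rewrite linearB linearZ_LR !pair_ext_delta b_scal subrr.
Qed.

Let lift_fun (t : tens iota M N) : V := pair_ext (repr t).

Let lift_qpi u : lift_fun (qpi (Defs.span (tens_rel iota (M := M) (N := N))) u) = pair_ext u.
Proof.
apply/eqP; rewrite -subr_eq0 -linearB; apply/eqP/pair_ext_span.
exact: repr_qpi.
Qed.

Let lift_D : {morph lift_fun : t u / t + u}.
Proof.
by move=> t u; rewrite -[t]qpi_repr -[u]qpi_repr -linearD !lift_qpi linearD.
Qed.

Let lift_Z a t : lift_fun (a *: t) = a *: lift_fun t.
Proof. by rewrite -[t]qpi_repr -linearZ_LR !lift_qpi linearZ_LR. Qed.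

Definition tens_lift : {linear tens iota M N -> V} := mk_linear lift_D lift_Z.

Lemma tens_lift_ptens m n : tens_lift (ptens iota m n) = b m n.
Proof. by rewrite [LHS]lift_qpi pair_ext_delta. Qed.

End Lift.

End Relations.

Lemma tens_mapl_ptens (M M' : lmodType R^c) (N : lmodType R)
    (f : {linear M -> M'}) m n :
  tens_mapl iota N f (ptens iota m n) = ptens iota (f m) n.
Proof. exact: tens_map_ptens. Qed.

Lemma tens_mapr_ptens (M : lmodType R^c) (N N' : lmodType R)
    (g : {linear N -> N'}) m n :
  tens_mapr iota M g (ptens iota m n) = ptens iota m (g n).
Proof. exact: tens_map_ptens. Qed.

Lemma tens_mapl_comp (M M' M'' : lmodType R^c) (N : lmodType R)
    (f : {linear M -> M'}) (f' : {linear M' -> M''}) (f'' : {linear M -> M''}) :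
  (forall x, f'' x = f' (f x)) ->
  forall t, tens_mapl iota N f'' t = tens_mapl iota N f' (tens_mapl iota N f t).
Proof. by move=> fE; apply: tens_map_comp. Qed.

Lemma tens_mapl_mapr (M M' : lmodType R^c) (N N' : lmodType R)
    (f : {linear M -> M'}) (g : {linear N -> N'}) t :
  tens_mapl iota N' f (tens_mapr iota M g t) =
  tens_mapr iota M' g (tens_mapl iota N f t).
Proof.
elim/tens_ind: t => [|t u IHt IHu|a t IH|m n].
- by rewrite !linear0.
- by rewrite !linearD IHt IHu.
- by rewrite !linearZ_LR IH.
- by rewrite tens_mapr_ptens !tens_mapl_ptens tens_mapr_ptens.
Qed.

Lemma tens_mapl_surj (M M' : lmodType R^c) (N : lmodType R)
    (f : {linear M -> M'}) : (forall y, exists x, f x = y) ->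
  forall t, exists s, tens_mapl iota N f s = t.
Proof.
move=> f_surj; elim/tens_ind => [|t u [t' <-] [u' <-]|a t [t' <-]|m n].
- by exists 0; rewrite linear0.
- by exists (t' + u'); rewrite linearD.
- by exists (a *: t'); rewrite linearZ_LR.
- by have [x <-] := f_surj m; exists (ptens iota x n); rewrite tens_mapl_ptens.
Qed.

Lemma tens_mapr_surj (M : lmodType R^c) (N N' : lmodType R)
    (g : {linear N -> N'}) : (forall y, exists x, g x = y) ->
  forall t, exists s, tens_mapr iota M g s = t.
Proof.
move=> g_surj; elim/tens_ind => [|t u [t' <-] [u' <-]|a t [t' <-]|m n].
- by exists 0; rewrite linear0.
- by exists (t' + u'); rewrite linearD.
- by exists (a *: t'); rewrite linearZ_LR.
- by have [x <-] := g_surj n; exists (ptens iota m x); rewrite tens_mapr_ptens.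
Qed.

(* Right exactness: g (x) N has a retraction modulo the image of f (x) N. *)
Lemma tens_mapl_exact (U V W : lmodType R^c) (N : lmodType R)
    (f : {linear U -> V}) (g : {linear V -> W}) :
    (forall w, exists v, g v = w) -> (forall v, g v = 0 -> exists u, f u = v) ->
  forall t, tens_mapl iota N g t = 0 -> exists s, tens_mapl iota N f s = t.
Proof.
move=> /choice[s sK] fg.
pose B := im (tens_mapl iota N f).
have sE v n : qpi B (ptens iota (s (g v)) n) = qpi B (ptens iota v n).
  have [|u fu] := fg (s (g v) - v); first by rewrite linearB sK subrr.
  by apply/qpi_eq; exists (ptens iota u n); rewrite tens_mapl_ptens fu ptensBl.
pose b w n := qpi B (ptens iota (s w) n).
have bDl w w' n : b (w + w') n = b w n + b w' n.
  by rewrite -[w]sK -[w']sK -linearD /b !sE ptensDl linearD.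
have bDr w n n' : b w (n + n') = b w n + b w n'.
  by rewrite /b ptensDr linearD.
have b_mid w (r : R) n : b ((r : R^c) *: w) n = b w (r *: n).
  by rewrite -[w]sK -linearZ_LR /b !sE ptens_mid.
have b_scal a w n : b w (iota a *: n) = a *: b w n.
  by rewrite /b ptens_scal linearZ_LR.
pose h := tens_lift bDl bDr b_mid b_scal.
have hE t : h (tens_mapl iota N g t) = qpi B t.
  elim/tens_ind: t => [|t u IHt IHu|a t IH|m n].
  - by rewrite !linear0.
  - by rewrite !linearD IHt IHu.
  - by rewrite !linearZ_LR IH.
  - by rewrite tens_mapl_ptens tens_lift_ptens /b sE.
move=> t gt0; have /esym := hE t; rewrite gt0 linear0 -(linear0 (qpi B)).
by move=> /qpi_eq; rewrite subr0.
Qed.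

Lemma tens_mapr_exact (M : lmodType R^c) (U V W : lmodType R)
    (f : {linear U -> V}) (g : {linear V -> W}) :
    (forall w, exists v, g v = w) -> (forall v, g v = 0 -> exists u, f u = v) ->
  forall t, tens_mapr iota M g t = 0 -> exists s, tens_mapr iota M f s = t.
Proof.
move=> /choice[s sK] fg.
pose B := im (tens_mapr iota M f).
have sE m v : qpi B (ptens iota m (s (g v))) = qpi B (ptens iota m v).
  have [|u fu] := fg (s (g v) - v); first by rewrite linearB sK subrr.
  by apply/qpi_eq; exists (ptens iota m u); rewrite tens_mapr_ptens fu ptensBr.
pose b m w := qpi B (ptens iota m (s w)).
have bDl m m' w : b (m + m') w = b m w + b m' w.
  by rewrite /b ptensDl linearD.
have bDr m w w' : b m (w + w') = b m w + b m w'.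
  by rewrite -[w]sK -[w']sK -linearD /b !sE ptensDr linearD.
have b_mid m (r : R) w : b ((r : R^c) *: m) w = b m (r *: w).
  by rewrite -[w]sK -linearZ_LR /b !sE ptens_mid.
have b_scal a m w : b m (iota a *: w) = a *: b m w.
  by rewrite -[w]sK -linearZ_LR /b !sE ptens_scal linearZ_LR.
pose h := tens_lift bDl bDr b_mid b_scal.
have hE t : h (tens_mapr iota M g t) = qpi B t.
  elim/tens_ind: t => [|t u IHt IHu|a t IH|m n].
  - by rewrite !linear0.
  - by rewrite !linearD IHt IHu.
  - by rewrite !linearZ_LR IH.
  - by rewrite tens_mapr_ptens tens_lift_ptens /b sE.
move=> t gt0; have /esym := hE t; rewrite gt0 linear0 -(linear0 (qpi B)).
by move=> /qpi_eq; rewrite subr0.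
Qed.

(* K is the pullback of f and g, and K -> U (+) W -> L -> 0 is exact. *)
Section Pullback.
Variables (K U W L : lmodType R^c) (N : lmodType R).
Variables (f : {linear U -> L}) (g : {linear W -> L}).
Variables (p : {linear K -> U}) (q : {linear K -> W}).
Hypothesis fg_surj : forall y, exists u w, y = f u - g w.
Hypothesis fg_pull : forall u w, f u = g w -> exists x, p x = u /\ q x = w.

Let E : lmodType R^c := GRing.Lmodule.clone R^c (U * W)%type _.

Let to_fun (x : K) : E := (p x, q x).
Let toD : {morph to_fun : x y / x + y}.
Proof. by move=> x y; rewrite /to_fun !linearD. Qed.
Let toZ a x : to_fun (a *: x) = a *: to_fun x.
Proof. by rewrite /to_fun !linearZ_LR. Qed.
Let to : {linear K -> E} := mk_linear toD toZ.

Let from_fun (e : E) : L := f e.1 - g e.2.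
Let fromD : {morph from_fun : x y / x + y}.
Proof. by move=> x y; rewrite /from_fun (linearD f) (linearD g) opprD addrACA. Qed.
Let fromZ a x : from_fun (a *: x) = a *: from_fun x.
Proof. by rewrite /from_fun (linearZ_LR f) (linearZ_LR g) scalerBr. Qed.
Let from : {linear E -> L} := mk_linear fromD fromZ.

Let pr1 : {linear E -> U} :=
  @mk_linear _ E U fst (fun _ _ => erefl) (fun _ _ => erefl).
Let pr2 : {linear E -> W} :=
  @mk_linear _ E W snd (fun _ _ => erefl) (fun _ _ => erefl).

Let from_surj y : exists e, from e = y.
Proof. by have [u [w ->]] := fg_surj y; exists (u, w). Qed.

Let to_from e : from e = 0 -> exists x, to x = e.
Proof.
case: e => u w /subr0_eq /fg_pull[x [pu qw]]; exists x.
by congr pair.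
Qed.

Let tens_from (e : tens iota E N) : tens_mapl iota N from e =
  tens_mapl iota N f (tens_mapl iota N pr1 e) -
  tens_mapl iota N g (tens_mapl iota N pr2 e).
Proof.
elim/tens_ind: e => [|t u IHt IHu|a t IH|x y].
- by rewrite !linear0 addr0.
- rewrite (linearD (tens_mapl iota N pr1)) (linearD (tens_mapl iota N pr2)).
  rewrite (linearD (tens_mapl iota N f)) (linearD (tens_mapl iota N g)).
  by rewrite opprD addrACA -IHt -IHu linearD.
- rewrite (linearZ_LR (tens_mapl iota N pr1)) (linearZ_LR (tens_mapl iota N pr2)).
  rewrite (linearZ_LR (tens_mapl iota N f)) (linearZ_LR (tens_mapl iota N g)).
  by rewrite -scalerBr -IH linearZ_LR.
- by rewrite !tens_mapl_ptens ptensBl.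
Qed.

(** The half of the distributivity of the tensor product over U (+) W that lifts a pair of tensors
    to a single one. *)
Let tens_E_pair u w : exists e : tens iota E N,
  tens_mapl iota N pr1 e = u /\ tens_mapl iota N pr2 e = w.
Proof.
have [e [eu e0]] : exists e : tens iota E N,
    tens_mapl iota N pr1 e = u /\ tens_mapl iota N pr2 e = 0.
  elim/tens_ind: u => [|t u [e [<- e0]] [e' [<- e0']]|a t [e [<- e0]]|m n].
  - by exists 0; rewrite !linear0.
  - by exists (e + e'); rewrite !linearD e0 e0' addr0.
  - by exists (a *: e); rewrite !linearZ_LR e0 scaler0.
  - by exists (ptens iota ((m, 0) : E) n); rewrite !tens_mapl_ptens ptens0l.
have [e' [e'0 ew]] : exists e : tens iota E N,
    tens_mapl iota N pr1 e = 0 /\ tens_mapl iota N pr2 e = w.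
  elim/tens_ind: w => [|t v [d [d0 <-]] [d' [d0' <-]]|a t [d [d0 <-]]|m n].
  - by exists 0; rewrite !linear0.
  - by exists (d + d'); rewrite !linearD d0 d0' addr0.
  - by exists (a *: d); rewrite !linearZ_LR d0 scaler0.
  - by exists (ptens iota ((0, m) : E) n); rewrite !tens_mapl_ptens ptens0l.
by exists (e + e'); rewrite !linearD eu e0 e'0 ew addr0 add0r.
Qed.

(** A lift of the pair to [E (x) N] is killed by [from (x) N], so right exactness brings it back to
    [K (x) N]. It yields existence of [t], and does not assert uniqueness. *)
Lemma tens_pullback u w : tens_mapl iota N f u = tens_mapl iota N g w ->
  exists t, tens_mapl iota N p t = u /\ tens_mapl iota N q t = w.
Proof.
have [e [<- <-]] := tens_E_pair u w => /eqP.
rewrite -subr_eq0 -tens_from => /eqP e0.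
have [t <-] := tens_mapl_exact from_surj to_from e0.
by exists t; split; apply: tens_mapl_comp.
Qed.

Lemma tens_pullback_surj y :
  exists u w, y = tens_mapl iota N f u - tens_mapl iota N g w.
Proof.
have [e <-] := tens_mapl_surj from_surj y.
by exists (tens_mapl iota N pr1 e), (tens_mapl iota N pr2 e); rewrite tens_from.
Qed.

End Pullback.

End TensorTheory.

Arguments tens_lift : simpl never.

Section SubmodInclusion.
Variables (R : pzRingType) (V : lmodType R).

Definition submod_val_linear (S : submod V) : {linear submodule S -> V} :=
  @mk_linear R (submodule S) V val (fun _ _ => erefl) (fun _ _ => erefl).

Definition submod_incl (S S' : submod V) (SS' : forall x, S x -> S' x) :
    {linear submodule S -> submodule S'} :=
  @submod_map R R idfun V V idfun S S' SS'.

End SubmodInclusion.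

(** * Tor_1 of quotients of ideals *)

(* A k-algebra A, presented by its structure map iota and by an identification
   j of A with a k-module V (the identity, when A is a group algebra). *)
Section IdealTensor.
Variables (k : comPzRingType) (A : pzRingType) (iota : k -> A).
Variables (V : lmodType k) (j : A -> V).
Hypothesis iotaC : forall a x, iota a * x = x * iota a.
Hypothesis jD : {morph j : x y / x + y}.
Hypothesis jZ : forall a x, j (iota a * x) = a *: j x.
Hypothesis j_inj : injective j.
Local Notation rmod I := (submodule (right_submod (A := A) I)).
Local Notation lmod J := (submodule (left_submod (A := A) J)).

Let j0 : j 0 = 0.
Proof. by apply: (addIr (j 0)); rewrite -jD !add0r. Qed.

Let jB u v : j (u - v) = j u - j v.
Proof. by apply/eqP; rewrite eq_sym subr_eq -jD subrK. Qed.

Section Multiplication.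
Variables (M : lmodType A^c) (f : {linear M -> (A^c)^o}) (J : ideal A).

Let mul_fun (m : M) (y : lmod J) : V := j ((f m : A) * (val y : A)).

Let mulDl m m' y : mul_fun (m + m') y = mul_fun m y + mul_fun m' y.
Proof. by rewrite /mul_fun linearD -jD -mulrDl. Qed.

Let mulDr m y y' : mul_fun m (y + y') = mul_fun m y + mul_fun m y'.
Proof. by rewrite /mul_fun -jD -mulrDr. Qed.

Let mul_mid m (r : A) y : mul_fun ((r : A^c) *: m) y = mul_fun m (r *: y).
Proof. by rewrite /mul_fun linearZ_LR; congr j; apply/esym/mulrA. Qed.

Let mul_scal a m y : mul_fun m (iota a *: y) = a *: mul_fun m y.
Proof.
rewrite /mul_fun -jZ; congr j.
rewrite [LHS](_ : _ = (f m : A) * (iota a * (val y : A))) //.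
by rewrite mulrA -iotaC mulrA.
Qed.

Definition tens_mul : {linear tens iota M (lmod J) -> V} :=
  tens_lift mulDl mulDr mul_mid mul_scal.

Lemma tens_mul_ptens m y :
  tens_mul (ptens iota m y) = j ((f m : A) * (val y : A)).
Proof. exact: tens_lift_ptens. Qed.

End Multiplication.

Definition right_val (I : ideal A) : {linear rmod I -> (A^c)^o} :=
  submod_val_linear (right_submod I).

Definition ideal_tens_mul I J : {linear tens iota (rmod I) (lmod J) -> V} :=
  tens_mul (right_val I) J.

Lemma ideal_tens_mul_in (I J : ideal A) t :
  exists2 z, ideal_mul I J z & j z = ideal_tens_mul I J t.
Proof.
elim/tens_ind: t => [|t u [x Ix xE] [y Iy yE]|a t [x Ix xE]|m n].
- by exists 0; [apply: ideal0 | rewrite linear0 j0].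
- by exists (x + y); [apply: idealD | rewrite linearD jD xE yE].
- by exists (iota a * x); [apply: idealMl | rewrite linearZ_LR jZ xE].
- exists ((val m : A) * (val n : A)); last by rewrite [RHS]tens_mul_ptens.
  exists [:: (val m : A, val n : A)]; last by rewrite big_seq1.
  move=> p; rewrite inE => /eqP ->; split; first exact: (submod_valP m).
  exact: (submod_valP n).
Qed.

Lemma ideal_tens_mulP (I J : ideal A) (z : A) :
  ideal_mul I J z <-> exists t, ideal_tens_mul I J t = j z.
Proof.
split=> [[s sIJ ->]|[t tz]]; last first.
  by have [z' Iz' z'E] := ideal_tens_mul_in t; rewrite -(j_inj (etrans z'E tz)).
elim: s sIJ => [|[x y] s IH] sIJ.
  by exists 0; rewrite linear0 big_nil j0.
have [|t tE] := IH; first by move=> p ps; apply: sIJ; rewrite inE ps orbT.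
have [Ix Jy] : I x /\ J y := sIJ (x, y) (mem_head _ _).
exists (ptens iota (insubmod (right_submod I) Ix) (insubmod (left_submod J) Jy) + t).
by rewrite linearD tE big_cons jD [ideal_tens_mul _ _ _]tens_mul_ptens.
Qed.

(** The multiplication factors as I (x) J -> A (x) J -> A. The first map is injective by flatness of
    [J]; the second because every tensor of A (x) J has the form 1 (x) y. *)
Lemma ideal_tens_mul_inj (I J : ideal A) :
  left_flat iota (lmod J) -> injective (ideal_tens_mul I J).
Proof.
move=> flatJ; pose m := tens_mul (idfun : {linear (A^c)^o -> (A^c)^o}) J.
have m_inj : injective m.
  have can y : m (ptens iota (1 : (A^c)^o) y) = j (val y).
    by rewrite [LHS]tens_mul_ptens; congr j; apply: mul1r.
  have surj (t : tens iota (GRing.Lmodule.clone A^c (A^c)^o _) (lmod J)) :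
      exists y, t = ptens iota (1 : (A^c)^o) y.
    elim/tens_ind: t => [|t u [y ->] [z ->]|a t [y ->]|x y].
    - by exists 0; rewrite ptens0r.
    - by exists (y + z); rewrite ptensDr.
    - by exists (iota a *: y); rewrite ptens_scal.
    - exists ((x : A) *: y); rewrite -ptens_mid; congr (ptens _ _ _).
      exact: (esym (mulr1 (x : A^c))).
  move=> t u; have [y ->] := surj t; have [z ->] := surj u.
  by rewrite !can => /j_inj/val_inj ->.
have fac t : ideal_tens_mul I J t = m (tens_mapl iota (lmod J) (right_val I) t).
  elim/tens_ind: t => [|t u IHt IHu|a t IH|x y].
  - by rewrite !linear0.
  - by rewrite !linearD IHt IHu.
  - by rewrite !linearZ_LR IH.
  - by rewrite tens_mapl_ptens [RHS]tens_mul_ptens [LHS]tens_mul_ptens.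
move=> t u; rewrite !fac => /m_inj; apply: flatJ => x y.
exact: val_inj.
Qed.

Lemma ideal_tens_mul_incr (I J J' : ideal A) (J'J : forall x, J' x -> J x) t :
  ideal_tens_mul I J (tens_mapr iota (rmod I)
    (@submod_incl _ _ (left_submod J') (left_submod J) J'J) t) =
  ideal_tens_mul I J' t.
Proof.
elim/tens_ind: t => [|t u IHt IHu|a t IH|x y].
- by rewrite !linear0.
- by rewrite !linearD IHt IHu.
- by rewrite !linearZ_LR IH.
- by rewrite tens_mapr_ptens [LHS]tens_mul_ptens [RHS]tens_mul_ptens.
Qed.

Lemma ideal_tens_mul_incl (I I' J : ideal A) (I'I : forall x, I' x -> I x) t :
  ideal_tens_mul I J (tens_mapl iota (lmod J)
    (@submod_incl _ _ (right_submod I') (right_submod I) I'I) t) =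
  ideal_tens_mul I' J t.
Proof.
elim/tens_ind: t => [|t u IHt IHu|a t IH|x y].
- by rewrite !linear0.
- by rewrite !linearD IHt IHu.
- by rewrite !linearZ_LR IH.
- by rewrite tens_mapl_ptens [LHS]tens_mul_ptens [RHS]tens_mul_ptens.
Qed.

Section QuotientMultiplication.
Variables (I' J J' : ideal A).

Definition lquot : {linear lmod J -> left_quotient J J'} :=
  qpi (comap (left_submod J) (left_submod J')).

(** This is A/I'J' viewed in [V]. Dividing all of [V], rather than I'J, lets a product be recognised
    as coming from I'J or from IJ' in the same module. *)
Definition mul_quot : lmodType k := quotient (im (ideal_tens_mul I' J')).

Definition mul_pi : {linear V -> mul_quot} := qpi (im (ideal_tens_mul I' J')).

Lemma mul_pi_eq0 z : mul_pi (j z) = 0 <-> ideal_mul I' J' z.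
Proof.
rewrite ideal_tens_mulP -(linear0 mul_pi).
by split=> [/qpi_eq|?]; [|apply/qpi_eq]; rewrite subr0.
Qed.

Definition quot_mul_fun (x : rmod I') (n : left_quotient J J') : mul_quot :=
  mul_pi (j ((val x : A) * (val (repr n : lmod J) : A))).

Fact quot_mul_lquot x y :
  quot_mul_fun x (lquot y) = mul_pi (j ((val x : A) * (val y : A))).
Proof.
apply/eqP; rewrite -subr_eq0 -linearB; apply/eqP.
rewrite -jB -mulrBr; apply/mul_pi_eq0.
have J'y : J' (val (repr (lquot y) - y : lmod J)) := repr_qpi (comap _ _) y.
exists [:: (val x : A, val (repr (lquot y) - y : lmod J) : A)].
  by move=> p; rewrite inE => /eqP ->; split=> //; apply: (submod_valP x).
by rewrite big_seq1.
Qed.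

Fact quot_mulDl x x' n :
  quot_mul_fun (x + x') n = quot_mul_fun x n + quot_mul_fun x' n.
Proof. by rewrite /quot_mul_fun -linearD -jD -mulrDl. Qed.

Fact quot_mulDr x n n' :
  quot_mul_fun x (n + n') = quot_mul_fun x n + quot_mul_fun x n'.
Proof.
rewrite -[n]qpi_repr -[n']qpi_repr -[X in quot_mul_fun x X]linearD.
by rewrite !quot_mul_lquot -linearD -jD -mulrDr.
Qed.

Fact quot_mul_mid x (r : A) n :
  quot_mul_fun ((r : A^c) *: x) n = quot_mul_fun x (r *: n).
Proof.
rewrite -[n]qpi_repr -[X in quot_mul_fun x X]linearZ_LR !quot_mul_lquot.
congr (mul_pi (j _)).
exact: (esym (mulrA (val x : A) r (val (repr n : lmod J) : A))).
Qed.

Fact quot_mul_scal a x n : quot_mul_fun x (iota a *: n) = a *: quot_mul_fun x n.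
Proof.
rewrite -[n]qpi_repr -[X in quot_mul_fun x X]linearZ_LR !quot_mul_lquot.
rewrite -linearZ_LR -jZ; congr (mul_pi (j _)).
rewrite [LHS](_ : _ = (val x : A) * (iota a * (val (repr n : lmod J) : A))) //.
by rewrite mulrA -iotaC mulrA.
Qed.

Definition quot_mul : {linear tens iota (rmod I') (left_quotient J J') -> mul_quot} :=
  tens_lift quot_mulDl quot_mulDr quot_mul_mid quot_mul_scal.

Lemma quot_mul_ptens x y : quot_mul (ptens iota x (lquot y)) =
  mul_pi (j ((val x : A) * (val y : A))).
Proof. by rewrite [LHS]tens_lift_ptens quot_mul_lquot. Qed.

Lemma quot_mul_mapr t :
  quot_mul (tens_mapr iota (rmod I') lquot t) = mul_pi (ideal_tens_mul I' J t).
Proof.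
elim/tens_ind: t => [|t u IHt IHu|a t IH|x y].
- by rewrite !linear0.
- by rewrite !linearD IHt IHu.
- by rewrite !linearZ_LR IH.
- rewrite tens_mapr_ptens quot_mul_ptens; congr (mul_pi _).
  exact/esym/tens_mul_ptens.
Qed.

End QuotientMultiplication.

(* P covers I / I' with kernel K, and f lifts the covering to I; hence K is the
   pullback of f and of the inclusion of I'. *)
Section TorKernel.
Variables I I' J J' : ideal A.
Hypothesis I'I : forall x, I' x -> I x.
Hypothesis J'J : forall x, J' x -> J x.
Local Notation i := (@submod_incl _ _ (right_submod I') (right_submod I) I'I).
Local Notation l := (@submod_incl _ _ (left_submod J') (left_submod J) J'J).
Local Notation q := (lquot J J').
Variables (P K : lmodType A^c) (f : {linear P -> rmod I}).
Variables (p : {linear K -> P}) (g : {linear K -> rmod I'}).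
Hypothesis p_inj : injective p.
Hypothesis fp : forall x, f (p x) = i (g x).
Hypothesis f_surj : forall y, exists u x, y = f u - i x.
Hypothesis f_pull : forall u x, f u = i x -> exists t, p t = u /\ g t = x.
Hypothesis I_flat : right_flat iota (rmod I).
Hypothesis J_flat : left_flat iota (lmod J).

Let q_surj n : exists y, q y = n.
Proof. by exists (repr n); apply: qpi_repr. Qed.

Let q_exact y : q y = 0 -> exists z, l z = y.
Proof.
rewrite -(linear0 q) => /qpi_eq; rewrite subr0 => J'y.
by exists (insubmod (left_submod J') J'y); apply: val_inj.
Qed.

Let ql0 (X : lmodType A^c) t : tens_mapr iota X q (tens_mapr iota X l t) = 0.
Proof.
elim/tens_ind: t => [|t u IHt IHu|a t IH|x y].
- by rewrite !linear0.
- by rewrite !linearD IHt IHu addr0.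
- by rewrite !linearZ_LR IH scaler0.
rewrite !tens_mapr_ptens (_ : q (l y) = 0) ?ptens0r //.
rewrite -(linear0 q); apply/qpi_eq; rewrite subr0.
exact: (submod_valP y).
Qed.

Let tens_fp (X : lmodType A) t : tens_mapl iota X f (tens_mapl iota X p t) =
  tens_mapl iota X i (tens_mapl iota X g t).
Proof.
elim/tens_ind: t => [|t u IHt IHu|a t IH|x y].
- by rewrite !linear0.
- by rewrite !linearD IHt IHu.
- by rewrite !linearZ_LR IH.
- by rewrite !tens_mapl_ptens fp.
Qed.

Local Notation N := (left_quotient J J').
Local Notation mul := (quot_mul I' J J').

(** Lift [t] to [t0] in K (x) J. Its image in P (x) J dies in P (x) J/J', hence comes from some [u]
    in P (x) J'. The product of [g t0] is visibly in I'J; it agrees with that of [f u], which is in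
    IJ'. *)
Lemma tor_kernel_mul t : tens_mapl iota N p t = 0 ->
  exists z, [/\ ideal_mul I' J z, ideal_mul I J' z
              & mul (tens_mapl iota N g t) = mul_pi I' J' (j z)].
Proof.
have [t0 <-] := tens_mapr_surj q_surj t.
rewrite tens_mapl_mapr => /(tens_mapr_exact q_surj q_exact)[u uE].
have [z I'Jz zE] := ideal_tens_mul_in (tens_mapl iota (lmod J) g t0).
exists z; split=> //; last by rewrite tens_mapl_mapr quot_mul_mapr zE.
apply/ideal_tens_mulP; exists (tens_mapl iota (lmod J') f u).
rewrite zE -(ideal_tens_mul_incr J'J) -(ideal_tens_mul_incl I'I).
by rewrite -tens_fp -uE tens_mapl_mapr.
Qed.

(** With [t0] and [u] as in [tor_kernel_mul], the product of [g t0] is that of some [x] in I' (x)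
    J'. Flatness of [J] gives [g t0 = l x] in I' (x) J, then flatness of [I] gives [f u = i x] in I
    (x) J'. The pullback property yields [t1] in K (x) J' over [u], and flatness of [J] against [p]
    identifies [l t1] with [t0], whose class modulo J' is therefore zero. *)
Lemma tor_kernel_inj t : tens_mapl iota N p t = 0 ->
  mul (tens_mapl iota N g t) = 0 -> t = 0.
Proof.
have [t0 <-] := tens_mapr_surj q_surj t.
rewrite tens_mapl_mapr => /(tens_mapr_exact q_surj q_exact)[u uE].
rewrite tens_mapl_mapr quot_mul_mapr => mul0.
have [x xE] : im (ideal_tens_mul I' J')
    (ideal_tens_mul I' J (tens_mapl iota (lmod J) g t0)).
  by rewrite -[X in im _ X]subr0; apply/qpi_eq; rewrite [LHS]mul0 linear0.
have {}xE : tens_mapr iota (rmod I') l x = tens_mapl iota (lmod J) g t0.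
  by apply: (ideal_tens_mul_inj J_flat); rewrite ideal_tens_mul_incr.
have ux : tens_mapl iota (lmod J') f u = tens_mapl iota (lmod J') i x.
  apply: (I_flat (g := l)); first by move=> y z [yz]; apply: val_inj.
  by rewrite -!tens_mapl_mapr uE xE tens_fp.
have [t1 [t1u _]] := tens_pullback f_surj f_pull ux.
have <- : tens_mapr iota K l t1 = t0; last exact: ql0.
apply: (J_flat p_inj); rewrite tens_mapl_mapr.
by rewrite [X in tens_mapr _ _ _ X](t1u) uE.
Qed.

(** Write [z] as the product of [x] in I' (x) J and of [y = f u - i v] in I (x) J'. Then [f (l u)]
    and [i (l v + x)] have the same product, so they agree in I (x) J and come from one [t] in K (x)
    J. Modulo J' the terms in [l] vanish, and the product of [v] lies in I'J'. *)
Lemma tor_kernel_surj z : ideal_mul I' J z -> ideal_mul I J' z ->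
  exists t, tens_mapl iota N p t = 0 /\
            mul (tens_mapl iota N g t) = mul_pi I' J' (j z).
Proof.
move=> /ideal_tens_mulP[x xz] /ideal_tens_mulP[y yz].
have [u [v yE]] := tens_pullback_surj f_surj y.
have [|t [tu tx]] := @tens_pullback _ _ _ _ _ _ _ (lmod J) _ _ _ _ f_surj f_pull
    (tens_mapr iota P l u) (tens_mapr iota (rmod I') l v + x).
  apply: (ideal_tens_mul_inj J_flat).
  rewrite tens_mapl_mapr (ideal_tens_mul_incr J'J) (ideal_tens_mul_incl I'I).
  rewrite linearD (ideal_tens_mul_incr J'J) xz -yz yE.
  rewrite (linearB (ideal_tens_mul I J')) (ideal_tens_mul_incl I'I).
  by rewrite addrC subrK.
exists (tens_mapr iota K q t); rewrite !tens_mapl_mapr tu ql0 quot_mul_mapr tx.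
split=> //; rewrite linearD xz ideal_tens_mul_incr linearD.
rewrite (_ : mul_pi I' J' _ = 0) ?add0r //.
by rewrite -(linear0 (mul_pi I' J')); apply/qpi_eq; rewrite subr0; exists v.
Qed.

End TorKernel.

End IdealTensor.

Lemma subquot_map_qpi (R S : pzRingType) (phi : R -> S) (U : lmodType R)
    (V : lmodType S) (f : {linear U -> V | phi \; *:%R}) (Z B : submod U)
    (Z' B' : submod V) (fZ : forall x, Z x -> Z' (f x))
    (fB : forall x, B x -> B' (f x)) (x : submodule Z) :
  subquot_map fZ fB (qpi (comap Z B) x) = qpi (comap Z' B') (submod_map fZ x).
Proof. exact: (@quot_map_qpi _ _ phi _ _ (submod_map fZ) (comap Z B) (comap Z' B')
  (fun y => fB (val y)) x). Qed.

(** * The free resolution behind [Tor1] and its multiplication map *)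

Section TorPresentation.
Variables (k : comPzRingType) (A : pzRingType) (iota : k -> A).
Variables (V : lmodType k) (j : A -> V).
Hypothesis iotaC : forall a x, iota a * x = x * iota a.
Hypothesis jD : {morph j : x y / x + y}.
Hypothesis jZ : forall a x, j (iota a * x) = a *: j x.
Hypothesis j_inj : injective j.
Local Notation rmod I := (submodule (right_submod (A := A) I)).
Local Notation lmod J := (submodule (left_submod (A := A) J)).
Variables I I' J J' : ideal A.
Hypothesis I'I : forall x, I' x -> I x.
Hypothesis J'J : forall x, J' x -> J x.
Local Notation M := (right_quotient I I').
Local Notation N := (left_quotient J J').
Local Notation F0 := (freemod A^c M).
Local Notation F1 := (Defs.cover (tor_aug M)).
Local Notation K0 := (submodule (ker (tor_aug M))).
Local Notation i := (@submod_incl _ _ (right_submod I') (right_submod I) I'I).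

(** Basis elements go to chosen representatives in [I]; the resulting failure of naturality is
    measured by [lift_diff]. *)
Definition aug_lift : {linear F0 -> rmod I} :=
  lin_ext (fun m : M => repr m : rmod I).

Lemma qpi_aug_lift u :
  qpi (comap (right_submod I) (right_submod I')) (aug_lift u) = tor_aug M u.
Proof.
apply: (@free_ext_unique _ _ idfun _ _ (qpi _ \o aug_lift) (tor_aug M)) => m.
rewrite [RHS]lin_ext_delta -[RHS]qpi_repr; congr qpi.
exact: lin_ext_delta.
Qed.

Lemma aug_lift_ker u : tor_aug M u = 0 <-> I' (val (aug_lift u)).
Proof.
rewrite -qpi_aug_lift -(linear0 (qpi _)).
by split=> [/qpi_eq|H]; [rewrite subr0 | apply/qpi_eq; rewrite subr0].
Qed.

Definition ker_lift : {linear K0 -> rmod I'} :=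
  @submod_map A^c A^c idfun _ _ (right_val I \o aug_lift) (ker (tor_aug M))
    (right_submod I') (fun u => (aug_lift_ker u).1).

Definition ker_incl : {linear K0 -> F0} := submod_val_linear (ker (tor_aug M)).

Definition cover_ker : {linear F1 -> K0} := lin_ext (fun x => x).

Lemma cover_kerE u : ker_incl (cover_ker u) = tor_d1 M u.
Proof.
apply: (@free_ext_unique _ _ idfun _ _ (ker_incl \o cover_ker) (tor_d1 M)) => x.
rewrite [RHS]cover_map_delta; congr (ker_incl _).
exact: lin_ext_delta.
Qed.

Lemma ker_incl_inj : injective ker_incl.
Proof. exact: val_inj. Qed.

Let aug_lift_surj y : exists u x, y = aug_lift u - i x.
Proof.
pose u : F0 := delta A^c (qpi (comap (right_submod I) (right_submod I')) y).
have I'u : I' (val (aug_lift u - y)).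
  have /qpi_eq : qpi (comap (right_submod I) (right_submod I')) (aug_lift u) =
    qpi (comap (right_submod I) (right_submod I')) y.
    by rewrite qpi_aug_lift [LHS]lin_ext_delta.
  by [].
exists u, (insubmod (right_submod I') I'u); apply/eqP.
rewrite eq_sym subr_eq addrC -subr_eq; apply/eqP.
exact: val_inj.
Qed.

Let aug_lift_pull u x : aug_lift u = i x ->
  exists t, ker_incl t = u /\ ker_lift t = x.
Proof.
move=> ux; have u_ker : ker (tor_aug M) u.
  by apply/aug_lift_ker; rewrite ux; apply: (submod_valP x).
exists (insubmod (ker (tor_aug M)) u_ker); split=> //; apply: val_inj.
exact: (congr1 val ux).
Qed.

Let aug_lift_incl t : aug_lift (ker_incl t) = i (ker_lift t).
Proof. exact: val_inj. Qed.

Hypothesis I_flat : right_flat iota (rmod I).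
Hypothesis J_flat : left_flat iota (lmod J).

(** [F1] covers [K0] with kernel the image of [tor_d2], so cycles of F1 (x) N modulo boundaries are
    the kernel of K0 (x) N -> F0 (x) N, to which the lemmas on [tor_kernel] apply. *)
Definition tor_mul : {linear tens iota F1 N -> mul_quot iotaC jD jZ I' J'} :=
  quot_mul iotaC jD jZ j_inj I' J J' \o
    (tens_mapl iota N ker_lift \o tens_mapl iota N cover_ker).

Lemma tor_mulE t : tor_mul t = quot_mul iotaC jD jZ j_inj I' J J'
  (tens_mapl iota N ker_lift (tens_mapl iota N cover_ker t)).
Proof. by []. Qed.

Let tens_d1 t : tens_mapl iota N (tor_d1 M) t =
  tens_mapl iota N ker_incl (tens_mapl iota N cover_ker t).
Proof. by apply: tens_mapl_comp => x; rewrite cover_kerE. Qed.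

Let cover_ker_surj x : exists u, cover_ker u = x.
Proof. by exists (delta A^c x); apply: lin_ext_delta. Qed.

Let cover_ker_exact u : cover_ker u = 0 <-> exists v, tor_d2 M v = u.
Proof.
have ker_d1 : cover_ker u = 0 <-> tor_d1 M u = 0.
  rewrite -cover_kerE; split=> [->|]; first exact: linear0.
  by move=> u0; apply: ker_incl_inj; rewrite u0 linear0.
rewrite ker_d1; split=> [du|[v <-]].
  by exists (delta A^c (insubmod (ker (tor_d1 M)) du)); apply: cover_map_delta.
apply: (@free_ext_unique _ _ idfun _ _ (tor_d1 M \o tor_d2 M) \0) => x.
rewrite [LHS](_ : _ = tor_d1 M (tor_d2 M (delta A^c x))) // cover_map_delta.
exact: (submod_valP x).
Qed.

Lemma tor_mul_in t : tens_mapl iota N (tor_d1 M) t = 0 ->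
  exists z, [/\ ideal_mul I' J z, ideal_mul I J' z
              & tor_mul t = mul_pi iotaC jD jZ I' J' (j z)].
Proof.
rewrite tens_d1 tor_mulE => /(tor_kernel_mul iotaC jD jZ j_inj J'J aug_lift_incl).
exact.
Qed.

Lemma tor_mul_surj z : ideal_mul I' J z -> ideal_mul I J' z ->
  exists t, tens_mapl iota N (tor_d1 M) t = 0 /\
            tor_mul t = mul_pi iotaC jD jZ I' J' (j z).
Proof.
move=> zI'J zIJ'.
have [t [t0 tz]] := tor_kernel_surj iotaC jD jZ j_inj J'J
  aug_lift_surj aug_lift_pull J_flat zI'J zIJ'.
have [s st] := tens_mapl_surj cover_ker_surj t.
by exists s; rewrite tens_d1 tor_mulE st.
Qed.

(** Injectivity on the kernel makes the image of [t] in K0 (x) N vanish; right exactness for F2 ->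
    F1 -> K0 -> 0 then makes [t] a boundary. *)
Lemma tor_mul_inj t : tens_mapl iota N (tor_d1 M) t = 0 -> tor_mul t = 0 ->
  exists s, tens_mapl iota N (tor_d2 M) s = t.
Proof.
rewrite tens_d1 tor_mulE => t0 /(tor_kernel_inj J'J ker_incl_inj aug_lift_incl
  aug_lift_surj aug_lift_pull I_flat J_flat t0).
apply: tens_mapl_exact; first exact: cover_ker_surj.
by move=> u /cover_ker_exact.
Qed.

Lemma tor_mul_d2 s : tor_mul (tens_mapl iota N (tor_d2 M) s) = 0.
Proof.
rewrite tor_mulE (_ : tens_mapl iota N cover_ker _ = 0) ?linear0 //.
elim/tens_ind: s => [|t u IHt IHu|a t IH|x y].
- by rewrite !linear0.
- by rewrite !linearD IHt IHu addr0.
- by rewrite !linearZ_LR IH scaler0.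
rewrite !tens_mapl_ptens (_ : cover_ker _ = 0) ?ptens0l //.
by apply/cover_ker_exact; exists x.
Qed.

Lemma tor_mul_ptens u (y : lmod J) : tor_mul (ptens iota u (lquot J J' y)) =
  mul_pi iotaC jD jZ I' J' (j ((val (aug_lift (tor_d1 M u)) : A) * (val y : A))).
Proof.
rewrite tor_mulE (tens_mapl_ptens _ cover_ker) (tens_mapl_ptens _ ker_lift).
by rewrite quot_mul_ptens -cover_kerE.
Qed.

End TorPresentation.

(** * Naturality of the multiplication map in the ring and the ideals *)

Section TorNaturality.
Variables (k : comPzRingType) (A B : pzRingType) (iA : k -> A) (iB : k -> B).
Variables (V W : lmodType k) (jA : A -> V) (jB : B -> W).
Hypothesis iAC : forall a x, iA a * x = x * iA a.
Hypothesis jAD : {morph jA : x y / x + y}.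
Hypothesis jAZ : forall a x, jA (iA a * x) = a *: jA x.
Hypothesis jA_inj : injective jA.
Hypothesis iBC : forall a x, iB a * x = x * iB a.
Hypothesis jBD : {morph jB : x y / x + y}.
Hypothesis jBZ : forall a x, jB (iB a * x) = a *: jB x.
Hypothesis jB_inj : injective jB.
Variables (phi : {rmorphism A -> B}) (psi : {linear V -> W}).
Hypothesis phi_iota : forall a, phi (iA a) = iB a.
Hypothesis psi_j : forall a, psi (jA a) = jB (phi a).
Variables (I I' J J' : ideal A) (L L' H H' : ideal B).
Hypothesis phiI : forall x, I x -> L (phi x).
Hypothesis phiI' : forall x, I' x -> L' (phi x).
Hypothesis phiJ : forall x, J x -> H (phi x).
Hypothesis phiJ' : forall x, J' x -> H' (phi x).

Let f := right_quotient_map phiI phiI'.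
Let g := left_quotient_map phiJ phiJ'.

Local Notation M := (right_quotient I I').
Local Notation M' := (right_quotient L L').
Local Notation rval x := (val x : B).

Lemma ideal_mul_map z : ideal_mul I' J' z -> ideal_mul L' H' (phi z).
Proof.
move=> [s sIJ ->]; exists [seq (phi p.1, phi p.2) | p <- s].
  by move=> _ /mapP[p /sIJ[Ip Jp] ->]; split; [apply: phiI' | apply: phiJ'].
by rewrite big_map rmorph_sum; apply: eq_bigr => p _; rewrite rmorphM.
Qed.

Fact mul_im_map x : im (ideal_tens_mul iAC jAD jAZ I' J') x ->
  im (ideal_tens_mul iBC jBD jBZ L' H') (psi x).
Proof.
move=> [t <-]; have [z zIJ <-] := ideal_tens_mul_in iAC jAD jAZ t.
by rewrite psi_j; apply/(ideal_tens_mulP iBC jBD jBZ jB_inj)/ideal_mul_map.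
Qed.

Definition mul_quot_map :
    {linear mul_quot iAC jAD jAZ I' J' -> mul_quot iBC jBD jBZ L' H'} :=
  @quot_map k k idfun V W psi _ _ mul_im_map.

Lemma mul_quot_map_pi z : mul_quot_map (mul_pi iAC jAD jAZ I' J' (jA z)) =
  mul_pi iBC jBD jBZ L' H' (jB (phi z)).
Proof. by rewrite -psi_j; apply: (quot_map_qpi mul_im_map). Qed.

(* Two lifts of phi along the augmentations differ by a map to L'. *)
Fact lift_diff_in u : L' (rval (aug_lift L L' (tor_lift0 f u)) -
  phi (val (aug_lift I I' u) : A)).
Proof.
have : qpi (comap (right_submod L) (right_submod L')) (aug_lift L L' (tor_lift0 f u)) =
  f (qpi (comap (right_submod I) (right_submod I')) (aug_lift I I' u)).
  by rewrite !qpi_aug_lift tor_lift0P.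
move=> fE; have := etrans fE (subquot_map_qpi _ _ (aug_lift I I' u)).
by move=> /qpi_eq.
Qed.

Definition lift_diff_fun u : submodule (right_submod L') :=
  insubmod (right_submod L') (lift_diff_in u).

Fact lift_diffD : {morph lift_diff_fun : u v / u + v}.
Proof.
move=> u v; apply: val_inj.
rewrite [LHS](_ : _ = rval (aug_lift L L' (tor_lift0 f (u + v))) -
  phi (val (aug_lift I I' (u + v)) : A)) //.
rewrite (linearD (tor_lift0 f)) (linearD (aug_lift L L')) (linearD (aug_lift I I')).
rewrite [phi _](rmorphD phi) opprD; apply: addrACA.
Qed.

Fact lift_diffZ a u : lift_diff_fun (a *: u) = conv_morph phi a *: lift_diff_fun u.
Proof.
apply: val_inj.
rewrite [LHS](_ : _ = rval (aug_lift L L' (tor_lift0 f (a *: u))) -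
  phi (val (aug_lift I I' (a *: u)) : A)) //.
rewrite (linearZ_LR (tor_lift0 f)) (linearZ_LR (aug_lift L L')) (linearZ_LR (aug_lift I I')).
rewrite [X in _ - X](rmorphM phi).
exact: (esym (mulrBl (phi a) (rval (aug_lift L L' (tor_lift0 f u)))
  (phi (val (aug_lift I I' u) : A)))).
Qed.

Definition lift_diff : {linear freemod A^c M -> submodule (right_submod L') |
    conv_morph phi \; *:%R} :=
  mk_semilinear lift_diffD lift_diffZ.

(** On chains naturality holds only up to a correction, which factors through [tor_d1] and so
    vanishes on cycles. *)
Lemma tor_mul_tens1 t :
  tor_mul iBC jBD jBZ jB_inj L L' H H' (tor_tens1 phi_iota f g t) =
  mul_quot_map (tor_mul iAC jAD jAZ jA_inj I I' J J' t) +
  quot_mul iBC jBD jBZ jB_inj L' H H'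
    (tens_map phi_iota lift_diff g
      (tens_mapl iA (left_quotient J J') (tor_d1 M) t)).
Proof.
elim/tens_ind: t => [|t u IHt IHu|a t IH|u n].
- by rewrite !linear0 addr0.
- by rewrite !linearD IHt IHu addrACA.
- by rewrite !linearZ_LR IH scalerDr.
have [y <-] : exists y, lquot J J' y = n by exists (repr n); apply: qpi_repr.
pose y' : submodule (left_submod H) :=
  insubmod (left_submod H) (phiJ (submod_valP y)).
have gy : g (lquot J J' y) = lquot H H' y'.
  rewrite [LHS](subquot_map_qpi _ _ y).
  by congr qpi; apply: val_inj.
rewrite tens_mapl_ptens [tens_map _ _ _ _]tens_map_ptens gy quot_mul_ptens.
rewrite tor_mul_ptens mul_quot_map_pi.
rewrite [tor_tens1 _ _ _ _]tens_map_ptens gy tor_mul_ptens.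
rewrite [tor_d1 M' _](cover_liftP (tor_lift0P f)) -linearD -jBD rmorphM -mulrDl.
by rewrite [X in _ = mul_pi _ _ _ _ _ (jB (X * _))]addrC subrK.
Qed.

Lemma tor_mul_natural t z :
  tens_mapl iA (left_quotient J J') (tor_d1 M) t = 0 ->
  tor_mul iAC jAD jAZ jA_inj I I' J J' t = mul_pi iAC jAD jAZ I' J' (jA z) ->
  tor_mul iBC jBD jBZ jB_inj L L' H H' (tor_tens1 phi_iota f g t) =
  mul_pi iBC jBD jBZ L' H' (jB (phi z)).
Proof.
by move=> t0 tz; rewrite tor_mul_tens1 t0 tz !linear0 addr0 mul_quot_map_pi.
Qed.

End TorNaturality.

Section TorRelation.
Variables (k : comPzRingType) (A : pzRingType) (iota : k -> A).
Variables (V : lmodType k) (j : A -> V).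
Hypothesis iotaC : forall a x, iota a * x = x * iota a.
Hypothesis jD : {morph j : x y / x + y}.
Hypothesis jZ : forall a x, j (iota a * x) = a *: j x.
Hypothesis j_inj : injective j.
Variables I I' J J' : ideal A.
Local Notation M := (right_quotient I I').
Local Notation N := (left_quotient J J').
Local Notation mul := (tor_mul iotaC jD jZ j_inj I I' J J').
Local Notation pi := (mul_pi iotaC jD jZ I' J').

(* The graph of the isomorphism (I'J :&: IJ') / I'J' -> Tor_1(I/I', J/J'). *)
Definition tor_rel (x : V) (w : Tor1 iota M N) : Prop :=
  exists2 t, hclass t w & mul t = pi x.

Lemma tor_relD x x' w w' :
  tor_rel x w -> tor_rel x' w' -> tor_rel (x + x') (w + w').
Proof.
move=> [t tw tx] [t' tw' tx']; exists (t + t'); first exact: hclassD.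
by rewrite !linearD tx tx'.
Qed.

Lemma tor_relZ a x w : tor_rel x w -> tor_rel (a *: x) (a *: w).
Proof.
move=> [t tw tx]; exists (a *: t); first exact: hclassZ.
by rewrite !linearZ_LR tx.
Qed.

Lemma tor_rel0r z : tor_rel (j z) 0 <-> ideal_mul I' J' z.
Proof.
rewrite -(mul_pi_eq0 iotaC jD jZ j_inj); split=> [[t t0 <-]|z0].
  have [s <-] := (hclass_eq0 t0).1 erefl; exact: tor_mul_d2.
exists 0; last by rewrite linear0 z0.
have [w w0] := hclass_ex (tens_mapl iota N (tor_d2 M))
  (linear0 (tens_mapl iota N (tor_d1 M))).
suff <- : w = 0 by [].
by apply/(hclass_eq0 w0); exists 0; rewrite linear0.
Qed.

Hypothesis I'I : forall x, I' x -> I x.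
Hypothesis J'J : forall x, J' x -> J x.

Lemma tor_rel_surj w :
  exists z, [/\ ideal_mul I' J z, ideal_mul I J' z & tor_rel (j z) w].
Proof.
have [t tw] := hclass_rep w.
have [z [zI'J zIJ' tz]] := tor_mul_in iotaC jD jZ j_inj I'I J'J (hclass_ker tw).
by exists z; split=> //; exists t.
Qed.

Hypothesis I_flat : right_flat iota (submodule (right_submod I)).
Hypothesis J_flat : left_flat iota (submodule (left_submod J)).

Lemma tor_rel0l w : tor_rel 0 w -> w = 0.
Proof.
move=> [t tw t0]; apply/(hclass_eq0 tw).
have mul0 : mul t = 0 by rewrite t0 linear0.
exact: (tor_mul_inj I'I J'J I_flat J_flat (hclass_ker tw) mul0).
Qed.

Lemma tor_rel_total z : ideal_mul I' J z -> ideal_mul I J' z ->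
  exists w, tor_rel (j z) w.
Proof.
move=> zI'J zIJ'.
have [t [t0 tz]] := tor_mul_surj iotaC jD jZ j_inj I'I J'J J_flat zI'J zIJ'.
by have [w tw] := hclass_ex (tens_mapl iota N (tor_d2 M)) t0; exists w, t.
Qed.

End TorRelation.

Section TorRelationNatural.
Variables (k : comPzRingType) (A B : pzRingType) (iA : k -> A) (iB : k -> B).
Variables (V W : lmodType k) (jA : A -> V) (jB : B -> W).
Hypothesis iAC : forall a x, iA a * x = x * iA a.
Hypothesis jAD : {morph jA : x y / x + y}.
Hypothesis jAZ : forall a x, jA (iA a * x) = a *: jA x.
Hypothesis jA_inj : injective jA.
Hypothesis iBC : forall a x, iB a * x = x * iB a.
Hypothesis jBD : {morph jB : x y / x + y}.
Hypothesis jBZ : forall a x, jB (iB a * x) = a *: jB x.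
Hypothesis jB_inj : injective jB.
Variables (phi : {rmorphism A -> B}) (psi : {linear V -> W}).
Hypothesis phi_iota : forall a, phi (iA a) = iB a.
Hypothesis psi_j : forall a, psi (jA a) = jB (phi a).
Variables (I I' J J' : ideal A) (L L' H H' : ideal B).
Hypothesis phiI : forall x, I x -> L (phi x).
Hypothesis phiI' : forall x, I' x -> L' (phi x).
Hypothesis phiJ : forall x, J x -> H (phi x).
Hypothesis phiJ' : forall x, J' x -> H' (phi x).

Lemma tor_rel_natural z w :
  tor_rel iAC jAD jAZ jA_inj (I := I) (I' := I') (J := J) (J' := J') (jA z) w ->
  tor_rel iBC jBD jBZ jB_inj (I := L) (I' := L') (J := H) (J' := H') (jB (phi z))
    (Tor1_map phi_iota (right_quotient_map phiI phiI')
       (left_quotient_map phiJ phiJ') w).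
Proof.
move=> [t tw tz].
exists (tor_tens1 phi_iota (right_quotient_map phiI phiI')
       (left_quotient_map phiJ phiJ') t); last first.
  exact: (tor_mul_natural iBC jBD jBZ jB_inj phi_iota psi_j
    phiI phiI' phiJ phiJ' (hclass_ker tw) tz).
have [t0 ->] := tw.
eexists; rewrite [LHS]subquot_map_qpi; congr qpi; apply: val_inj.
Qed.

End TorRelationNatural.

(** * Functorial ideals *)

Section FunctorialIdealsExact.
Variables (k : comPzRingType) (G : grp).

Definition ideal_cap (A : pzRingType) (I J : ideal A) : ideal A.
Proof.
exists (fun x => I x /\ J x).
- by split; apply: ideal0.
- by move=> x y [Ix Jx] [Iy Jy]; split; apply: idealD.
- by move=> r x [Ix Jx]; split; apply: Defs.idealMl.
- by move=> r x [Ix Jx]; split; apply: Defs.idealMr.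
Defined.

Definition fideal_cap (a b : fideal k G) : fideal k G.
Proof.
exists (fun c => ideal_cap (a c) (b c)) => c d f x [ax bx].
by split; apply: fi_map.
Defined.

Definition fideal_elt (a : fideal k G) c (x : pr_alg k c) (ax : a c x) :
  fideal_functor a c := insubmod (galg_submod (a c)) ax.

Definition fideal_incl (a b : fideal k G) (ab : fideal_sub a b) :
  nattrans (fideal_functor a) (fideal_functor b).
Proof.
apply: (@mk_nattrans k (Pres G) (fideal_functor a) (fideal_functor b)
  (fun c x => fideal_elt (ab c _ (submod_valP x)))).
- by move=> c x y; apply: val_inj.
- by move=> c r x; apply: val_inj.
- by move=> c d f x; apply: val_inj.
Defined.

Section Sum.
Variables a b : fideal k G.
Local Notation cap := (fideal_functor (fideal_cap a b)).
Local Notation sum := (fideal_functor (fideal_add a b)).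
Local Notation prod := (prod_functor (fideal_functor a) (fideal_functor b)).

Definition cap_pair : nattrans cap prod :=
  nat_pair (fideal_incl (a := fideal_cap a b) (b := a) (fun c x xab => xab.1))
    (fideal_incl (a := fideal_cap a b) (b := b) (fun c x xab => xab.2)).

Fact fideal_addl : fideal_sub a (fideal_add a b).
Proof.
by move=> c x ax; exists x, 0; split; [|apply: ideal0|rewrite addr0].
Qed.

Fact fideal_addr : fideal_sub b (fideal_add a b).
Proof.
by move=> c x bx; exists 0, x; split; [apply: ideal0| |rewrite add0r].
Qed.

Definition pair_sub : nattrans prod sum :=
  nat_sub (nat_comp (fideal_incl fideal_addl) (prod_fst _ _))
    (nat_comp (fideal_incl fideal_addr) (prod_snd _ _)).

Lemma cap_sum_exact : short_exact cap_pair pair_sub.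
Proof.
split.
- by move=> c x y [xy]; apply: val_inj.
- move=> c [x y]; split=> [xy|[z [<- <-]]]; last first.
    by apply: val_inj; rewrite [LHS](_ : _ = val z - val z) // subrr.
  have {}xy : val x = val y by apply: subr0_eq; apply: (congr1 val xy).
  have xab : fideal_cap a b c (val x).
    by split; [apply: (submod_valP x) | rewrite xy; apply: (submod_valP y)].
  by exists (fideal_elt xab); congr pair; apply: val_inj.
- move=> c z; have [x [y [ax bY zE]]] := submod_valP z.
  exists (fideal_elt ax, - fideal_elt bY); apply: val_inj.
  by rewrite [LHS](_ : _ = x - - y) // opprK.
Qed.

End Sum.
End FunctorialIdealsExact.

Section ProductExact.
Variables (k : comPzRingType) (C : category) (F H : functor k C).

Lemma prod_exact :
  short_exact (nat_pair (nat_id F) (nat_zero F H)) (prod_snd F H).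
Proof.
split=> [c x y [] // | c [x y] | c y]; last by exists (0, y).
by split=> [y0 | [z <-]] //; exists x; congr pair; apply: (esym y0).
Qed.

End ProductExact.

Section TorExact.
Variables (k : comPzRingType) (G : grp).
Variables a a' b b' : fideal k G.
Hypothesis a'a : fideal_sub a' a.
Hypothesis b'b : fideal_sub b' b.

Lemma ideal_mul_sub (A : pzRingType) (I I' J J' : ideal A) :
  (forall x, I x -> I' x) -> (forall x, J x -> J' x) ->
  forall x, ideal_mul I J x -> ideal_mul I' J' x.
Proof.
move=> II' JJ' x [s sIJ ->]; exists s => // p /sIJ[Ip Jp].
by split; [apply: II' | apply: JJ'].
Qed.

Local Notation a'b := (fideal_mul a' b).
Local Notation ab' := (fideal_mul a b').
Local Notation a'b' := (fideal_mul a' b').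
Local Notation cap := (fideal_cap a'b ab').

Fact mul_sub_cap : fideal_sub a'b' cap.
Proof.
move=> c x x_mul; split; first exact: ideal_mul_sub (@b'b c) _ x_mul.
exact: ideal_mul_sub (@a'a c) _ _ x_mul.
Qed.

Hypothesis a_flat : forall c : Pres G,
  right_flat (galg_scalar (prF c)) (submodule (right_submod (a c))).
Hypothesis b_flat : forall c : Pres G,
  left_flat (galg_scalar (prF c)) (submodule (left_submod (b c))).

Let gmod (c : Pres G) : lmodType k :=
  GRing.Lmodule.clone k (galg k (prF c)) _.
Let gid (c : Pres G) (x : pr_alg k c) : gmod c := x.

Let gidC (c : Pres G) (r : k) (x : pr_alg k c) :
  galg_scalar (prF c) r * x = x * galg_scalar (prF c) r.
Proof. exact: galg_scalarC. Qed.

Let gidD (c : Pres G) : {morph @gid c : x y / x + y}.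
Proof. by []. Qed.

Let gidZ (c : Pres G) (r : k) (x : pr_alg k c) :
  gid (galg_scalar (prF c) r * x) = r *: gid x.
Proof. exact: galg_scalarE. Qed.

Let gid_inj (c : Pres G) : injective (@gid c).
Proof. by []. Qed.

Let rel (c : Pres G) (x : fideal_functor cap c) (w : ftor a a' b b' c) : Prop :=
  @tor_rel k (pr_alg k c) (galg_scalar (prF c)) (gmod c) (@gid c)
    (@gidC c) (@gidD c) (@gidZ c) (@gid_inj c)
    (a c) (a' c) (b c) (b' c) (gid (val x)) w.

(** Flatness enters through the totality and single-valuedness of [rel]; its kernel and surjectivity
    then give the two exactness statements for the map out of the intersection. *)
Lemma cap_tor_exact : exists g : nattrans (fideal_functor cap) (ftor a a' b b'),
  short_exact (fideal_incl mul_sub_cap) g.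
Proof.
have ex_g c : exists g : {linear fideal_functor cap c -> ftor a a' b b' c},
    forall x w, rel x w <-> g x = w.
  apply: linear_of_relation.
  - by move=> x x' w w'; apply: tor_relD.
  - by move=> r x w; apply: tor_relZ.
  - move=> x; have [xa'b xab'] := submod_valP x.
    exact: (tor_rel_total (@gidC c) (@gidD c) (@gidZ c) (@gid_inj c)
      (@a'a c) (@b'b c) (@b_flat c) xa'b xab').
  - move=> w; exact: (tor_rel0l (@a'a c) (@b'b c) (@a_flat c) (@b_flat c)).
have [g gE] := dfun_choice ex_g.
have gN c d (m : mor c d) x :
    g d (fmap (fideal_functor cap) m x) = fmap (ftor a a' b b') m (g c x).
  have /gE xw : g c x = g c x by [].
  apply/gE; apply: (tor_rel_natural (@gidC d) (@gidD d) (@gidZ d) (@gid_inj d)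
    (phi := pr_map k m)
    (psi := mk_linear (galg_mapD (phF m)) (galg_mapZ (phF m)))) xw => //.
exists (NatTrans gN); split.
- by move=> c x y [xy]; apply: val_inj.
- move=> c x; split=> [/gE /tor_rel0r xa'b' | [y <-]].
    by exists (fideal_elt (a := a'b') xa'b'); apply: val_inj.
  by apply/gE/tor_rel0r; apply: (submod_valP y).
- move=> c w.
  have [z [za'b zab' zw]] := tor_rel_surj (@gidC c) (@gidD c) (@gidZ c)
    (@gid_inj c) (@a'a c) (@b'b c) w.
  have zcap : cap c z by [].
  by exists (fideal_elt zcap); apply/gE.
Qed.

End TorExact.

(** * Exactness, vanishing and the final assembly *)

Section ModuleExact.
Variable k : comPzRingType.

Lemma linear_inverse (U V : lmodType k) (f : {linear U -> V}) : bijective f ->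
  exists g : {linear V -> U}, cancel f g /\ cancel g f.
Proof.
move=> [g fK gK]; have gD : {morph g : x y / x + y}.
  by move=> x y; rewrite -{1}(gK x) -{1}(gK y) -linearD fK.
have gZ a x : g (a *: x) = a *: g x by rewrite -{1}(gK x) -linearZ_LR fK.
by exists (mk_linear gD gZ).
Qed.

Variables (U V W : lmodType k) (f : {linear U -> V}) (g : {linear V -> W}).
Hypothesis fg : exact_at f g.

Lemma exact_zero : zero_module U -> zero_module W -> zero_module V.
Proof.
move=> U0 W0 v; have [u <-] := (fg v).1 (W0 _).
by rewrite (U0 u) linear0.
Qed.

Lemma exact_ker0 : zero_module U -> forall v, g v = 0 -> v = 0.
Proof. by move=> U0 v /fg[u <-]; rewrite (U0 u) linear0. Qed.

Lemma exact_surj : zero_module W -> forall v, exists u, f u = v.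
Proof. by move=> W0 v; apply/fg; apply: W0. Qed.

End ModuleExact.

Section DerivedLimitVanishing.
Variables (k : comPzRingType) (G : grp).

Lemma derlim0_zero (C : category) (F : functor k C) :
  zero_module (derlim 0 F) <-> zero_module (lim F).
Proof.
have [t [t' tK t'K]] := lim_derlim0 (cofree_resolution F).
split=> F0 x; first by rewrite -[x]tK (F0 (t x)) -(linear0 t) tK.
by rewrite -[LHS]t'K (F0 (t' x)) linear0.
Qed.

Lemma lim_sub_zero (a b : fideal k G) : fideal_sub a b ->
  zero_module (lim (fideal_functor b)) -> zero_module (lim (fideal_functor a)).
Proof.
move=> ab b0 x; apply: lim_eq => c.
have x0 : fideal_incl ab c (val x c) = 0.
  exact: (congr1 (fun u : lim _ => val u c) (b0 (lim_map (fideal_incl ab) x))).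
by apply: val_inj; apply: (congr1 val x0).
Qed.

End DerivedLimitVanishing.



Theorem proposition5p12
  (k : comPzRingType) (G : grp)
  (a a' b b' : fideal k G)
  (a'a : fideal_sub a' a) (b'b : fideal_sub b' b)
  (a_flat : forall c : Pres G,
     right_flat (galg_scalar (prF c)) (submodule (right_submod (a c))))
  (b_flat : forall c : Pres G,
     left_flat (galg_scalar (prF c)) (submodule (left_submod (b c)))) :
  let Lim i := @derlim k (Pres G) i in
  let a'b := fideal_functor (fideal_mul a' b) in
  let ab' := fideal_functor (fideal_mul a b') in
  let ab := fideal_functor (fideal_mul a b) in
  let a'b' := fideal_functor (fideal_mul a' b') in
  let sum := fideal_functor (fideal_add (fideal_mul a' b) (fideal_mul a b')) in
  let T := ftor a a' b b' in
  (zero_module (Lim 1%N a'b) -> zero_module (Lim 1%N ab') -> zero_module (lim ab) ->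
   isomorphic (Lim 1%N a'b') (lim T))
  /\
  (forall n : nat, (1 <= n)%N ->
   (forall i : nat, (i <= n.+1)%N ->
      [/\ zero_module (Lim i a'b), zero_module (Lim i ab')
        & (0 < i)%N -> zero_module (Lim i.-1 ab)]) ->
   exists (alpha : forall i : nat, {linear Lim i T -> Lim i.+1 a'b'})
          (beta : forall i : nat, {linear Lim i.+1 a'b' -> Lim i sum})
          (gamma : forall i : nat, {linear Lim i sum -> Lim i.+1 T}),
     injective (alpha 1%N)
     /\ (forall i : nat, (1 <= i < n)%N ->
         [/\ exact_at (alpha i) (beta i),
             exact_at (beta i) (gamma i)
           & exact_at (gamma i) (alpha i.+1)])).

Proof.
move=> Lim a'b ab' ab a'b' sum T.
have sum_ab : fideal_sub (fideal_add (fideal_mul a' b) (fideal_mul a b'))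
    (fideal_mul a b).
  move=> c _ [x [y [xa'b yab' ->]]]; apply: idealD.
    exact: ideal_mul_sub (@a'a c) _ _ xa'b.
  exact: ideal_mul_sub _ (@b'b c) _ yab'.
have cap_ab : fideal_sub (fideal_cap (fideal_mul a' b) (fideal_mul a b'))
    (fideal_mul a b).
  by move=> c x [xa'b _]; exact: ideal_mul_sub (@a'a c) _ _ xa'b.
(* The long exact sequence of the split extension stands in for additivity of [derlim]: it gives the
   vanishing for the product. *)
have [fP [gP [dP prodE]]] := derlim_long_exact (prod_exact a'b ab').
have prod0 i : zero_module (Lim i a'b) -> zero_module (Lim i ab') ->
    zero_module (Lim i (prod_functor a'b ab')).
  by have [e _ _] := prodE i; apply: exact_zero e.
have [fS [gS [dS sumE]]] := derlim_long_exact
  (cap_sum_exact (fideal_mul a' b) (fideal_mul a b')).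
have [q q_exact] := cap_tor_exact a'a b'b a_flat b_flat.
have [fT [gT [dT torE]]] := derlim_long_exact q_exact.
split=> [a'b0 ab'0 ab0 | n n_gt0 vanish].
  have sum0 : zero_module (Lim 0 sum).
    exact/derlim0_zero/(lim_sub_zero sum_ab ab0).
  have cap0 := (derlim0_zero _).2 (lim_sub_zero cap_ab ab0).
  have cap1 : zero_module (Lim 1 (fideal_functor
      (fideal_cap (fideal_mul a' b) (fideal_mul a b')))).
    have [_ _ e] := sumE 0; exact: exact_zero e sum0 (prod0 1 a'b0 ab'0).
  have [_ ker_dT im_dT] := torE 0.
  have dT_bij : bijective (dT 0).
    by apply: linear_bij; [apply: exact_ker0 ker_dT cap0 | apply: exact_surj im_dT cap1].
  have [t t_bij] := lim_derlim0 (cofree_resolution T).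
  have [s [s1 s2]] := linear_inverse (bij_comp dT_bij t_bij : bijective (dT 0 \o t)).
  by exists s; exists (dT 0 \o t).
have sum0 : zero_module (Lim 0 sum).
  have [_ _ ab0] := vanish 1 isT.
  exact/derlim0_zero/(lim_sub_zero sum_ab)/derlim0_zero/ab0.
have prod_zero i : (i <= n.+1)%N -> zero_module (Lim i (prod_functor a'b ab')).
  by move=> /vanish[? ? _]; apply: prod0.
(* [dS i] sits between the derived limits of the product in degrees [i] and [i + 1], whence the
   bound [i <= n]. *)
have dS_bij i : (i <= n)%N -> bijective (dS i).
  move=> i_le_n; have [_ ker_dS im_dS] := sumE i; apply: linear_bij.
    exact: exact_ker0 ker_dS (prod_zero i (leqW i_le_n)).
  exact: exact_surj im_dS (prod_zero i.+1 i_le_n).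
(* The maps of the conclusion are indexed by every natural number, so the inverse of [dS i] is
   completed by zero for [i > n]. *)
have /dfun_choice[s sK] i : exists s : {linear Lim i.+1 (fideal_functor
      (fideal_cap (fideal_mul a' b) (fideal_mul a b'))) -> Lim i sum},
    (i <= n)%N -> cancel (dS i) s /\ cancel s (dS i).
  have [le_i_n | _] := boolP (i <= n)%N; last by exists \0.
  by have [s sK] := linear_inverse (dS_bij i le_i_n); exists s.
(* These are the maps of the sequence for the intersection, with its [lim^(i+1)] replaced by [lim^i]
   of the sum through [dS i] and [s i]. *)
exists dT, (fun i => s i \o fT i.+1), (fun i => gT i.+1 \o dS i); split.
  move=> x y xy; apply/eqP; rewrite -subr_eq0; apply/eqP.
  (* The kernel of [dT 1] is the image of [lim^1] of the intersection, which vanishes since [dS 0]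
     identifies it with [lim^0] of the sum. *)
  have [_ ker_dT _] := torE 1.
  have /ker_dT[v <-] : dT 1 (x - y) = 0 by rewrite linearB xy subrr.
  by rewrite -[v](sK 0 isT).2 (sum0 (s 0 v)) !linear0.
move=> i /andP[_ /ltnW i_le_n]; have [dSK sdK] := sK i i_le_n.
have [_ _ dT_fT] := torE i; have [fT_gT gT_dT _] := torE i.+1.
have s_eq0 v : s i v = 0 <-> v = 0.
  by split=> [sv0|->]; [rewrite -[LHS]sdK sv0 linear0 | apply: linear0].
split=> y.
- exact: (iff_trans (s_eq0 (fT i.+1 y)) (dT_fT y)).
- apply: (iff_trans (fT_gT (dS i y))); split=> -[x xy]; exists x.
    exact: (etrans (congr1 (s i) xy) (dSK y)).
  by rewrite -[LHS]sdK; congr (dS i _).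
- apply: (iff_trans (gT_dT y)); split=> -[x <-]; last by exists (dS i x).
  by exists (s i x); congr (gT i.+1 _); apply: sdK.
Qed.
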